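(* Let $P\in\mathbb K[X_1,\dots,X_n,U_1]$, $f=P(X_1,\dots,X_n,e^{X_1})$, $V=\mathrm{Zer}(f)\subset\mathbb R^n$, and $m=\dim V$. Let $\pi:\mathbb R^{n+1}\to\mathbb R^n$ be the projection along $U_1$. Let $W\subset\mathbb R^{n+1}$ be an admissible set for $V$ and let $W^{(1)},\dots,W^{(t)}$ be all the irreducible components of the algebraic set $W$. Then every $m$-dimensional irreducible component of $V$ either coincides with $\pi\left(W^{(i)}\cap\mathrm{Zer}(U_1-e^{X_1})\right)$ for some $1\le i\le t$, or is an algebraic subset of $\mathrm{Zer}(X_1)$.
   Context: $\mathbb K\subset\mathbb R$ is a fixed real algebraic extension of $\mathbb Q$. $\mathrm{Zer}(\cdot)$ denotes the common real zero set of the listed functions. Real algebraic sets are zero sets of finitely many polynomials over $\mathbb K$, irreducibility of algebraic sets is over $\mathbb K$. Here exponential sets are the zero sets in $\mathbb R^n$ of finitely many elements of the ring $\mathbb K[\underline X,e^{X_1}]$ of functions $Q(X_1,\dots,X_n,e^{X_1})$, $Q\in\mathbb K[X_1,\dots,X_n,U_1]$ (single exponential). They are the closed sets of a Noetherian topology on $\mathbb R^n$; a non-empty exponential set is irreducible if it is not a union of two proper exponential subsets, and every non-empty exponential set is uniquely a finite union of irreducible exponential sets, none contained in another, called its irreducible components. A real algebraic set $W\subset\mathbb R^{n+1}$ is called admissible for $V=\mathrm{Zer}(f)$, $f=P(\underline X,e^{X_1})$, $m=\dim V$, if $V=\pi\left((W\cap\mathrm{Zer}(U_1-e^{X_1}))\cup\mathrm{Zer}(P,X_1,U_1-1)\right)$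 and $\dim W\le m+1$. Dimension. For an exponential set $V\subset\mathbb R^n$ let $I(V)=(f_1,\dots,f_k)$ be the (finitely generated) ideal of functions in the ring vanishing on $V$, let $\mathrm{rank}(V,\mathbf x)$ be the rank of the Jacobian matrix $\partial(f_1,\dots,f_k)/\partial(X_1,\dots,X_n)$ at $\mathbf x$, and $\mathrm{rank}\,I(V)=\sup_{\mathbf x\in V}\mathrm{rank}(V,\mathbf x)$. If $V$ is irreducible, $\mathbf x\in V$ is regular if $\mathrm{rank}(V,\mathbf x)=\mathrm{rank}\,I(V)$; if $V$ is reducible, $\mathbf x$ is regular if exactly one irreducible component contains $\mathbf x$ and $\mathbf x$ is regular on that component. $\mathrm{Reg}(V)$ is the set of regular points, $\mathrm{Sing}(V)=V\setminus\mathrm{Reg}(V)$ (an exponential set). The non-singular stratification is the finite partition $V=\mathrm{Reg}(V)\cup\mathrm{Reg}(\mathrm{Sing}(V))\cup\cdots$ into real analytic manifolds, and $\dim V$ is the maximal dimension of these manifolds. *)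

(* Defs.v *)
From HB Require Import structures.
From mathcomp Require Import all_boot all_order all_algebra.
From mathcomp Require mpoly.
From mathcomp Require Import all_classical all_reals all_analysis.
Import Order.TTheory GRing.Theory Num.Theory.
Import numFieldNormedType.Exports.

Set Implicit Arguments.
Unset Strict Implicit.
Unset Printing Implicit Defensive.

Local Open Scope classical_set_scope.
Local Open Scope ring_scope.

(* [mpoly] is not imported: its notations clash with those of the analysis
   library. *)
Notation "{ 'mpoly' K [ n ] }" := (mpoly.mpoly n K)
  (at level 0, K at level 2, n at level 100, format "{ 'mpoly'  K [ n ] }")
  : type_scope.

Section ZeroSets.
Context {R : realType} {T : Type}.

Definition Zer (fs : seq (T -> R)) : set T :=
  [set x | forall i, (i < size fs)%N -> fs`_i x = 0].

Definition zero_set (A : set (T -> R)) (V : set T) : Prop :=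
  exists2 fs : seq (T -> R),
    forall i, (i < size fs)%N -> A fs`_i & V = Zer fs.

End ZeroSets.

Section Irreducibility.
Context {T : Type}.
Variable closed : set (set T).

Definition irreducible (V : set T) : Prop :=
  [/\ closed V, V !=set0 &
      forall V1 V2, closed V1 -> closed V2 -> V = V1 `|` V2 ->
        V1 = V \/ V2 = V].

Definition irr_decomposition (V : set T) (C : set (set T)) : Prop :=
  [/\ finite_set C,
      forall Z, C Z -> irreducible Z,
      forall Z Z', C Z -> C Z' -> Z `<=` Z' -> Z = Z' &
      V = \bigcup_(Z in C) Z].

Definition irr_component (V Z : set T) : Prop :=
  exists2 C, irr_decomposition V C & C Z.

End Irreducibility.

Section Dimension.
Context {R : realType} {N : nat}.
Notation pt := 'rV[R]_N.+1.

(* [A] is a ring of functions on R^(N+1).  It is instantiated below both with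
   the exponential ring and with the polynomial ring, so that exponential and
   real algebraic sets have their dimension from the same construction. *)
Variable A : set (pt -> R).

Definition vanishing_ideal (V : set pt) : set (pt -> R) :=
  [set f | A f /\ forall x, V x -> f x = 0].

Definition generates (fs : seq (pt -> R)) (I : set (pt -> R)) : Prop :=
  (forall i, (i < size fs)%N -> I fs`_i) /\
  forall f, I f -> exists2 a : 'I_(size fs) -> pt -> R,
    forall i, A (a i) & f = fun x => \sum_(i < size fs) a i x * fs`_i x.

(* A choice of f_1, ..., f_k; at points of [V] the rank below does not depend
   on it. *)
Definition ideal_gens (V : set pt) : seq (pt -> R) :=
  xget [::] [set fs | generates fs (vanishing_ideal V)].

(* ['J] is the transpose of the usual Jacobian matrix. *)
Definition rank_at (V : set pt) (x : pt) : nat :=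
  let fs := ideal_gens V in
  \rank ('J (fun y : pt => \row_(i < size fs) fs`_i y) x).

Definition rank_ideal (V : set pt) : nat :=
  \max_(r < N.+2 | `[< exists2 x, V x & rank_at V x = r >]) r.

Definition reg_irr (V : set pt) : set pt :=
  [set x | V x /\ rank_at V x = rank_ideal V].

Definition Reg (V : set pt) : set pt :=
  [set x |
    (irreducible (zero_set A) V /\ reg_irr V x) \/
    (~ irreducible (zero_set A) V /\
     exists Z, [/\ irr_component (zero_set A) V Z, reg_irr Z x &
       forall Z', irr_component (zero_set A) V Z' -> Z' x -> Z' = Z])].

Definition Sing (V : set pt) : set pt := V `\` Reg V.

Definition stratum (V : set pt) (k : nat) : set pt := Reg (iter k Sing V).

(* Near [x], [M] is a d-dimensional submanifold of R^(N+1): it is cut out by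
   c = N+1-d independent equations.  The strata are real analytic manifolds;
   class C^1 already determines their dimension. *)
Definition submanifold_at (d : nat) (M : set pt) (x : pt) : Prop :=
  exists (c : nat) (U : set pt) (g : pt -> 'rV[R]_c),
    [/\ (c + d)%N = N.+1, open U, U x & M x] /\
    [/\ forall y, U y -> differentiable g y,
        forall y, U y -> {for y, continuous (fun z => 'J g z)},
        \rank ('J g x) = c &
        forall y, U y -> (M y <-> g y = 0)].

(* The maximum of the local dimensions of all strata (a stratum may have parts
   of several dimensions).  The empty set gets the value 0. *)
Definition dim (V : set pt) : nat :=
  \max_(d < N.+2 | `[< exists k x,
      stratum V k x /\ submanifold_at d (stratum V k) x >]) d.

End Dimension.

Section ExponentialSets.
Context {R : realType} {K : fieldType}.
Variable iota : {rmorphism K -> R}.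

Definition peval {N : nat} (Q : {mpoly K[N]}) (x : 'rV[R]_N) : R :=
  mpoly.mmap iota (fun i => x 0 i) Q.

Definition poly_ring {N : nat} : set ('rV[R]_N -> R) :=
  [set f | exists Q : {mpoly K[N]}, f = peval Q].

Definition algebraic_set {N : nat} (W : set 'rV[R]_N) : Prop :=
  zero_set poly_ring W.

Definition alg_dim {N : nat} (W : set 'rV[R]_N.+1) : nat :=
  dim poly_ring W.

Context {n : nat}.

(* Points of R^(n+2) are (X_1, ..., X_(n+1), U_1): the coordinate [ord0] is
   X_1, and U_1 is the last one, [ord_max]. *)
Definition X1 {N : nat} (x : 'rV[R]_N.+1) : R := x 0 ord0.
Definition U1 (w : 'rV[R]_n.+2) : R := w 0 ord_max.

Definition proj_U1 (w : 'rV[R]_n.+2) : 'rV[R]_n.+1 :=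
  \row_j w 0 (lift ord_max j).

Definition exp_lift (x : 'rV[R]_n.+1) : 'rV[R]_n.+2 :=
  \row_i (if unlift ord_max i is Some j then x 0 j else expR (X1 x)).

Definition exp_eval (Q : {mpoly K[n.+2]}) (x : 'rV[R]_n.+1) : R :=
  peval Q (exp_lift x).

Definition exp_ring : set ('rV[R]_n.+1 -> R) :=
  [set f | exists Q : {mpoly K[n.+2]}, f = exp_eval Q].

Definition exponential_set (V : set 'rV[R]_n.+1) : Prop :=
  zero_set exp_ring V.

Definition exp_dim (V : set 'rV[R]_n.+1) : nat := dim exp_ring V.

Definition exp_graph : set 'rV[R]_n.+2 := Zer [:: fun w => U1 w - expR (X1 w)].

Definition admissible (P : {mpoly K[n.+2]}) (W : set 'rV[R]_n.+2) : Prop :=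
  let V := Zer [:: exp_eval P] in
  [/\ algebraic_set W,
      V = proj_U1 @` ((W `&` exp_graph) `|`
                   Zer [:: peval P; X1; fun w => U1 w - 1]) &
      (alg_dim W <= (exp_dim V).+1)%N].

End ExponentialSets.

(* Main.v *)
(* Let Z be the component and let transcendence degree be measured by subsets of
   the coordinates: T is independent on a set S if no nonzero polynomial in the
   coordinates of T vanishes on S. By irreducibility Z lies in {X_1 = 0}, where
   putting U_1 = 1 shows that it is algebraic, or the lift of Z to the graph of
   exp lies in a component Wi of W. In the second case some m + 1 coordinates are
   independent on the lift. To see this, take a C^1 piece of dimension m of Z and
   apply the implicit function theorem. K is countable, so by Baire's theorem the
   m parameters can be chosen with no algebraic relation over K. If X_1 can be a
   parameter, then e^{X_1} is independent of the m of them. Otherwise X_1 is a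
   constant c on the piece; if c <> 0 then c or e^c is transcendental by
   Lindemann's theorem, and if c = 0 the m parameters are not maximal, since
   otherwise some nonzero polynomial in them would be a multiple of X_1 modulo
   I(Z) and so vanish on the piece. (For m = 0 Lindemann's theorem at one point
   off {X_1 = 0} suffices.)
   If the lift of Z is not all of Wi on the graph, some polynomial h vanishes on
   the lift but not on Wi. Were the m + 1 coordinates maximal on Wi,
   eliminating the others would give a multiple of h which is, modulo I(Wi), a
   nonzero polynomial in these coordinates vanishing on the lift. So m + 2
   coordinates are independent on Wi, and the Jacobian criterion at a smooth
   point of Wi gives dim W >= m + 2, against admissibility. *)
From HB Require Import structures.
Require Import Defs.
From mathcomp Require Import all_boot all_order all_algebra.
From mathcomp Require mpoly.
From mathcomp Require Import all_classical all_reals all_analysis.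
From mathcomp Require Import perm ring lra zify.
Import (canonicals, coercions) mpoly.
Import Order.TTheory GRing.Theory Num.Theory.
Import numFieldNormedType.Exports.
Set Implicit Arguments.
Unset Strict Implicit.
Unset Printing Implicit Defensive.
Local Open Scope classical_set_scope.
Local Open Scope ring_scope.

(** * Lindemann's theorem for real exponents *)

(** Since K and all points are real, Lindemann's theorem is required only for one real exponent a
    with a and e^a both assumed algebraic. Hermite's approximants on the real line and the mean
    value theorem then suffice, and norms of integer matrices acting on Q(a, e^a) replace
    conjugates. Measuring by sets of coordinates keeps everything in one polynomial ring in n + 2
    variables. There the ideal of the lift of Z is prime and contains the ideal of Wi, so a set
    independent on Z is independent on Wi and can be enlarged there. Only nested sets of coordinates
    are compared, so no exchange property enters. The dimension defined by strata enters through two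
    one-sided facts: positive dimension of Z gives one point near which a stratum is a C^1
    submanifold, and a generic point of Wi bounds dim W from below. The C^1 equations of the piece
    bear no relation to K, which is why its generic points come from category and not from algebra.
    For this it is enough that every parameter value near the base point is attained on the piece;
    no smooth parametrization is constructed. *)

Section HermitePade.
Context {R : realType}.
Implicit Types (A B : {poly R}) (L u b d x : R).

(** The value at 0 of the i-th derivative. In these coordinates differentiation and integration are
    shifts. *)
Definition fact_coef A i : R := A`_i *+ i`!.

(** This condition and [coef_bounded] are graded by i, with weights L^i and 2^i: passing to the
    derivative improves u to u / L and b to b / 2, which makes up for the loss in solving an
    equation for the derivative. *)
Definition coef_integral L u A := forall i, u * fact_coef A i / L ^+ i \is a Num.int.

Definition coef_bounded b A := forall i, 2 ^+ i * `|fact_coef A i| <= b.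

Lemma fact_coef_deriv A i : fact_coef A^`() i = fact_coef A i.+1.
Proof. by rewrite /fact_coef coef_deriv -mulrnA factS. Qed.

(* B is the sum of the (-1)^k A^(k) / d^(k+1); each derivative is absorbed by the
   factorial in [fact_coef] and costs one factor L / d. *)
Lemma first_order_solution L u b d A : L != 0 -> L / d \is a Num.int -> 1 <= `|d| ->
  coef_integral L u A -> coef_bounded b A ->
  exists B, [/\ B^`() + d *: B = A, (size B <= size A)%N,
    coef_integral L (u * L) B & coef_bounded (2 * b) B].
Proof.
move=> L0 Ld d1.
have d0 : d != 0 by apply: contraTneq d1 => ->; rewrite normr0 ler10.
have [n] := ubnP (size A); elim: n A u b => // n IH A u b sA HA bA.
have [->|A0] := eqVneq A 0.
  exists 0; split; rewrite ?linear0 ?scaler0 ?addr0 ?size_poly0 //.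
    by move=> i; rewrite /fact_coef coef0 mul0rn mulr0 mul0r.
  move=> i; rewrite /fact_coef coef0 mul0rn normr0 mulr0.
  by have := bA 0%N; rewrite mul1r; have := normr_ge0 (fact_coef A 0); lra.
have szA' : (size A^`() < size A)%N by rewrite lt_size_deriv.
case: (IH A^`() (u / L) (b / 2)) => [||i|B0 [E0 sz0 I0 b0]].
- exact: leq_trans szA' sA.
- move=> i; rewrite fact_coef_deriv.
  rewrite (_ : _ / _ = u * fact_coef A i.+1 / L ^+ i.+1); first exact: HA.
  by rewrite exprS; field; rewrite ?L0 ?expf_neq0.
- rewrite fact_coef_deriv ler_pdivlMr//.
  by apply: le_trans (bA i.+1); rewrite exprS; lra.
have fcB i : fact_coef (d^-1 *: (A - B0)) i = (fact_coef A i - fact_coef B0 i) / d.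
  by rewrite /fact_coef coefZ coefB -mulrnAr mulrnBl mulrC.
exists (d^-1 *: (A - B0)); split.
- rewrite derivZ derivB -{1}E0 addrAC subrr add0r.
  by rewrite !scalerA mulVf ?mulfV// !scale1r addrC subrK.
- rewrite (leq_trans (size_scale_leq _ _))// (leq_trans (size_polyD _ _))//.
  by rewrite size_polyN geq_max leqnn (leq_trans sz0)// ltnW.
- move=> i; rewrite fcB.
  have -> : u * L * ((fact_coef A i - fact_coef B0 i) / d) / L ^+ i =
      L / d * (u * fact_coef A i / L ^+ i - u / L * L * fact_coef B0 i / L ^+ i).
    by field; rewrite ?L0 ?d0 ?expf_neq0.
  by rewrite rpredM// rpredB.
- move=> i; rewrite fcB normrM normfV mulrA ler_pdivrMr ?(lt_le_trans ltr01)//.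
  have h1 := bA i; have h2 := b0 i.
  have h3 : 2 ^+ i * `|fact_coef A i - fact_coef B0 i| <= 2 * b.
    apply: (@le_trans _ _ (2 ^+ i * (`|fact_coef A i| + `|fact_coef B0 i|))).
      by rewrite ler_wpM2l ?exprn_ge0// ler_normB.
    by rewrite mulrDr; lra.
  apply: le_trans h3 _; rewrite ler_peMr//.
  by rewrite mulr_ge0 // (le_trans _ h1) // mulr_ge0 // exprn_ge0.
Qed.

(** For i = 0 the quotient has denominator 0 and hence is 0: this is the primitive that vanishes at
    0. *)
Definition primitive A : {poly R} := \poly_(i < (size A).+1) (A`_i.-1 / i%:R).

Lemma fact_coef_primitive0 A : fact_coef (primitive A) 0 = 0.
Proof. by rewrite /fact_coef coef_poly /= invr0 mulr0 mul0rn. Qed.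

Lemma fact_coef_primitiveS A i : fact_coef (primitive A) i.+1 = fact_coef A i.
Proof.
rewrite /fact_coef coef_poly ltnS factS mulrnA; case: ltnP => [_|h].
  by rewrite -[_ / _ *+ _]mulr_natr mulfVK// pnatr_eq0.
by rewrite mul0rn nth_default.
Qed.

Lemma deriv_primitive A : (primitive A)^`() = A.
Proof.
apply/polyP => i; apply: (mulIf (_ : i`!%:R != 0 :> R)).
  by rewrite pnatr_eq0 -lt0n fact_gt0.
rewrite !mulr_natr -[LHS]/(fact_coef _ i).
by rewrite fact_coef_deriv fact_coef_primitiveS.
Qed.

End HermitePade.

Section HermitePadeSystems.
Context {R : realType}.
Implicit Types (A B : {poly R}) (L u b d x : R).

Lemma mean_value (f df : R -> R) (a b : R) :
  (forall x, is_derive x 1 f (df x)) -> a < b ->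
  exists2 c, a < c < b & f b - f a = df c * (b - a).
Proof.
move=> fdf ab.
have [|c] := @MVT R f df a b ab (fun x _ => fdf x).
  apply: derivable_within_continuous => x _.
  by have [] := fdf x.
by rewrite in_itv => /= cab E; exists c.
Qed.

Lemma is_derive_expRM (k y : R) :
  is_derive y 1 (fun y : R => expR (k * y)) (k * expR (k * y)).
Proof.
rewrite mulrC; apply: (@is_derive1_comp _ expR (fun y : R => k * y)).
by apply: is_derive_eq; rewrite /GRing.scale/= mulr1.
Qed.

(** The integrating factor E = e^(-cx) gives (F E)' = G E, so that both bounds follow from the mean
    value theorem on [0, x]. As c <= l, the derivative of the majorant M is at least x^k / k! times
    e^((l-c)x) for x > 0. *)
Lemma linear_ode_bounds (c l k : nat) (F G : R -> R) : (c <= l)%N ->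
  (forall x, is_derive x 1 F (c%:R * F x + G x)) -> F 0 = 0 ->
  (forall x, 0 < x -> 0 < G x <= x ^+ k / k`!%:R * expR (l%:R * x)) ->
  forall x, 0 < x -> 0 < F x <= x ^+ k.+1 / k.+1`!%:R * expR (l%:R * x).
Proof.
move=> cl dF F0 bG x x0.
pose E (y : R) := expR (- c%:R * y).
have dE (y : R) : is_derive y 1 E (- c%:R * E y).
  exact: is_derive_expRM.
pose H (y : R) := F y * E y.
have dH (y : R) : is_derive y 1 H (G y * E y).
  have dFy := dF y; have dEy := dE y.
  by apply: is_derive_eq; rewrite /GRing.scale/=; ring.
pose D (y : R) := expR ((l%:R - c%:R) * y).
have dD (y : R) : is_derive y 1 D ((l%:R - c%:R) * D y).
  exact: is_derive_expRM.
pose M (y : R) := y ^+ k.+1 / k.+1`!%:R * D y.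
have fk0 : k`!%:R != 0 :> R by rewrite pnatr_eq0 -lt0n fact_gt0.
have dM (y : R) : is_derive y 1 M ((y ^+ k / k`!%:R + (l%:R - c%:R) * (y ^+ k.+1 / k.+1`!%:R)) * D y).
  have dDy := dD y.
  rewrite (_ : M = horner (k.+1`!%:R^-1 *: 'X^(k.+1)) * D); last first.
    by apply/funext => z; rewrite /M !fctE hornerZ hornerXn [_^-1 * _]mulrC.
  apply: is_derive_eq.
  rewrite /GRing.scale/= derivZ derivXn !hornerZ hornerMn !hornerXn factS natrM exprS.
  by rewrite -mulr_natl; field; rewrite fk0 nat1r pnatr_eq0.
have EE y : expR (l%:R * y) * E y = D y by rewrite -expRD; congr expR; ring.
have H0 : H 0 = 0 by rewrite /H F0 mul0r.
have M0 : M 0 = 0 by rewrite /M expr0n !mul0r.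
apply/andP; split.
  have [y /andP[y0 _]] := mean_value dH x0.
  rewrite H0 !subr0 => HE.
  rewrite -(@pmulr_lgt0 _ (E x)) ?expR_gt0 // -/(H x) HE.
  by rewrite !mulr_gt0 ?expR_gt0//; case/andP: (bG _ y0).
have dMH (y : R) : is_derive y 1 (fun y : R => M y - H y)
    ((y ^+ k / k`!%:R + (l%:R - c%:R) * (y ^+ k.+1 / k.+1`!%:R)) * D y - G y * E y).
  by have dMy := dM y; have dHy := dH y; apply: is_derive_eq.
have [y /andP[y0 _]] := mean_value dMH x0.
rewrite H0 M0 !subr0 => HE.
have : 0 <= M x - H x.
  rewrite HE; apply: mulr_ge0; last exact: ltW.
  rewrite mulrDl addrAC; apply: addr_ge0.
    rewrite -EE mulrA -mulrBl; apply: mulr_ge0; last exact: expR_ge0.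
    by rewrite subr_ge0; case/andP: (bG _ y0).
  by rewrite !mulr_ge0 ?subr_ge0 ?ler_nat ?invr_ge0 ?exprn_ge0 ?ltW ?expR_gt0.
by rewrite subr_ge0 /M /H -EE mulrA ler_pM2r ?expR_gt0.
Qed.

Definition exp_poly (l : nat) (A : nat -> {poly R}) (x : R) :=
  \sum_(j < l) (A j).[x] * expR (j%:R * x).

Lemma is_derive_exp_poly l (A : nat -> {poly R}) x :
  is_derive x 1 (exp_poly l A) (exp_poly l (fun j => (A j)^`() + j%:R *: A j) x).
Proof.
rewrite /exp_poly.
rewrite (_ : (fun _ => _) = \sum_(j < l) (fun x : R => (A j).[x] * expR (j%:R * x))); last first.
  by apply/funext => y; rewrite fct_sumE.
apply: is_derive_sum => j.
have dE := is_derive_expRM j%:R x.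
apply: is_derive_eq; rewrite /GRing.scale/= hornerD hornerZ; ring.
Qed.

(** Hermite-Padé approximation of 1, e^x, ..., e^((l-1)x) at 0, where [cs] lists the exponents with
    multiplicity. Positivity of the remainder for x > 0 provides the nonvanishing that a
    transcendence proof has to secure. *)
Definition pade_system l (cs : seq nat) (A : nat -> {poly R}) :=
  [/\ forall j, (size (A j) <= count_mem j cs)%N,
      forall j, coef_integral l`!%:R (l`!%:R ^+ size cs) (A j),
      forall j, coef_bounded ((2 * l%:R) ^+ size cs) (A j) &
      forall x, 0 < x -> 0 < exp_poly l A x <=
         x ^+ (size cs).-1 / (size cs).-1`!%:R * expR (l%:R * x)].

Lemma fact_coef0 i : fact_coef (0 : {poly R}) i = 0.
Proof. by rewrite /fact_coef coef0 mul0rn. Qed.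

Lemma pade_system1 l c : (c < l)%N -> exists A : nat -> {poly R}, pade_system l [:: c] A.
Proof.
move=> cl; exists (fun j : nat => (j == c)%:R%:P).
have fc (j i : nat) : fact_coef ((j == c)%:R%:P : {poly R}) i = ((i == 0) && (j == c))%:R.
  rewrite /fact_coef coefC; case: i => [|i] /=; first by rewrite mulr1n.
  by rewrite mul0rn.
split=> [j|j i|j i|x x0].
- by rewrite size_polyC /= addn0 pnatr_eq0 eqb0 negbK eq_sym.
- rewrite fc /=; case: i => [|i] /=; last by rewrite mulr0 mul0r.
  by rewrite expr0 divr1 expr1 rpredM ?rpred_nat.
- rewrite fc /= expr1; case: i => [|i] /=; last by rewrite normr0 mulr0 mulr_ge0.
  rewrite expr0 mul1r; apply: (@le_trans _ _ 1); first by case: eqP; rewrite ?normr0 ?normr1.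
  by rewrite -natrM ler1n muln_gt0 (leq_ltn_trans _ cl).
- rewrite /= expr0 invr1 mulr1 mul1r /exp_poly.
  rewrite (bigD1 (Ordinal cl)) //= eqxx hornerC mul1r big1 ?addr0; last first.
    move=> j jc; rewrite (_ : (j == c :> nat) = false) ?hornerC ?mul0r//.
    by apply/negbTE; apply: contra jc => /eqP jc; apply/eqP/val_inj.
  by rewrite expR_gt0 ler_expR ler_pM2r // ler_nat ltnW.
Qed.

Lemma fact_divr_int l m : (0 < m <= l)%N -> l`!%:R / m%:R \is a @Num.int R.
Proof.
move=> /andP[m0 ml]; have /dvdnP[q ->] : (m %| l`!)%N by rewrite dvdn_fact ?m0.
by rewrite natrM mulfK ?pnatr_eq0 -?lt0n.
Qed.

(* From F solve F' = c F + (old F) with F 0 = 0: this raises the order of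
   vanishing at 0 by one and allows one more coefficient at e^(c x). *)
Lemma pade_systemS l c cs (A : nat -> {poly R}) : (c < l)%N -> (0 < size cs)%N ->
  pade_system l cs A -> exists B : nat -> {poly R}, pade_system l (c :: cs) B.
Proof.
move=> cl cs0 [sA iA bA eA].
(* Nonzero differences of exponents below l divide l!, so that L / (j - c) is an integer. *)
set L : R := l`!%:R.
have L0 : L != 0 by rewrite pnatr_eq0 -lt0n fact_gt0.
have b0 : 0 <= (2 * l%:R) ^+ size cs :> R by rewrite exprn_ge0.
have l1 : 1 <= l%:R :> R by rewrite ler1n (leq_ltn_trans _ cl).
have /choice[B0 B0P] : forall j, exists B, (j < l)%N -> j != c ->
    [/\ B^`() + (j%:R - c%:R) *: B = A j, (size B <= size (A j))%N,
    coef_integral L (L ^+ size cs * L) B & coef_bounded (2 * (2 * l%:R) ^+ size cs) B].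
  move=> j; have [jl|] := boolP (j < l)%N; last by exists 0.
  have [|jc] := eqVneq j c; first by exists 0.
  have [|||||B HB] := @first_order_solution R L (L ^+ size cs) ((2 * l%:R) ^+ size cs) (j%:R - c%:R) (A j) => //.
  - have [jc'|jc'] := ltnP j c.
      rewrite -opprB -natrB ?(ltnW jc')// invrN mulrN rpredN fact_divr_int//.
      by rewrite subn_gt0 jc' (leq_trans (leq_subr _ _))// ltnW.
    rewrite -natrB // fact_divr_int//.
    by rewrite subn_gt0 ltn_neqAle eq_sym jc jc' (leq_trans (leq_subr _ _))// ltnW.
  - have [jc'|jc'] := ltnP j c.
      by rewrite distrC -natrB ?(ltnW jc')// normr_nat ler1n subn_gt0.
    by rewrite -natrB// normr_nat ler1n subn_gt0 ltn_neqAle eq_sym jc.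
  by exists B.
(* The constant of integration at the exponent c is the only freedom left; it is spent on F(0) =
   0. *)
pose k := - \sum_(j < l | j != c :> nat) fact_coef (B0 j) 0.
pose B j := if (j < l)%N then if j == c then primitive (A c) + k%:P else B0 j else 0.
have fcBc0 : fact_coef (B c) 0 = k.
  rewrite /B cl eqxx /fact_coef coefD coefC mulrnDl -/(fact_coef _ 0).
  by rewrite fact_coef_primitive0 add0r.
have fcBcS i : fact_coef (B c) i.+1 = fact_coef (A c) i.
  by rewrite /B cl eqxx -[RHS]fact_coef_primitiveS /fact_coef coefD coefC addr0.
have ode j : (j < l)%N -> (B j)^`() + j%:R *: B j = c%:R *: B j + A j.
  move=> jl; have [->|jc] := eqVneq j c.
    by rewrite addrC {2}/B cl eqxx derivD deriv_primitive derivC addr0.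
  have [E _ _ _] := B0P j jl jc.
  by rewrite /B jl (negbTE jc) -E scalerBl addrCA subrKC.
have BE0 : exp_poly l B 0 = 0.
  have E0 j : (B j).[0] * expR (j%:R * 0) = fact_coef (B j) 0.
    by rewrite mulr0 expR0 mulr1 horner_coef0 /fact_coef.
  rewrite /exp_poly; under eq_bigr do rewrite E0.
  rewrite (bigD1 (Ordinal cl))//= fcBc0 /k addrC; apply/eqP; rewrite subr_eq0.
  apply/eqP; apply: eq_big => [j|j jc]; first by rewrite -val_eqE.
  by rewrite /B ltn_ord (negbTE (jc : j != c :> nat)).
exists B; split.
- move=> j; rewrite /B; case: ifP => [jl|_]; last by rewrite size_poly0.
  rewrite /=; have [->|jc] := eqVneq j c.
    rewrite (leq_trans (size_polyD _ _))// geq_max.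
    rewrite (leq_trans (size_poly _ _)) ?add1n ?ltnS//=.
    by rewrite (leq_trans (size_polyC_leq1 _)).
  have [_ sB _ _] := B0P j jl jc.
  by rewrite (leq_trans sB)// (leq_trans (sA j))// leq_addl.
- have iB0 j : (j < l)%N -> j != c -> coef_integral L (L ^+ (size cs).+1) (B0 j).
    by move=> jl jc; have [_ _ + _] := B0P j jl jc; rewrite exprSr.
  move=> j i; have [jl|jl] := boolP (j < l)%N; last first.
    by rewrite /B (negbTE jl) fact_coef0 mulr0 mul0r.
  have [->|jc] := eqVneq j c; last by rewrite /B jl (negbTE jc); apply: iB0.
  case: i => [|i].
    rewrite fcBc0 expr0 divr1 mulrN rpredN mulr_sumr rpred_sum// => i ic.
    by have := iB0 i (ltn_ord i) ic 0; rewrite expr0 divr1.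
  rewrite fcBcS /= !exprS; have := iA c i; congr (is_true (_ \is a Num.int)).
  by rewrite -/L; field; rewrite L0 expf_neq0.
- have le2 : 2 * (2 * l%:R) ^+ size cs <= (2 * l%:R) ^+ (size cs).+1 :> R.
    by rewrite exprS -mulrA ler_wpM2l// ler_peMl.
  have iB0 j : (j < l)%N -> j != c -> coef_bounded (2 * (2 * l%:R) ^+ size cs) (B0 j).
    by move=> jl jc; have [_ _ _] := B0P j jl jc.
  move=> j i; have [jl|jl] := boolP (j < l)%N; last first.
    by rewrite /B (negbTE jl) fact_coef0 normr0 mulr0 exprn_ge0.
  have [->|jc] := eqVneq j c; last first.
    by rewrite /B jl (negbTE jc); apply: le_trans le2; apply: iB0.
  case: i => [|i].
    rewrite fcBc0 expr0 mul1r normrN (le_trans (ler_norm_sum _ _ _))//.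
    apply: (@le_trans _ _ (\sum_(i < l | i != c :> nat) 2 * (2 * l%:R) ^+ size cs)).
      apply: ler_sum => i ic.
      by have := iB0 i (ltn_ord i) ic 0; rewrite expr0 mul1r.
    rewrite big_mkcond /= (@le_trans _ _ (\sum_(i < l) 2 * (2 * l%:R) ^+ size cs))//.
      by apply: ler_sum => i _; case: ifP => // _; rewrite mulr_ge0.
    by rewrite sumr_const card_ord exprS -[leLHS]mulr_natl mulrA [l%:R * 2]mulrC.
  by rewrite fcBcS exprS -mulrA; apply: le_trans le2; rewrite ler_wpM2l// bA.
- have dB (y : R) : is_derive y 1 (exp_poly l B) (c%:R * exp_poly l B y + exp_poly l A y).
    have := is_derive_exp_poly l B y; congr (is_derive _ _ _ _).
    rewrite /exp_poly mulr_sumr -big_split /=; apply: eq_bigr => j _.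
    by rewrite ode// hornerD hornerZ mulrDl mulrA.
  have := linear_ode_bounds (ltnW cl) dB BE0 eA.
  by rewrite prednK.
Qed.

Lemma pade_system_exists l cs : (0 < size cs)%N -> all (fun c => c < l)%N cs ->
  exists A : nat -> {poly R}, pade_system l cs A.
Proof.
case: cs => // c cs _.
elim: cs c => [|c' cs IH] c /andP[cl csl]; first exact: pade_system1.
have [A HA] := IH c' csl.
exact: pade_systemS HA.
Qed.

End HermitePadeSystems.

(** * Denominators and norms in the field generated by two real algebraic numbers *)

Section RationalSpan.
Context {R : realType} {J : finType}.
Variable u : J -> R.
Implicit Types (I : {set J}) (c : J -> rat) (x y : R).

Definition rat_span I x :=
  exists2 c, (forall j, j \notin I -> c j = 0) & x = \sum_j ratr (c j) * u j.

Definition rat_free I := forall c, (forall j, j \notin I -> c j = 0) ->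
  \sum_j ratr (c j) * u j = 0 -> forall j, c j = 0.

Lemma rat_spanD I x y : rat_span I x -> rat_span I y -> rat_span I (x + y).
Proof.
move=> [c c0 ->] [e e0 ->]; exists (fun j => c j + e j).
  by move=> j jI; rewrite c0 // e0 // addr0.
by rewrite -big_split; apply: eq_bigr => j _; rewrite rmorphD mulrDl.
Qed.

Lemma rat_spanZ I (q : rat) x : rat_span I x -> rat_span I (ratr q * x).
Proof.
move=> [c c0 ->]; exists (fun j => q * c j).
  by move=> j jI; rewrite c0 // mulr0.
by rewrite mulr_sumr; apply: eq_bigr => j _; rewrite rmorphM mulrA.
Qed.

Lemma rat_span0 I : rat_span I 0.
Proof.
by exists (fun=> 0) => //; rewrite big1 // => j _; rewrite rmorph0 mul0r.
Qed.

Lemma rat_span_sum I (T : finType) (c : T -> rat) (f : T -> R) :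
  (forall i, rat_span I (f i)) -> rat_span I (\sum_i ratr (c i) * f i).
Proof.
move=> fI; apply: big_ind; [exact: rat_span0|exact: rat_spanD|].
by move=> i _; apply: rat_spanZ.
Qed.

Lemma rat_span_gen I j : j \in I -> rat_span I (u j).
Proof.
move=> jI; exists (fun i => (i == j)%:R).
  by move=> i; case: eqVneq => // ->; rewrite jI.
rewrite (bigD1 j) //= eqxx rmorph1 mul1r big1 ?addr0// => i /negbTE ->.
by rewrite rmorph0 mul0r.
Qed.

Lemma rat_basis : exists2 I, rat_free I & forall j, rat_span I (u j).
Proof.
have free0 : `[< rat_free finset.set0 >].
  by apply/asboolP => c c0 _ j; rewrite c0 // finset.in_set0.
case: (@arg_maxnP _ finset.set0 (fun I : {set J} => `[< rat_free I >]) (fun I => #|I|) free0).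
move=> I /asboolP If Imax; exists I => // j.
have [jI|jI] := boolP (j \in I); first exact: rat_span_gen.
have /existsNP[c] : ~ rat_free (j |: I).
  by move=> /asboolP /Imax; rewrite cardsU1 jI /= add1n ltnn.
move=> /not_implyP[c0] /not_implyP[cu] /existsNP[k ck].
have c0' i : i != j -> i \notin I -> c i = 0.
  by move=> ij iI; apply: c0; rewrite finset.in_setU1 negb_or ij.
have cj : c j != 0.
  apply/eqP => cj; apply: ck; apply: If => // i iI.
  by have [->//|ij] := eqVneq i j; apply: c0'.
exists (fun i => if i == j then 0 else - (c i / c j)).
  by move=> i iI; case: ifPn => // ij; rewrite c0' // mul0r oppr0.
have cj' : ratr (c j) != 0 :> R by rewrite fmorph_eq0.
apply: (mulfI cj'); rewrite mulr_sumr (bigD1 j) //= eqxx rmorph0 mul0r mulr0 add0r.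
move/eqP: cu; rewrite (bigD1 j) //= addr_eq0 => /eqP ->.
rewrite -sumrN; apply: eq_bigr => i /negbTE ->.
by rewrite rmorphN fmorph_div mulrA mulrN mulrCA mulfV// mulr1 mulNr.
Qed.

End RationalSpan.

Section StableLattices.
Context {R : realType}.

Lemma algebraic_powers (a : R) : algebraicOver (ratr : rat -> R) a ->
  exists n (c : 'I_n.+1 -> rat), a ^+ n.+1 = \sum_(i < n.+1) ratr (c i) * a ^+ i.
Proof.
move=> [p p0 /rootP pa].
have sp : (1 < size (map_poly ratr p : {poly R}))%N.
  by rewrite ltnNge; apply: contra p0 => /size1_polyC E; move: pa;
     rewrite E hornerC => E0; move: E; rewrite E0 polyC0 => /eqP; rewrite map_poly_eq0.
move: sp; rewrite size_map_poly => sp.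
case E : (size p) sp => [|[|n]]// _.
exists n, (fun i => - (p`_i / lead_coef p)).
have lp : ratr (lead_coef p) != 0 :> R by rewrite fmorph_eq0 lead_coef_eq0.
apply: (mulfI lp).
move: pa; rewrite horner_coef size_map_poly E big_ord_recr /= coef_map /= => /eqP.
rewrite addrC addr_eq0 lead_coefE E /= => /eqP ->.
rewrite -sumrN mulr_sumr; apply: eq_bigr => i _.
rewrite coef_map rmorphN fmorph_div mulrA mulrN mulrCA.
by rewrite mulfV ?mulr1 ?mulNr//; move: lp; rewrite lead_coefE E.
Qed.

Lemma common_denominator (T : finType) (f : T -> rat) :
  exists2 d : int, 0 < d & forall t, exists z : int, d%:~R * f t = z%:~R.
Proof.
exists (\prod_t denq (f t)); first by apply: prodr_gt0 => t _.
move=> t; exists (numq (f t) * \prod_(s | s != t) denq (f s)).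
by rewrite (bigD1 t) //= rmorphM /= rmorphM /= numqE mulrC mulrA.
Qed.

(** The entries of w are a basis over the rationals of Q[a, b], taken from the monomials a^i b^j,
    and X, Y are the matrices of multiplication by a and b after clearing one common denominator d.
    They take the place of a ring of algebraic integers. *)
Lemma stable_lattice (a b : R) : algebraicOver (ratr : rat -> R) a ->
  algebraicOver (ratr : rat -> R) b ->
  exists r (w : 'cV[R]_r.+1) (d : int) (X Y : 'M[int]_r.+1),
    [/\ 0 < d, forall v : 'rV[int]_r.+1, map_mx intr v *m w = 0 -> v = 0,
        map_mx intr X *m w = (d%:~R * a) *: w & map_mx intr Y *m w = (d%:~R * b) *: w].
Proof.
move=> /algebraic_powers[n [p pE]] /algebraic_powers[m [q qE]].
pose u (k : 'I_n.+1 * 'I_m.+1) := a ^+ k.1 * b ^+ k.2.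
have [I If Isp] := rat_basis u.
have uspan i j : (i <= n.+1)%N -> (j <= m.+1)%N -> rat_span u I (a ^+ i * b ^+ j).
  have H0 i' j' : (i' <= n)%N -> (j' <= m)%N -> rat_span u I (a ^+ i' * b ^+ j').
    by move=> hi hj; have := Isp (Ordinal (hi : (i' < n.+1)%N), Ordinal (hj : (j' < m.+1)%N)).
  have H1 i' j' : (i' <= n.+1)%N -> (j' <= m)%N -> rat_span u I (a ^+ i' * b ^+ j').
    rewrite leq_eqVlt => /orP[/eqP -> jm|]; last exact: H0.
    rewrite pE mulr_suml; under eq_bigr do rewrite -mulrA.
    by apply: rat_span_sum => k; apply: H0 => //; rewrite -ltnS.
  move=> hi; rewrite leq_eqVlt => /orP[/eqP ->|]; last exact: H1.
  rewrite qE mulr_sumr; under eq_bigr do rewrite mulrCA.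
  by apply: rat_span_sum => k; apply: H1 => //; rewrite -ltnS.
have stable (t : R) : (forall k, rat_span u I (t * u k)) -> forall x, rat_span u I x -> rat_span u I (t * x).
  move=> tu x [c _ ->]; rewrite mulr_sumr; under eq_bigr do rewrite mulrCA.
  exact: rat_span_sum.
have sa k : rat_span u I (a * u k).
  by rewrite mulrA -exprS; apply: uspan; [exact: ltn_ord|exact/ltnW/ltn_ord].
have sb k : rat_span u I (b * u k).
  by rewrite mulrCA -exprS; apply: uspan; [exact/ltnW/ltn_ord|exact: ltn_ord].
(* The monomial 1 is nonzero, so the basis is nonempty; its size is written r + 1. *)
have I0 : (0 < #|I|)%N.
  rewrite card_gt0; apply/eqP => I0; have [c c0] := uspan 0 0 isT isT.
  rewrite mulr1 big1 => [/eqP|j _]; first by rewrite oner_eq0.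
  by rewrite c0  ?I0 ?finset.in_set0// rmorph0 mul0r.
case rE : #|I| I0 => [//|r] _.
pose e (k : 'I_r.+1) : 'I_n.+1 * 'I_m.+1 := enum_val (cast_ord (esym rE) k).
have eI k : e k \in I by exact: enum_valP.
have esum (F : 'I_n.+1 * 'I_m.+1 -> R) : (forall j, j \notin I -> F j = 0) ->
    \sum_j F j = \sum_k F (e k).
  move=> F0; rewrite (bigID (mem I)) /= [X in _ + X]big1 ?addr0//.
  rewrite big_enum_val /=.
  by rewrite (reindex (cast_ord (esym rE))) //=; exists (cast_ord rE) => k _; rewrite ?cast_ordK ?cast_ordKV.
have rows (t : R) : (forall k, rat_span u I (t * u k)) ->
    exists X : 'I_r.+1 -> 'I_r.+1 -> rat, forall k, t * u (e k) = \sum_l ratr (X k l) * u (e l).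
  move=> tu; have /choice[X HX] : forall k, exists X : 'I_r.+1 -> rat, t * u (e k) = \sum_l ratr (X l) * u (e l).
    move=> k; have [c c0 ->] := tu (e k); exists (c \o e).
    by rewrite esum // => j jI; rewrite c0 // rmorph0 mul0r.
  by exists X.
have [X HX] := rows a sa; have [Y HY] := rows b sb.
have [d d0 Hd] := common_denominator (fun k : bool * 'I_r.+1 * 'I_r.+1 =>
  if k.1.1 then X k.1.2 k.2 else Y k.1.2 k.2).
have /choice[z Hz] := Hd.
have mat (t : R) (B : 'I_r.+1 -> 'I_r.+1 -> rat) (k : bool) :
    (forall k, t * u (e k) = \sum_l ratr (B k l) * u (e l)) ->
    (forall i j, d%:~R * B i j = (z (k, i, j))%:~R) ->
    map_mx intr (\matrix_(i, j) z (k, i, j)) *m \col_k u (e k) = (d%:~R * t) *: \col_k u (e k).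
  move=> HB zB; apply/matrixP => i j; rewrite !mxE -mulrA HB mulr_sumr.
  apply: eq_bigr => l _; rewrite !mxE [RHS]mulrA; congr (_ * _).
  by rewrite -[LHS]ratr_int -zB rmorphM /= ratr_int.
exists r, (\col_k u (e k)), d, (\matrix_(i, j) z (true, i, j)), (\matrix_(i, j) z (false, i, j)).
split => //.
- move=> v v0; pose c j := if j \in I then (v 0 (cast_ord rE (enum_rank_in (eI ord0) j)))%:~R else 0 : rat.
  have ce k : c (e k) = (v 0 k)%:~R.
    by rewrite /c eI enum_valK_in cast_ordKV.
  apply/matrixP => i k; rewrite ord1 mxE; apply/eqP; rewrite -(intr_eq0 rat) -ce.
  apply/eqP; apply: If => [j|]; first by rewrite /c => /negbTE ->.
  rewrite esum; last by move=> j; rewrite /c => /negbTE ->; rewrite rmorph0 mul0r.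
  have := congr1 (fun M : 'M[R]_1 => M 0 0) v0; rewrite !mxE => E; rewrite -[RHS]E.
  by apply: eq_bigr => l _; rewrite ce !mxE ratr_int.
- by apply: mat => // i j; rewrite -Hz.
- by apply: mat => // i j; rewrite -Hz.
Qed.

End StableLattices.

Section LiouvilleInequality.
Context {R : realType}.

Definition mx_bounded (b : R) m n (A : 'M[R]_(m, n)) := forall i j, `|A i j| <= b.

Lemma mx_bounded_exists m n (A : 'M[R]_(m, n)) : exists2 h, 1 <= h & mx_bounded h A.
Proof.
exists (1 + \sum_i \sum_j `|A i j|).
  by rewrite lerDl; apply: sumr_ge0 => i _; apply: sumr_ge0.
move=> i j; rewrite (bigD1 i) //= (bigD1 j) //=.
set s := \sum_(_ < _ | _) _; set t := \sum_(_ < _ | _) _.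
have : 0 <= s by apply: sumr_ge0.
have : 0 <= t by apply: sumr_ge0 => k _; apply: sumr_ge0.
lra.
Qed.

Lemma mx_bounded_mul m n p (a b : R) (A : 'M[R]_(m, n)) (B : 'M[R]_(n, p)) :
  mx_bounded a A -> mx_bounded b B -> mx_bounded (n%:R * a * b) (A *m B).
Proof.
move=> hA hB i j; rewrite mxE (le_trans (ler_norm_sum _ _ _))//.
apply: (@le_trans _ _ (\sum_(k < n) a * b)).
  by apply: ler_sum => k _; rewrite normrM ler_pM.
by rewrite sumr_const card_ord -[leLHS]mulr_natl mulrA.
Qed.

Lemma det_bounded n (b : R) (A : 'M[R]_n) : 0 <= b -> mx_bounded b A ->
  `|\det A| <= n`!%:R * b ^+ n.
Proof.
move=> b0 hA; rewrite /determinant (le_trans (ler_norm_sum _ _ _))//.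
apply: (@le_trans _ _ (\sum_(s : {perm 'I_n}) b ^+ n)).
  apply: ler_sum => s _; rewrite normrM normrX normrN1 expr1n mul1r normr_prod.
  rewrite -[X in b ^+ X](card_ord n) -prodr_const.
  by apply: ler_prod => i _; rewrite normr_ge0 hA.
by rewrite sumr_const card_Sn mulr_natl.
Qed.

Lemma adj_bounded n (b : R) (A : 'M[R]_n.+1) : 0 <= b -> mx_bounded b A ->
  mx_bounded (n`!%:R * b ^+ n) (\adj A).
Proof.
move=> b0 hA i j; rewrite mxE /cofactor normrM normrX normrN1 expr1n mul1r.
by apply: det_bounded => // k l; rewrite !mxE.
Qed.

(* The norm form of Liouville's inequality: [det M] is a nonzero integer and
   [w] is an eigenvector of [M] for the number to be bounded from below. *)
Lemma integer_eigenvalue_bound r (w : 'cV[R]_r.+1) (M : 'M[int]_r.+1) (x b : R) :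
  (forall v : 'rV[int]_r.+1, map_mx intr v *m w = 0 -> v = 0) ->
  map_mx intr M *m w = x *: w -> x != 0 -> 0 <= b -> mx_bounded b (map_mx intr M) ->
  1 <= `|x| * (r.+1%:R * r`!%:R * b ^+ r).
Proof.
move=> wfree Mw x0 b0 hM.
set MR : 'M[R]_r.+1 := map_mx intr M in Mw hM.
have detM : \det M != 0.
  apply/det0P => -[v v0 vM]; move/eqP: v0; apply; apply: wfree.
  apply: (scalerI x0); rewrite scaler0 scalemxAr -Mw mulmxA.
  by rewrite -map_mxM vM map_mx0 mul0mx.
have det1 : 1 <= `|\det MR|.
  by rewrite det_map_mx -intr_norm ler1z -gtz0_ge1 normr_gt0.
have adjw : \det MR *: w = x *: (\adj MR *m w).
  by rewrite scalemxAr -Mw mulmxA mul_adj_mx mul_scalar_mx.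
(* Comparing coordinates where |w| is largest turns the vector identity [adjw] into a scalar
   inequality. *)
have [k _ kmax] := @Order.TotalTheory.arg_maxP _ _ _ (ord0 : 'I_r.+1) xpredT (fun i => `|w i 0|) isT.
have wk0 : 0 < `|w k 0|.
  rewrite normr_gt0; apply/eqP => wk0.
  have w0 : w = 0.
    apply/matrixP => i j; rewrite ord1 mxE; apply/eqP.
    by rewrite -normr_le0 (le_trans (kmax i isT))// wk0 normr0.
  have /matrixP/(_ 0 0) : (const_mx 1 : 'rV[int]_r.+1) = 0.
    by apply: wfree; rewrite w0 mulmx0.
  by rewrite !mxE.
rewrite -(ler_pM2r wk0) mul1r.
apply: (@le_trans _ _ (`|\det MR| * `|w k 0|)); first by rewrite ler_peMl.
have := congr1 (fun A : 'cV[R]_r.+1 => `|A k 0|) adjw.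
rewrite /= !mxE !normrM => ->; rewrite -[leRHS]mulrA ler_wpM2l//.
rewrite (le_trans (ler_norm_sum _ _ _))//.
apply: (@le_trans _ _ (\sum_(j < r.+1) (r`!%:R * b ^+ r) * `|w k 0|)).
  apply: ler_sum => j _; rewrite normrM ler_pM//; last exact: kmax.
  exact: adj_bounded.
by rewrite sumr_const card_ord -[leLHS]mulr_natl !mulrA.
Qed.

Lemma mx_pow_bounded r (h : R) (X : 'M[R]_r.+1) : 1 <= h -> mx_bounded h X ->
  forall i, mx_bounded ((r.+1%:R * h) ^+ i) (X ^+ i).
Proof.
move=> h1 hX; elim=> [|i IH].
  by rewrite expr0 => k l; rewrite !mxE; case: eqP; rewrite ?normr1 ?normr0 ?mulr0n//= normr0.
by rewrite !exprS; apply: mx_bounded_mul.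
Qed.

(** Substituting matrices for a and b makes d^(n+l) x an eigenvalue of an integer matrix with
    eigenvector w. The order of the quantifiers matters: the exponent r of the height H depends on a
    and b only, so l may be chosen after it. *)
Lemma liouville (a b : R) : algebraicOver (ratr : rat -> R) a ->
  algebraicOver (ratr : rat -> R) b ->
  exists r, forall l, exists2 C : R, 1 <= C &
    forall n (c : nat -> nat -> int) (H : R), (0 < n)%N -> 1 <= H ->
      (forall i j, `|c i j|%:~R <= H) ->
      let x := \sum_(i < n) \sum_(j < l) (c i j)%:~R * a ^+ i * b ^+ j in
      x != 0 -> 1 <= `|x| * (C ^+ n * H ^+ r).
Proof.
move=> aalg balg; have [r [w [d [X [Y [d0 wfree Xw Yw]]]]]] := stable_lattice aalg balg.
exists r => l.
have [h h1 [hX hY]] : exists2 h : R, 1 <= h & mx_bounded h (map_mx intr X) /\ mx_bounded h (map_mx intr Y).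
  have [h1 h11 hX] := mx_bounded_exists (map_mx intr X).
  have [h2 h21 hY] := mx_bounded_exists (map_mx intr Y).
  exists (h1 + h2); first by lra.
  by split=> i j; [have := hX i j|have := hY i j]; lra.
have d1 : 1 <= d%:~R :> R by rewrite ler1z -gtz0_ge1.
pose rh := r.+1%:R * h.
have rh1 : 1 <= rh by rewrite mulr_ege1 ?ler1n.
pose e := (l + 1)%N.
pose D := (d%:~R * rh) ^+ e.
have D1 : 1 <= D by rewrite exprn_ege1// mulr_ege1.
(* The factor 2 * (l + 1) pays for the n * l summands, by n <= 2^n and l <= (l + 1)^n. *)
pose E := 2 * (l%:R + 1) * (r.+1%:R * D) : R.
exists ((d%:~R ^+ e) * (r.+1%:R * r`!%:R) * E ^+ r).
  rewrite mulr_ege1 ?mulr_ege1 ?exprn_ege1 ?ler1n ?fact_gt0 // /E.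
  by rewrite !mulr_ege1 ?ler1n // ler_wpDl.
move=> n c H n0 H1 hc x x0.
(* The powers of d homogenize the sum, since X and Y represent d a and d b. *)
pose M : 'M[int]_r.+1 := \sum_(i < n) \sum_(j < l) (c i j * d ^+ (n + l - i - j)) *: (X ^+ i * Y ^+ j).
have powX (Z : 'M[int]_r.+1) (t : R) i : map_mx intr Z *m w = t *: w ->
    map_mx intr Z ^+ i *m w = t ^+ i *: w.
  move=> Zw; elim: i => [|i IH]; first by rewrite !expr0 mul1mx scale1r.
  by rewrite exprSr -mulmxA Zw -scalemxAr IH scalerA -exprS.
have MR : map_mx intr M = \sum_(i < n) \sum_(j < l)
    ((c i j)%:~R * d%:~R ^+ (n + l - i - j)) *: ((map_mx intr X) ^+ i * (map_mx intr Y) ^+ j) :> 'M[R]_r.+1.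
  rewrite /M rmorph_sum; apply: eq_bigr => i _; rewrite rmorph_sum; apply: eq_bigr => j _.
  by rewrite /= map_mxZ rmorphM /= rmorphM /= !rmorphXn /=.
have Mw : map_mx intr M *m w = (d%:~R ^+ (n + l) * x) *: w.
  rewrite MR mulmx_suml /x mulr_sumr scaler_suml; apply: eq_bigr => i _.
  rewrite mulmx_suml mulr_sumr scaler_suml; apply: eq_bigr => j _.
  rewrite -scalemxAl -mulmxA (powX _ _ j Yw) -scalemxAr (powX _ _ i Xw).
  rewrite !scalerA; congr (_ *: _); rewrite !exprMn.
  have -> : d%:~R ^+ (n + l) = d%:~R ^+ (n + l - i - j) * d%:~R ^+ i * d%:~R ^+ j :> R.
    by rewrite -!exprD; congr (_ ^+ _); have := ltn_ord i; have := ltn_ord j; lia.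
  by ring.
have bM : mx_bounded (H * E ^+ n) (map_mx intr M).
  have H0 : 0 <= H by apply: le_trans H1.
  have D0 : 0 <= D by apply: le_trans D1.
  have nl : (n + l <= e * n)%N by rewrite /e; nia.
  have term i j : (i <= n)%N -> (j <= l)%N -> mx_bounded (r.+1%:R * H * D ^+ n)
      (((c i j)%:~R * d%:~R ^+ (n + l - i - j)) *: ((map_mx intr X) ^+ i * (map_mx intr Y) ^+ j)).
    move=> ni lj p q; rewrite mxE normrM.
    have hXY := mx_bounded_mul (mx_pow_bounded h1 hX i) (mx_pow_bounded h1 hY j).
    apply: (@le_trans _ _ ((H * d%:~R ^+ (n + l)) * (r.+1%:R * rh ^+ i * rh ^+ j))).
      apply: ler_pM => //; rewrite normrM ler_pM -?intr_norm //.
      rewrite normrX ger0_norm ?(le_trans ler01)// ler_weXn2l//.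
      by rewrite -subnDA leq_subr.
    rewrite [leLHS](_ : _ = (r.+1%:R * H) * (d%:~R ^+ (n + l) * rh ^+ (i + j))); last first.
      by rewrite [rh ^+ (i + j)]exprD; ring.
    rewrite ler_wpM2l ?mulr_ge0 ?(le_trans ler01 H1)//.
    apply: (@le_trans _ _ (d%:~R ^+ (n + l) * rh ^+ (n + l))).
      by rewrite ler_wpM2l ?exprn_ge0 ?(le_trans ler01)// ler_weXn2l// leq_add.
    by rewrite -exprMn /D -exprM ler_weXn2l// mulr_ege1.
  move=> p q; rewrite MR summxE (le_trans (ler_norm_sum _ _ _))//.
  apply: (@le_trans _ _ (\sum_(i < n) \sum_(j < l) r.+1%:R * H * D ^+ n)).
    apply: ler_sum => i _; rewrite summxE (le_trans (ler_norm_sum _ _ _))//.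
    by apply: ler_sum => j _; apply: term; apply: ltnW.
  rewrite !sumr_const !card_ord -mulrnA -[leLHS]mulr_natl /E !exprMn.
  rewrite [leRHS](_ : _ = (2 ^+ n * (l%:R + 1) ^+ n) * (r.+1%:R ^+ n * H * D ^+ n)); last by ring.
  apply: ler_pM => //.
  - by apply: mulr_ge0; [exact: mulr_ge0|exact: exprn_ge0].
  - rewrite natrM mulrC; apply: ler_pM => //; first by rewrite -natrX ler_nat ltnW// ltn_expl.
    by rewrite -[leLHS]expr1 (@le_trans _ _ ((l%:R + 1) ^+ 1)) ?expr1 ?lerDl// ler_eXnr// ler_wpDl.
  - apply: ler_wpM2r; first exact: exprn_ge0.
    by apply: ler_wpM2r => //; rewrite ler_eXnr// ler1n.
have E0 : 0 <= E.
  by apply: mulr_ge0; apply: mulr_ge0 => //; exact: le_trans D1.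
have d0' : 0 <= d%:~R :> R by apply: le_trans d1.
have dx0 : d%:~R ^+ (n + l) * x != 0.
  by rewrite mulf_neq0// expf_neq0// gt_eqF// (lt_le_trans ltr01 d1).
have HE0 : 0 <= H * E ^+ n by rewrite mulr_ge0 ?exprn_ge0 ?(le_trans ler01 H1).
apply: le_trans (integer_eigenvalue_bound wfree Mw dx0 HE0 bM) _.
clearbody E. rewrite normrM -[leLHS]mulrA [leLHS]mulrCA; apply: ler_wpM2l => //.
rewrite normrX (ger0_norm d0') [(H * _) ^+ _]exprMn -!exprM !exprMn.
rewrite [leLHS](_ : _ = (d%:~R ^+ (n + l) * (r.+1%:R * r`!%:R)) * (E ^+ (n * r) * H ^+ r)); last by ring.
rewrite [leRHS](_ : _ = (d%:~R ^+ (e * n) * (r.+1%:R * r`!%:R) ^+ n) * (E ^+ (n * r) * H ^+ r)); last first.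
  by rewrite -!exprM exprMn [(r * n)%N]mulnC; ring.
apply: ler_wpM2r; first by apply: mulr_ge0; apply: exprn_ge0 => //; exact: le_trans H1.
apply: ler_pM; [exact: exprn_ge0|exact: mulr_ge0| |].
  by rewrite ler_weXn2l// /e; nia.
by rewrite ler_eXnr// mulr_ege1// ler1n ?fact_gt0.
Qed.

End LiouvilleInequality.

Section Lindemann.
Context {R : realType}.

Lemma fact_expn_le k n : (n`! ^ k <= (k * n)`!)%N.
Proof.
elim: k => [|k IH]; first by rewrite mul0n.
rewrite expnS mulSn (leq_trans (leq_mul (leqnn _) IH))//.
by rewrite -(@bin_fact (n + k * n) n) ?leq_addr// addKn leq_pmull// bin_gt0 leq_addr.
Qed.

Lemma expr_lt_fact (C : R) : exists2 n, (0 < n)%N & C ^+ n < n`!%:R.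
Proof.
have /cvgrPdist_lt/(_ 1 ltr01) := cvg_series_cvg_0 (is_cvg_series_exp_coeff `|C|).
move=> [N _ HN]; exists N.+1 => //.
have := HN N.+1 (leqnSn N); rewrite /= sub0r normrN /exp_coeff /=.
have f0 : 0 < N.+1`!%:R :> R by rewrite ltr0n fact_gt0.
rewrite normrM normfV normrX normr_id (gtr0_norm f0) ltr_pdivrMr// mul1r.
by apply: le_lt_trans; rewrite -normrX ler_norm.
Qed.

(* With n copies of each exponent j < l the remainder is about a^(nl) / (nl)!,
   while Liouville's lower bound loses only (n!)^(r+1); l = r + 3 wins. *)
Lemma exp_algebraic_pos (a : R) : 0 < a -> algebraicOver (ratr : rat -> R) a ->
  ~ algebraicOver (ratr : rat -> R) (expR a).
Proof.
move=> a0 aalg balg.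
have [r /(_ (r + 3)%N)] := liouville aalg balg.
set l := (r + 3)%N => -[C C1 HC].
set L : R := l`!%:R.
have L1 : 1 <= L by rewrite ler1n fact_gt0.
pose D := (L * (2 * l%:R)) ^+ l.
have l0 : (0 < l)%N by rewrite /l addn3.
have D1 : 1 <= D.
  by apply: exprn_ege1; apply: mulr_ege1 => //; rewrite -natrM ler1n muln_gt0.
pose a1 := a + 1; have a11 : 1 <= a1 by rewrite lerDr ltW.
pose E := C * D ^+ r * (L * a1) ^+ l * expR (l%:R * a).
have [n n0] := expr_lt_fact E; rewrite ltNge => /negP; apply.
pose cs := flatten (nseq n (iota 0 l)).
have scs : size cs = (n * l)%N.
  by rewrite size_flatten /shape map_nseq size_iota sumn_nseq mulnC.
have cs0 : (0 < size cs)%N by rewrite scs muln_gt0 n0 /l addn3.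
have csl : all (fun c => c < l)%N cs.
  apply/allP => c /flattenP[s]; rewrite mem_nseq => /andP[_ /eqP ->].
  by rewrite mem_iota.
have count_cs j : (count_mem j cs <= n)%N.
  rewrite count_flatten map_nseq sumn_nseq -[leqRHS]mul1n leq_mul2r.
  by rewrite count_uniq_mem ?iota_uniq// leq_b1 orbT.
have [A [sA iA bA /(_ a a0)]] := @pade_system_exists R l cs cs0 csl.
rewrite -/L in iA; rewrite scs in iA bA *; set N := (n * l)%N in iA bA *.
have nf0 : n`!%:R != 0 :> R by rewrite pnatr_eq0 -lt0n fact_gt0.
(* The bounds concern i! times the i-th coefficient. As [A j] has size at most n, multiplication by
   n! makes the coefficients themselves integral. *)
have coefE i j : n`!%:R * L ^+ N * (A j)`_i = (n`! %/ i`!)%:R * (L ^+ N * fact_coef (A j) i).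
  have [ni|ni] := leqP n i.
    by rewrite /fact_coef nth_default ?mul0rn ?mulr0// (leq_trans (sA j))// (leq_trans (count_cs j)).
  rewrite /fact_coef -[_ *+ _]mulr_natr.
  have : (i`! %| n`!)%N.
    by have := @bin_fact n i (ltnW ni) => <-; rewrite mulnCA dvdn_mulr.
  by move=> /divnK {1}<-; rewrite natrM; ring.
have /choice[c1 c1P] : forall ij : nat * nat, exists z : int, n`!%:R * L ^+ N * (A ij.2)`_ij.1 = z%:~R.
  move=> [i j] /=; apply/intrP; rewrite coefE rpredM ?rpred_nat//.
  have Li0 : L ^+ i != 0 by rewrite expf_neq0// gt_eqF// (lt_le_trans ltr01).
  by rewrite -(divfK Li0 (L ^+ N * _)) rpredM ?iA// rpredX// rpred_nat.
pose c i j := c1 (i, j).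
have H1 : 1 <= n`!%:R * D ^+ n.
  by apply: mulr_ege1; [rewrite ler1n fact_gt0|exact: exprn_ege1].
have cH i j : `|c i j|%:~R <= n`!%:R * D ^+ n.
  rewrite intr_norm -(c1P (i, j)) /= coefE normrM ler_pM//.
    by rewrite normr_nat ler_nat leq_div.
  rewrite normrM normrX (ger0_norm (le_trans ler01 L1)) /D -exprM [(l * n)%N]mulnC -/N exprMn.
  rewrite ler_wpM2l ?exprn_ge0 ?(le_trans ler01)//.
  apply: le_trans (bA j i); rewrite ler_peMl// exprn_ege1//; lra.
have xE : \sum_(i < n) \sum_(j < l) (c i j)%:~R * a ^+ i * expR a ^+ j =
    n`!%:R * L ^+ N * exp_poly l A a.
  rewrite exchange_big /exp_poly mulr_sumr; apply: eq_bigr => j _.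
  rewrite (@horner_coef_wide _ n) ?(leq_trans (sA j))// mulr_suml mulr_sumr.
  by apply: eq_bigr => i _; rewrite -(c1P (i : nat, j : nat)) /= expRM_natl; ring.
move=> /andP[F0 Fle].
have x0 : 0 < n`!%:R * L ^+ N * exp_poly l A a.
  apply: mulr_gt0 => //; apply: mulr_gt0; first by rewrite ltr0n fact_gt0.
  exact/exprn_gt0/(lt_le_trans ltr01).
have := HC n c _ n0 H1 cH; rewrite /= xE => /(_ (lt0r_neq0 x0)).
rewrite (gtr0_norm x0) => le1.
have N1 : N.-1`!%:R != 0 :> R by rewrite pnatr_eq0 -lt0n fact_gt0.
have N1' : 0 < N.-1`!%:R :> R by rewrite ltr0n fact_gt0.
have le2 : N.-1`!%:R <= n`!%:R ^+ r.+1 * E ^+ n.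
  have C0 : 0 <= C by apply: le_trans C1.
  have D0 : 0 <= D by apply: le_trans D1.
  have L0 : 0 <= L by apply: le_trans L1.
  have aa1 : a <= a1 by rewrite lerDl.
  clearbody D a1.
  have := ler_pM2l N1' 1 _; move=> /(_ _)/esym; rewrite mulr1 => eq1.
  have := le1; rewrite eq1 => /le_trans; apply.
  apply: (@le_trans _ _ (N.-1`!%:R * ((n`!%:R * L ^+ N * (a ^+ N.-1 / N.-1`!%:R * expR (l%:R * a))) *
      (C ^+ n * (n`!%:R * D ^+ n) ^+ r)))).
    apply: ler_wpM2l => //; apply: ler_wpM2r; last by apply: ler_wpM2l => //; rewrite mulr_ge0 ?exprn_ge0.
    by apply: mulr_ge0; apply: exprn_ge0 => //; apply: mulr_ge0 => //; apply: exprn_ge0.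
  rewrite [leLHS](_ : _ = n`!%:R ^+ r.+1 * ((C * D ^+ r) ^+ n * (L ^+ N * a ^+ N.-1 * expR (l%:R * a)))); last first.
    by rewrite exprS !exprMn -!exprM [(r * n)%N]mulnC; field.
  apply: ler_wpM2l; first by rewrite exprn_ge0.
  rewrite /E -[in leRHS]mulrA [leRHS]exprMn.
  apply: ler_wpM2l; first by apply/exprn_ge0/mulr_ge0 => //; exact: exprn_ge0.
  rewrite [leRHS]exprMn.
  apply: ler_pM.
  - by apply: mulr_ge0; apply: exprn_ge0 => //; apply: ltW.
  - exact: expR_ge0.
  - rewrite -exprM exprMn [(l * n)%N]mulnC -/N; apply: ler_wpM2l; first exact: exprn_ge0.
    apply: (@le_trans _ _ (a1 ^+ N.-1)).
      by rewrite lerXn2r ?nnegrE ?(le_trans ler01 a11) ?(ltW a0).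
    by rewrite ler_weXn2l// leq_pred.
  - by rewrite ler_eXnr// -expR0 ler_expR mulr_ge0// ltW.
(* Here l = r + 3 is used: (r + 2) n <= N - 1. Together with [le2] this leaves n! <= E^n, against
   the choice of n. *)
have le3 : n`!%:R ^+ r.+2 <= N.-1`!%:R :> R.
  rewrite -natrX ler_nat (leq_trans (fact_expn_le _ _))// leq_fact//.
  by rewrite -ltnS prednK ?muln_gt0 ?n0// mulnC ltn_pmul2l// /l addn3.
have := le_trans le3 le2; rewrite exprSr ler_pM2l// exprn_gt0// ltr0n fact_gt0//.
Qed.

Theorem exp_transcendental (a : R) : a != 0 -> algebraicOver (ratr : rat -> R) a ->
  ~ algebraicOver (ratr : rat -> R) (expR a).
Proof.
move=> a0 aalg balg; have [a_gt0|a_le0] := ltP 0 a; first exact: (exp_algebraic_pos a_gt0).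
apply: (@exp_algebraic_pos (- a)).
- by rewrite oppr_gt0 lt_neqAle a0.
- exact: algebraic_opp.
- by rewrite expRN; apply: algebraic_inv.
Qed.

End Lindemann.

(** * Elimination modulo a prime ideal *)

(* The size of a polynomial may occur with several convertible but syntactically
   different implicit arguments, which [lia] does not identify. *)
Tactic Notation "size_lia" constr(f) constr(q) constr(r) :=
  repeat match goal with H : is_true (leq _ _) |- _ => revert H end;
  move: (size f) (size q) (size r); intros; lia.

Section PolynomialsOverSubrings.
Context {A : comNzRingType}.
Implicit Types (B p : A -> Prop) (q f r : {poly A}) (x : A).

(** Subrings and ideals are predicates on a fixed ring, so that elimination can pass from one
    subalgebra to the next without a change of type. *)
Definition subring B :=
  [/\ B 1, forall a b, B a -> B b -> B (a - b) & forall a b, B a -> B b -> B (a * b)].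

(** The empty predicate is not excluded, which explains the separate hypotheses [p 0] below. *)
Definition prime_ideal p :=
  [/\ ~ p 1, forall a b, p a -> p b -> p (a + b), forall a b, p b -> p (a * b) &
      forall a b, p (a * b) -> p a \/ p b].

Definition coefs_in B q := forall i, B q`_i.

Section Subring.
Variable B : A -> Prop.
Hypothesis sB : subring B.

Lemma subring0 : B 0.
Proof. by have [B1 BB _] := sB; rewrite -(subrr 1); apply: BB. Qed.

Lemma subringN a : B a -> B (- a).
Proof. by have [B1 BB _] := sB => Ba; rewrite -sub0r; apply: BB => //; exact: subring0. Qed.

Lemma subringD a b : B a -> B b -> B (a + b).
Proof.
by have [B1 BB _] := sB => Ba Bb; rewrite -[b]opprK; apply: BB => //; exact: subringN.
Qed.

Lemma subringM a b : B a -> B b -> B (a * b).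
Proof. by have [_ _] := sB; apply. Qed.

Lemma subring_sum (I : Type) (s : seq I) (P : pred I) F :
  (forall i, P i -> B (F i)) -> B (\sum_(i <- s | P i) F i).
Proof. by move=> BF; apply: big_ind => //; [exact: subring0|exact: subringD]. Qed.

Lemma subringX a n : B a -> B (a ^+ n).
Proof.
have [B1 _ _] := sB => Ba; elim: n => // n IH; rewrite exprS; exact: subringM.
Qed.

Lemma coefs_inC a : B a -> coefs_in B a%:P.
Proof. by move=> Ba i; rewrite coefC; case: eqP => // _; exact: subring0. Qed.

Lemma coefs_in0 : coefs_in B 0.
Proof. by rewrite -polyC0; apply/coefs_inC/subring0. Qed.

Lemma coefs_inXn n : coefs_in B 'X^n.
Proof.
by have [B1 _ _] := sB => i; rewrite coefXn; case: eqP => // _; exact: subring0.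
Qed.

Lemma coefs_inD q r : coefs_in B q -> coefs_in B r -> coefs_in B (q + r).
Proof. by move=> Bq Br i; rewrite coefD; apply: subringD. Qed.

Lemma coefs_inN q : coefs_in B q -> coefs_in B (- q).
Proof. by move=> Bq i; rewrite coefN; apply: subringN. Qed.

Lemma coefs_inZ a q : B a -> coefs_in B q -> coefs_in B (a *: q).
Proof. by move=> Ba Bq i; rewrite coefZ; apply: subringM. Qed.

Lemma coefs_inM q r : coefs_in B q -> coefs_in B r -> coefs_in B (q * r).
Proof.
by move=> Bq Br i; rewrite coefM; apply: subring_sum => j _; apply: subringM.
Qed.

Lemma coefs_in_deriv q : coefs_in B q -> coefs_in B q^`().
Proof.
have [B1 _ _] := sB => Bq i; rewrite coef_deriv -mulr_natl.
apply: subringM => //; elim: i.+1 => [|n IH]; first exact: subring0.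
by rewrite -natr1; apply: subringD.
Qed.

Lemma size_cancel_lead (f q : {poly A}) : f != 0 -> (size f <= size q)%N ->
  (size (lead_coef f *: q - lead_coef q *: 'X^(size q - size f) * f)%R
    <= (size q).-1)%N.
Proof.
move=> f0 fq; have sf : (0 < size f)%N by rewrite size_poly_gt0.
apply/leq_sizeP => j; rewrite leq_eqVlt => /orP[/eqP <-|qj].
  rewrite coefB -scalerAl !coefZ coefXnM ifF; last by apply/negbTE; lia.
  rewrite (_ : ((size q).-1 - _)%N = (size f).-1); last by size_lia f f f.
  by rewrite -!lead_coefE mulrC subrr.
rewrite coefB -scalerAl !coefZ coefXnM ifF; last by apply/negbTE; lia.
rewrite !nth_default ?mulr0 ?subr0//. - by size_lia f q f.
- by size_lia q q q.
Qed.

(** Each step multiplies q by the leading coefficient of f instead of dividing by it, so that no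
    coefficient leaves B. *)
Lemma pseudo_division f q : f != 0 -> coefs_in B f -> coefs_in B q ->
  exists m a r, [/\ coefs_in B a, coefs_in B r, lead_coef f ^+ m *: q = a * f + r,
    (size r < size f)%N & (size a <= (size q).+1 - size f)%N].
Proof.
move=> f0 Bf; have [n] := ubnP (size q); elim: n q => // n IH q sq Bq.
have [qf|fq] := ltnP (size q) (size f).
  exists 0, 0, q; rewrite expr0 scale1r mul0r add0r size_poly0.
  by split=> //; exact: coefs_in0.
have sf : (0 < size f)%N by rewrite size_poly_gt0.
set q' := lead_coef f *: q - lead_coef q *: 'X^(size q - size f) * f.
have sq' : (size q' <= (size q).-1)%N by exact: size_cancel_lead.
have BX : coefs_in B (lead_coef q *: 'X^(size q - size f)).
  by apply: coefs_inZ; [rewrite lead_coefE|exact: coefs_inXn].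
have Bq' : coefs_in B q'.
  apply: coefs_inD; first by apply: coefs_inZ => //; rewrite lead_coefE.
  by apply/coefs_inN/coefs_inM.
case: (IH q' _ Bq') => [|m [a [r [Ba Br E sr sa]]]]; first by lia.
have Bl : B (lead_coef f ^+ m) by apply: subringX; rewrite lead_coefE.
exists m.+1, (a + lead_coef f ^+ m *: (lead_coef q *: 'X^(size q - size f))), r; split => //.
- by apply: coefs_inD => //; apply: coefs_inZ.
- rewrite exprSr -scalerA -[lead_coef f *: q](subrK (lead_coef q *: 'X^(size q - size f) * f)) -/q'.
  by rewrite scalerDr E mulrDl -[in RHS]scalerAl addrAC.
- rewrite (leq_trans (size_polyD _ _))// geq_max; apply/andP; split; first by lia.
  rewrite (leq_trans (size_scale_leq _ _))// (leq_trans (size_scale_leq _ _))//.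
  by rewrite size_polyXn; lia.
Qed.

End Subring.

Section PrimeIdeal.
Variable p : A -> Prop.
Hypothesis pp : prime_ideal p.

Lemma prime_idealD a b : p a -> p b -> p (a + b).
Proof. by have [_ + _ _] := pp; apply. Qed.

Lemma prime_idealMl a b : p b -> p (a * b).
Proof. by have [_ _ + _] := pp; apply. Qed.

Lemma prime_idealMr a b : p a -> p (a * b).
Proof. by rewrite mulrC; exact: prime_idealMl. Qed.

Lemma prime_idealN a : p a -> p (- a).
Proof. by rewrite -mulN1r; apply: prime_idealMl. Qed.

Lemma prime_idealB a b : p a -> p b -> p (a - b).
Proof. by move=> pa pb; apply: prime_idealD => //; exact: prime_idealN. Qed.

Lemma prime_ideal_cancel a b : p (a - b) -> p b -> p a.
Proof. by move=> pab pb; rewrite -(subrK b a); apply: prime_idealD. Qed.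

Lemma prime_ideal0 a : p a -> p 0.
Proof. by move=> pa; rewrite -(mul0r a); apply: prime_idealMl. Qed.

Lemma prime_ideal_sum (I : Type) (s : seq I) (P : pred I) F : p 0 ->
  (forall i, P i -> p (F i)) -> p (\sum_(i <- s | P i) F i).
Proof. by move=> p0 pF; apply: big_ind => //; exact: prime_idealD. Qed.

Lemma prime_idealNM a b : ~ p a -> ~ p b -> ~ p (a * b).
Proof. by have [_ _ _ pM] := pp => na nb /pM[]. Qed.

Lemma prime_idealNX a n : ~ p a -> ~ p (a ^+ n).
Proof.
move=> pa; elim: n => [|n IH]; first by have [+ _ _ _] := pp.
by rewrite exprS; apply: prime_idealNM.
Qed.

Lemma prime_idealN_prod (I : Type) (s : seq I) (P : pred I) F :
  (forall i, P i -> ~ p (F i)) -> ~ p (\prod_(i <- s | P i) F i).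
Proof.
move=> pF; apply: (big_ind (fun a => ~ p a)) => //; first by have [+ _ _ _] := pp.
by move=> a b; exact: prime_idealNM.
Qed.

Lemma coefs_in_horner q x : p 0 -> coefs_in p q -> p q.[x].
Proof.
move=> p0 pq; rewrite horner_coef; apply: prime_ideal_sum => // i _.
by apply: prime_idealMr.
Qed.

(** Leading terms with coefficient in p are dropped one by one. This gives access to the degree
    modulo p without forming a quotient ring. *)
Lemma trim_poly B q : subring B -> p 0 -> coefs_in B q -> ~ coefs_in p q ->
  exists q', [/\ coefs_in B q', ~ p (lead_coef q'), (size q' <= size q)%N &
    coefs_in p (q - q')].
Proof.
move=> sB p0; have [n] := ubnP (size q); elim: n q => // n IH q sq Bq pq.
have [pl|pl] := pselect (p (lead_coef q)); last first.
  by exists q; split=> // i; rewrite subrr coef0.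
have q0 : q != 0 by apply/eqP => q0; apply: pq => i; rewrite q0 coef0.
have sq0 : (0 < size q)%N by rewrite size_poly_gt0.
set l := lead_coef q *: 'X^((size q).-1).
have pl' : coefs_in p l.
  by move=> i; rewrite coefZ coefXn; case: eqP => _; rewrite ?mulr1 ?mulr0.
have sql : (size (q - l)%R <= (size q).-1)%N.
  apply/leq_sizeP => j; rewrite coefB coefZ coefXn leq_eqVlt => /orP[/eqP <-|qj].
    by rewrite eqxx mulr1 -lead_coefE subrr.
  rewrite (_ : (j == _) = false) ?mulr0 ?subr0 ?nth_default//; size_lia q q q.
case: (IH (q - l)) => [|||q' [Bq' pq' sq' pd]].
- by size_lia q q (q - l)%R.
- apply: coefs_inD => //; apply: coefs_inN => //; apply: coefs_inZ => //.
    by rewrite lead_coefE.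
  exact: coefs_inXn.
- move=> pql; apply: pq => i; apply: (@prime_ideal_cancel _ l`_i) => //.
  by rewrite -coefB.
exists q'; split=> //; first by size_lia q q' (q - l)%R.
move=> i; rewrite -(subrK l q) addrAC coefD; exact: prime_idealD.
Qed.

(** An algebraic equation for the class of x over the fractions of B modulo p. By the condition on
    the leading coefficient the size of q is not lowered modulo p; a minimal relation is thus a
    minimal polynomial up to a factor. *)
Definition relation B x q := [/\ coefs_in B q, p q.[x] & ~ p (lead_coef q)].

Definition minimal_relation B x f := relation B x f /\
  forall q, relation B x q -> (size f <= size q)%N.

Lemma minimal_relation_exists B x q : relation B x q ->
  exists f, minimal_relation B x f.
Proof.
move=> Rq; have exn : exists n, `[< exists2 f, relation B x f & size f = n >].
  by exists (size q); apply/asboolP; exists q.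
case: (ex_minnP exn) => n /asboolP[f Rf fn] nmin; exists f; split=> // g Rg.
by rewrite fn; apply: nmin; apply/asboolP; exists g.
Qed.

Lemma relation_neq0 B x f : relation B x f -> f != 0.
Proof.
move=> [_ pf pl]; apply/eqP => f0; apply: pl; rewrite f0 lead_coef0.
exact: prime_ideal0 pf.
Qed.

Lemma relation_size B x f : relation B x f -> (1 < size f)%N.
Proof.
move=> [_ pf pl]; rewrite ltnNge; apply/negP => /size1_polyC fC; apply: pl.
by move: pf; rewrite fC hornerC lead_coefC.
Qed.

Lemma minimal_relation_coefs B x f r : subring B -> minimal_relation B x f ->
  coefs_in B r -> p r.[x] -> (size r < size f)%N -> coefs_in p r.
Proof.
move=> sB [[_ pf _] fmin] Br pr sr; apply: contrapT => npr.
have p0 := prime_ideal0 pf.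
have [r' [Br' lr' sr' pd]] := trim_poly sB p0 Br npr.
have pr' : p r'.[x].
  apply: (@prime_ideal_cancel _ r.[x]) => //.
  rewrite -opprB -hornerN -hornerD; apply: prime_idealN.
  exact: coefs_in_horner.
by have := fmin r' (And3 Br' pr' lr'); size_lia f r r'.
Qed.

(** Separability in characteristic 0: the derivative is shorter than f, and its top coefficient is a
    positive integer times the leading coefficient of f, hence outside p. *)
Lemma minimal_relation_deriv B x f : subring B -> minimal_relation B x f ->
  (forall n a, p (n.+1%:R * a) -> p a) -> ~ p f^`().[x].
Proof.
move=> sB mf charp pf'; have [[Bf pf lf] fmin] := mf.
have p0 := prime_ideal0 pf.
have f0 := relation_neq0 mf.1; have sf := relation_size mf.1.
have := minimal_relation_coefs sB mf (coefs_in_deriv sB Bf) pf' (lt_size_deriv f0).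
move=> /(_ (size f).-2); rewrite coef_deriv -mulr_natl => /charp.
by rewrite (_ : (size f).-2.+1 = (size f).-1) -?lead_coefE//; size_lia f f f.
Qed.

(** By minimality the pseudo-remainder has all its coefficients in p; s is a power of the leading
    coefficient of f. *)
Lemma reduce_mod_minimal_relation B x f q : subring B -> minimal_relation B x f ->
  coefs_in B q -> p q.[x] ->
  exists s a r, [/\ ~ p s, coefs_in B r, coefs_in p r & s * q.[x] = a * f.[x] + r.[x]].
Proof.
move=> sB mf Bq pq; have [[Bf pf lf] fmin] := mf.
have f0 := relation_neq0 mf.1.
have [m [a [r [Ba Br E sr sa]]]] := pseudo_division sB f0 Bf Bq.
have Ex : lead_coef f ^+ m * q.[x] = a.[x] * f.[x] + r.[x].
  by rewrite -hornerZ E hornerD hornerM.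
exists (lead_coef f ^+ m), a.[x], r; split=> //; first exact: prime_idealNX.
apply: (minimal_relation_coefs sB mf Br _ sr).
rewrite (_ : r.[x] = lead_coef f ^+ m * q.[x] - a.[x] * f.[x]); last by rewrite Ex addrC addKr.
by apply: prime_idealB; apply: prime_idealMl.
Qed.

(** Modulo p, h is a nonzero element of an algebraic extension, so it has an inverse, and clearing
    denominators gives c. Concretely, J is the ideal generated by p and h, and q is a shortest
    polynomial over B with value in J but not in p; a Euclidean argument against f shows that q is
    constant. *)
Lemma eliminate_variable B x f h : subring B -> minimal_relation B x f ->
  (exists2 q, coefs_in B q & h = q.[x]) -> ~ p h ->
  exists c u, [/\ B c, ~ p c & p (c - u * h)].
Proof.
move=> sB mf [q0 Bq0 hq0] nph; have [[Bf pf lf] fmin] := mf.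
have p0 := prime_ideal0 pf; have f0 := relation_neq0 mf.1.
pose J z := exists u, p (z - u * h).
have pJ z : p z -> J z by move=> pz; exists 0; rewrite mul0r subr0.
have JB a b : J a -> J b -> J (a - b).
  move=> [u pu] [v pv]; exists (u - v).
  rewrite (_ : a - b - _ = (a - u * h) - (b - v * h)); first exact: prime_idealB.
  by ring.
have JM a b : J b -> J (a * b).
  by move=> [u pu]; exists (a * u); rewrite -mulrA -mulrBr; apply: prime_idealMl.
pose Q q := [/\ coefs_in B q, J q.[x], ~ p (lead_coef q) & ~ p q.[x]].
have trimQ q : coefs_in B q -> J q.[x] -> ~ p q.[x] ->
    exists2 q', Q q' & (size q' <= size q)%N.
  move=> Bq Jq npq.
  case: (@trim_poly B q) => // [pq|q' [Bq' lq' sq' pd]].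
    by apply: npq; apply: coefs_in_horner.
  have pqq' : p (q.[x] - q'.[x]) by rewrite -hornerN -hornerD; apply: coefs_in_horner.
  exists q' => //; split=> //.
    by rewrite -[q'.[x]](subKr q.[x]); apply: JB => //; apply: pJ.
  by move=> pq'; apply: npq; apply: prime_ideal_cancel pqq' pq'.
have exn : exists n, `[< exists2 q, Q q & size q = n >].
  have [|||q1 Q1 _] := trimQ q0 => //; rewrite -?hq0 //.
    by exists 1; rewrite mul1r subrr.
  by exists (size q1); apply/asboolP; exists q1.
case: (ex_minnP exn) => n /asboolP[q [Bq Jq lq npq] sqn] nmin.
have qmin r : coefs_in B r -> J r.[x] -> ~ p r.[x] -> (size q <= size r)%N.
  move=> Br Jr npr; have [r' Qr' sr'] := trimQ r Br Jr npr.
  by apply: leq_trans sr'; rewrite sqn; apply: nmin; apply/asboolP; exists r'.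
have q_neq0 : q != 0 by apply/eqP => q_eq0; apply: lq; rewrite q_eq0 lead_coef0.
have [q1|q1] := leqP (size q) 1.
  have qC := size1_polyC q1; exists q`_0; move: Jq; rewrite {1}qC hornerC => -[u pu].
  by exists u; split=> //; move: lq; rewrite qC lead_coefC -qC.
have sqf : (size q < size f)%N.
  rewrite ltnNge; apply/negP => sfq.
  have [m [a [r [Ba Br E sr sa]]]] := pseudo_division sB f0 Bf Bq.
  have Ex : r.[x] = lead_coef f ^+ m * q.[x] - a.[x] * f.[x].
    by rewrite -hornerZ E hornerD hornerM addrC addKr.
  suff : (size q <= size r)%N by size_lia f q r.
  apply: qmin => //; rewrite Ex.
    by apply: JB; [exact: JM|apply/pJ/prime_idealMl].
  move=> /prime_ideal_cancel => /(_ (prime_idealMl _ pf)).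
  by apply: prime_idealNM => //; exact: prime_idealNX.
(* A nonconstant q would be a factor of f modulo p. Minimality of q puts r.[x] in p, and then a.[x]
   as well; both a and r are shorter than f, so all their coefficients lie in p, and so does a
   multiple of the leading coefficient of f by elements outside p. *)
have [m [a [r [Ba Br E sr sa]]]] := pseudo_division sB q_neq0 Bq Bf.
have Ex : lead_coef q ^+ m * f.[x] = a.[x] * q.[x] + r.[x].
  by rewrite -hornerZ E hornerD hornerM.
have pr : p r.[x].
  apply: contrapT => npr; have : (size q <= size r)%N; last by size_lia f q r.
  apply: qmin => //.
  rewrite (_ : r.[x] = lead_coef q ^+ m * f.[x] - a.[x] * q.[x]); last by rewrite Ex addrC addKr.
  by apply: JB; [apply/pJ/prime_idealMl|exact: JM].
have pa : p a.[x].
  apply: contrapT => npa; apply: (prime_idealNM npa npq).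
  rewrite (_ : _ * _ = lead_coef q ^+ m * f.[x] - r.[x]); last by rewrite Ex addrK.
  by apply: prime_idealB => //; apply: prime_idealMl.
have cr : coefs_in p r by apply: minimal_relation_coefs mf Br pr _ => //; size_lia f q r.
have ca : coefs_in p a by apply: minimal_relation_coefs mf Ba pa _ => //; size_lia f q a.
exfalso; apply: (prime_idealNM (prime_idealNX (n := m) lq) lf).
rewrite (lead_coefE f) -coefZ E coefD; apply: prime_idealD => //.
by rewrite coefM; apply: prime_ideal_sum => // i _; apply: prime_idealMr.
Qed.

End PrimeIdeal.
End PolynomialsOverSubrings.

(** * Finite generation of ideals and triangular generators of prime ideals *)

Section NoetherianSubrings.
Context {A : comNzRingType}.
Implicit Types (B J : A -> Prop) (u : nat -> A).

Definition span B u n (h : A) :=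
  exists2 a : nat -> A, forall i, B (a i) & h = \sum_(i < n) a i * u i.

Definition noetherian B := forall J,
  (forall f, J f -> B f) -> J 0 ->
  (forall f g, J f -> J g -> J (f + g)) -> (forall b f, B b -> J f -> J (b * f)) ->
  exists n u, (forall i, (i < n)%N -> J (u i)) /\ forall f, J f -> span B u n f.

Section Span.
Variable B : A -> Prop.
Hypothesis sB : subring B.

Lemma span0 u n : span B u n 0.
Proof.
exists (fun=> 0); first by move=> _; exact: subring0.
by rewrite big1 // => i _; rewrite mul0r.
Qed.

Lemma spanD u n f g : span B u n f -> span B u n g -> span B u n (f + g).
Proof.
move=> [a Ba ->] [b Bb ->]; exists (fun i => a i + b i).
  by move=> i; exact: subringD.
by rewrite -big_split; apply: eq_bigr => i _; rewrite mulrDl.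
Qed.

Lemma spanM u n b f : B b -> span B u n f -> span B u n (b * f).
Proof.
move=> Bb [a Ba ->]; exists (fun i => b * a i).
  by move=> i; exact: subringM.
by rewrite mulr_sumr; apply: eq_bigr => i _; rewrite mulrA.
Qed.

Lemma span_sum u n (I : Type) (s : seq I) (P : pred I) F :
  (forall i, P i -> span B u n (F i)) -> span B u n (\sum_(i <- s | P i) F i).
Proof. by move=> HF; apply: big_ind => //; [exact: span0|exact: spanD]. Qed.

Lemma span_gen u n i : (i < n)%N -> span B u n (u i).
Proof.
have [B1 _ _] := sB => ltin; exists (fun j => (j == i)%:R).
  by move=> j; case: eqP => // _; exact: subring0.
rewrite (bigD1 (Ordinal ltin)) //= eqxx mul1r big1 ?addr0// => j /negbTE.
by rewrite -val_eqE /= => ->; rewrite mul0r.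
Qed.

Lemma span_widen u m n f : (m <= n)%N -> span B u m f -> span B u n f.
Proof.
move=> mn [a Ba ->]; apply: span_sum => i _; apply: spanM => //.
by apply: span_gen; rewrite (leq_trans (ltn_ord i)).
Qed.

Lemma noetherian_stationary : noetherian B -> forall u, (forall n, B (u n)) ->
  exists n, span B u n (u n).
Proof.
move=> nB u Bu.
have [||||n [g [gJ Jg]]] := nB (fun f => exists n, span B u n f).
- by move=> f [n [a Ba ->]]; apply: subring_sum => // i _; apply: subringM.
- by exists 0; exact: span0.
- move=> f g [m fm] [n gn]; exists (maxn m n); apply: spanD.
    by apply: span_widen fm; rewrite leq_maxl.
  by apply: span_widen gn; rewrite leq_maxr.
- by move=> b f Bb [n fn]; exists n; apply: spanM.
have /choice[k kP] : forall i, exists k, (i < n)%N -> span B u k (g i).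
  move=> i; have [/gJ[k gk]|_] := boolP (i < n)%N; first by exists k.
  by exists 0.
pose N := \max_(i < n) k i.
exists N; have [a Ba ->] : span B g n (u N).
  by apply: Jg; exists N.+1; apply: span_gen.
apply: span_sum => i _; apply: spanM => //.
by apply: span_widen (kP i (ltn_ord i)); exact: (@leq_bigmax _ (fun i : 'I_n => k i) i).
Qed.

End Span.

(** Hilbert's argument with shortest elements. As x may be algebraic over B, elements of B' are
    represented by polynomials over B, and length refers to the representative. From an ideal J
    without finite generation choose q n shortest with value in J outside the span of the earlier
    values; a combination of the earlier leading coefficients equal to that of q n would allow a
    shorter choice. *)
Lemma hilbert_basis B (x : A) B' : subring B -> subring B' ->
  (forall f, B' f <-> exists2 q, coefs_in B q & f = q.[x]) ->
  noetherian B -> noetherian B'.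
Proof.
move=> sB sB' B'P nB J JB' J0 JD JM; apply: contrapT => nfg.
have BB' b : B b -> B' b.
  by move=> Bb; apply/B'P; exists b%:P; [exact: coefs_inC|rewrite hornerC].
have B'x : B' x.
  apply/B'P; exists 'X; last by rewrite hornerX.
  by rewrite -['X]expr1; exact: coefs_inXn.
pose good (s : seq {poly A}) q :=
  [/\ coefs_in B q, J q.[x] & ~ span B' (fun i => (nth 0 s i).[x]) (size s) q.[x]].
(* The premise on s makes [next] satisfiable for every list, so that choice gives a total function;
   lists with values outside J get 0. *)
pose next s q := (forall i, (i < size s)%N -> J (nth 0 s i).[x]) ->
  good s q /\ forall r, good s r -> (size q <= size r)%N.
have /choice[f fP] : forall s, exists q, next s q.
  move=> s; have [sJ|?] := pselect (forall i, (i < size s)%N -> J (nth 0 s i).[x]); last by exists 0.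
  have exn : exists n, `[< exists2 q, good s q & size q = n >].
    apply: contrapT => ngood; apply: nfg; exists (size s), (fun i => (nth 0 s i).[x]).
    split=> // g Jg; apply: contrapT => ng; apply: ngood.
    have /B'P[q Bq gq] := JB' _ Jg; exists (size q); apply/asboolP; exists q => //.
    by split; rewrite -?gq.
  case: (ex_minnP exn) => n /asboolP[q Gq qn] nmin; exists q => _; split=> // r Gr.
  by rewrite qn; apply: nmin; apply/asboolP; exists r.
pose L := fix L n := if n is n'.+1 then rcons (L n') (f (L n')) else [::].
pose q n := f (L n).
have sL n : size (L n) = n by elim: n => //= n IH; rewrite size_rcons IH.
have nthL n i : (i < n)%N -> nth 0 (L n) i = q i.
  elim: n => // n IH; rewrite ltnS leq_eqVlt /= nth_rcons sL => /orP[/eqP->|h].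
    by rewrite ltnn eqxx.
  by rewrite h IH.
have JL n : forall i, (i < size (L n))%N -> J (nth 0 (L n) i).[x].
  elim: n => // n IH i /=; rewrite size_rcons nth_rcons ltnS leq_eqVlt.
  case: ltnP => [h _|h]; first exact: IH.
  by rewrite orbF => /eqP->; rewrite eqxx; have [[]] := fP (L n) IH.
pose ev i := (q i).[x].
have spanL n h : span B' (fun i => (nth 0 (L n) i).[x]) (size (L n)) h <-> span B' ev n h.
  by rewrite sL; split=> -[a Ba ->]; exists a => //; apply: eq_bigr => i _; rewrite nthL.
have qgood n : good (L n) (q n) by have [] := fP (L n) (JL n).
have qmin n r : coefs_in B r -> J r.[x] -> ~ span B' ev n r.[x] -> (size (q n) <= size r)%N.
  move=> Br Jr nr; have [_ fmin] := fP (L n) (JL n).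
  by apply: fmin; split=> // /spanL.
have Bq n : coefs_in B (q n) by have [] := qgood n.
have Jq n : J (ev n) by have [] := qgood n.
have nq n : ~ span B' ev n (ev n) by have [_ _ +] := qgood n; move=> + /spanL; apply.
have [n [a Ba lq]] : exists n, span B (fun i => lead_coef (q i)) n (lead_coef (q n)).
  by apply: noetherian_stationary => // i; rewrite lead_coefE; exact: Bq.
have qle i : (i < n)%N -> (size (q i) <= size (q n))%N.
  by move=> lin; apply: (qmin i _ (Bq n) (Jq n)) => /(span_widen sB' (ltnW lin)); exact: nq.
have qn0 : (0 < size (q n))%N.
  rewrite size_poly_gt0; apply/eqP => qn0; apply: (nq n); rewrite /ev qn0 horner0.
  exact: span0.
pose t i := a i *: 'X^(size (q n) - size (q i)) * q i.
have Bt i : coefs_in B (t i).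
  by apply: coefs_inM => //; apply: coefs_inZ => //; exact: coefs_inXn.
have tx i : (t i).[x] = a i * x ^+ (size (q n) - size (q i)) * ev i.
  by rewrite hornerM hornerZ hornerXn.
have Jneg g : J g -> J (- g).
  move=> Jg; rewrite -mulN1r; apply: JM => //.
  by apply: subringN => //; have [] := sB'.
have St i : (i < n)%N -> span B' ev n (t i).[x].
  move=> lin; rewrite tx; apply: spanM; [by []| |exact: span_gen].
  by apply: subringM => //; [exact: BB'|exact: subringX].
have Jt i : J (t i).[x].
  rewrite tx; apply: JM => //; apply: subringM => //; [exact: BB'|exact: subringX].
have := qmin n (q n - \sum_(i < n) t i).
rewrite leqNgt hornerD hornerN horner_sum => /(_ _ _ _)/negP; apply.
- apply: coefs_inD => //; apply: coefs_inN => //.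
  by apply: big_ind => //; [exact: coefs_in0|move=> *; exact: coefs_inD].
- apply: (JD); [exact: Jq|apply: Jneg].
  by apply: (big_ind J) => [|g h|i _]; [exact: J0|exact: JD|exact: Jt].
- move=> Sr; apply: (nq n); rewrite -[ev n](subrK (\sum_(i < n) (t i).[x])).
  by apply: spanD => //; apply: span_sum => // i _; exact: St.
rewrite -(prednK qn0) ltnS; apply/leq_sizeP => j jn.
rewrite coefB coef_sum.
have tj (i : 'I_n) : (t i)`_j = a i * (q i)`_(j - (size (q n) - size (q i))).
  have := qle i (ltn_ord i); rewrite /t -scalerAl coefZ coefXnM => qi.
  case: ltnP => // h; have [qi0|qi0] := posnP (size (q i)).
    by move/eqP: qi0; rewrite size_poly_eq0 => /eqP->; rewrite !coef0.
  by exfalso; size_lia (q n) (q i) (q i).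
under eq_bigr do rewrite tj.
move: jn; rewrite leq_eqVlt => /orP[/eqP <-|jn].
  rewrite -lead_coefE lq; apply/eqP; rewrite subr_eq0; apply/eqP.
  apply: eq_bigr => i _; rewrite lead_coefE; congr (_ * _`__).
  have := qle i (ltn_ord i); size_lia (q n) (q i) (q i).
rewrite nth_default; last by size_lia (q n) (q n) (q n).
rewrite big1 ?subr0// => i _; rewrite nth_default ?mulr0//.
have := qle i (ltn_ord i); size_lia (q n) (q i) (q i).
Qed.

End NoetherianSubrings.

Section GeneratedSubalgebras.
Context {K : fieldType} {A : comNzRingType} (k : {rmorphism K -> A}) {N : nat}.
Variable X : 'I_N -> A.
Implicit Types (S T : {set 'I_N}) (y : 'I_N) (ys : seq 'I_N) (p : A -> Prop).

Inductive gen S : A -> Prop :=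
| gen_const a : gen S (k a)
| gen_var i : i \in S -> gen S (X i)
| gen_add f g : gen S f -> gen S g -> gen S (f + g)
| gen_mul f g : gen S f -> gen S g -> gen S (f * g).

Lemma subring_gen S : subring (gen S).
Proof.
split=> [|a b Sa Sb|]; [by rewrite -(rmorph1 k); exact: gen_const| |exact: gen_mul].
apply: gen_add => //; rewrite -mulN1r -(rmorphN1 k); apply: gen_mul => //.
exact: gen_const.
Qed.
Hint Resolve subring_gen : core.

Lemma gen_mono S T f : S \subset T -> gen S f -> gen T f.
Proof.
move=> /fintype.subsetP ST; elim=> [a|i /ST iT|g h _ Tg _ Th|g h _ Tg _ Th].
- exact: gen_const.
- exact: gen_var.
- exact: gen_add.
- exact: gen_mul.
Qed.

Lemma genU1P S y f : gen (y |: S) f <-> exists2 q, coefs_in (gen S) q & f = q.[X y].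
Proof.
split; last first.
  move=> [q Sq ->]; rewrite horner_coef; apply: subring_sum => // i _.
  apply: gen_mul; first by apply: gen_mono (Sq i); exact: subsetU1.
  by apply: subringX => //; apply: gen_var; rewrite finset.setU11.
elim=> [a|i|g h _ [q Sq ->] _ [r Sr ->]|g h _ [q Sq ->] _ [r Sr ->]].
- by exists (k a)%:P; [apply: coefs_inC => //; exact: gen_const|rewrite hornerC].
- move=> /finset.setU1P[->|iS].
    exists 'X; last by rewrite hornerX.
    by rewrite -['X]expr1; exact: coefs_inXn.
  by exists (X i)%:P; [apply: coefs_inC => //; exact: gen_var|rewrite hornerC].
- by exists (q + r); [exact: coefs_inD|rewrite hornerD].
- by exists (q * r); [exact: coefs_inM|rewrite hornerM].
Qed.

Lemma gen_set0 f : gen finset.set0 f -> exists a, f = k a.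
Proof.
elim=> [a|i|g h _ [a ->] _ [b ->]|g h _ [a ->] _ [b ->]].
- by exists a.
- by rewrite finset.in_set0.
- by exists (a + b); rewrite rmorphD.
- by exists (a * b); rewrite rmorphM.
Qed.

Lemma noetherian_gen S : noetherian (gen S).
Proof.
have [n] := ubnP #|S|; elim: n S => // n IH S; rewrite ltnS => Sn.
have [->|[y yS]] := set_0Vmem S; last first.
  rewrite -(finset.setD1K yS); apply: (hilbert_basis _ _ (genU1P _ y)) => //.
  by apply: IH; apply: leq_trans Sn; rewrite [leqRHS](cardsD1 y) yS.
move=> J JB J0 JD JM; have [[f [Jf f0]]|nJ] := pselect (exists f, J f /\ f != 0).
  exists 1, (fun=> f); split=> // g Jg.
  have [a fa] := gen_set0 (JB _ Jf); have [b gb] := gen_set0 (JB _ Jg).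
  have a0 : a != 0 by apply: contra f0 => /eqP a0; rewrite fa a0 rmorph0.
  exists (fun=> k (b / a)); first by move=> _; exact: gen_const.
  by rewrite big_ord1 fa gb -rmorphM divfK.
exists 0, (fun=> 0); split=> // f Jf; exists (fun=> 0); first by move=> _; exact: subring0.
rewrite big_ord0; apply/eqP; apply: contrapT => /negP f0.
by apply: nJ; exists f.
Qed.

Section Derivations.
Variable D : 'I_N -> A -> A.
Hypothesis Dk : forall i a, D i (k a) = 0.
Hypothesis DX : forall i j, D i (X j) = (i == j)%:R.
Hypothesis DD : forall i f g, D i (f + g) = D i f + D i g.
Hypothesis DM : forall i f g, D i (f * g) = D i f * g + f * D i g.

Lemma derivation_gen0 S y f : y \notin S -> gen S f -> D y f = 0.
Proof.
move=> yS; elim=> [a|i iS|g h _ Dg _ Dh|g h _ Dg _ Dh].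
- exact: Dk.
- by rewrite DX; case: eqP iS yS => // -> ->.
- by rewrite DD Dg Dh addr0.
- by rewrite DM Dg Dh mulr0 mul0r addr0.
Qed.

Lemma derivation_horner S y q : y \notin S -> coefs_in (gen S) q ->
  D y q.[X y] = q^`().[X y].
Proof.
move=> yS; elim/poly_ind: q => [_|q c IH Sq].
  by rewrite deriv0 !horner0 -(rmorph0 k) Dk rmorph0.
have Sq' : coefs_in (gen S) q.
  by move=> i; have := Sq i.+1; rewrite coefD coefMX coefC /= addr0.
have Sc : gen S c by have := Sq 0; rewrite coefD coefMX coefC /= add0r.
rewrite hornerMXaddC derivMXaddC hornerD hornerM hornerX DD DM.
by rewrite (derivation_gen0 yS Sc) IH// DX eqxx mulr1 addr0 addrC.
Qed.

(** Each F i is the value of a minimal relation of one variable over T and the variables before it.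
    Hence the Jacobian is triangular, and its diagonal avoids p by separability. Reducing modulo the
    last relation leaves coefficients in p with one variable less, so the F i generate p up to a
    denominator outside p. *)
Lemma triangular_system p T ys : prime_ideal p ->
  (forall n a, p (n.+1%:R * a) -> p a) ->
  (forall h, gen T h -> p h -> h = 0) ->
  (forall y, y \in ys -> exists q, relation p (gen T) (X y) q) ->
  uniq ys -> (forall y, y \in ys -> y \notin T) ->
  exists F : nat -> A,
    (forall x0 i, (i < size ys)%N ->
       [/\ gen (T :|: [set y in ys])%SET (F i), p (F i), ~ p (D (nth x0 ys i) (F i)) &
           forall j, (i < j < size ys)%N -> D (nth x0 ys j) (F i) = 0]) /\
    forall h, gen (T :|: [set y in ys])%SET h -> p h ->
      exists2 s, ~ p s & span (fun=> True) F (size ys) (s * h).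
Proof.
move=> pp charp indT; elim/last_ind: ys => [|ys y IH] algT.
  move=> _ _; exists (fun=> 0); split=> // h Th ph.
  exists 1; first by have [] := pp.
  rewrite mul1r (indT h) //; first exact: span0.
  apply: gen_mono Th.
  by apply/fintype.subsetP => i; rewrite finset.in_setU finset.in_set => /orP[].
rewrite rcons_uniq => /andP[yys uys] ysT.
have [|||F [FP Fspan]] := IH => //.
- by move=> x xys; apply: algT; rewrite mem_rcons in_cons xys orbT.
- by move=> x xys; apply: ysT; rewrite mem_rcons in_cons xys orbT.
set S := (T :|: [set y in ys])%SET in FP Fspan *.
have TS : T \subset S by exact: finset.subsetUl.
have yT : y \notin T by apply: ysT; rewrite mem_rcons mem_head.
have yS : y \notin S by rewrite /S finset.in_setU finset.in_set negb_or yT.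
have -> : (T :|: [set x in rcons ys y])%SET = y |: S.
  apply/finset.setP => x; rewrite finset.in_setU1 !finset.in_setU !finset.in_set.
  by rewrite mem_rcons in_cons orbCA.
have SyS : S \subset y |: S by exact: subsetU1.
have yy : y \in rcons ys y by rewrite mem_rcons mem_head.
have [q [Tq pq lq]] := algT y yy.
have [f mf] : exists f, minimal_relation p (gen S) (X y) f.
  by apply: (minimal_relation_exists (q := q)); split=> // i; apply: gen_mono (Tq i).
have [[Sf pf lf] _] := mf.
pose G i := if (i < size ys)%N then F i else f.[X y].
have Gy : G (size ys) = f.[X y] by rewrite /G ltnn.
have GF i : (i < size ys)%N -> G i = F i by rewrite /G => ->.
exists G; split.
  move=> x0 i; rewrite size_rcons ltnS leq_eqVlt => /orP[/eqP->|ilt].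
    rewrite Gy nth_rcons ltnn eqxx (derivation_horner yS Sf); split=> //.
    - by apply/genU1P; exists f.
    - exact: (minimal_relation_deriv pp (subring_gen S) mf).
    - by move=> j /andP[h]; rewrite ltnS leqNgt h.
  rewrite GF// nth_rcons ilt; have [SF pF pDF DF] := FP x0 i ilt.
  split=> //; first exact: gen_mono SF.
  move=> j /andP[ij]; rewrite ltnS leq_eqVlt nth_rcons => /orP[/eqP->|jlt].
    by rewrite ltnn eqxx; apply: derivation_gen0 SF.
  by rewrite jlt; apply: DF; rewrite ij.
move=> h /genU1P[q0 Sq0 ->] ph; rewrite size_rcons.
have sT : subring (fun _ : A => True) by [].
have [s [a [r [ps Sr pr E]]]] := reduce_mod_minimal_relation pp (subring_gen S) mf Sq0 ph.
have /choice[t tP] : forall i, exists t, ~ p t /\ span (fun=> True) F (size ys) (t * r`_i).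
  by move=> i; have [t pt St] := Fspan _ (Sr i) (pr i); exists t.
(* A common denominator for all coefficients of the remainder. *)
pose u := \prod_(i < size r) t i.
exists (u * s).
  apply: prime_idealNM => //; apply: prime_idealN_prod => // i _.
  by have [] := tP i.
rewrite -mulrA E mulrDr; apply: spanD => //.
  by rewrite -Gy mulrA; apply: spanM => //; apply: span_gen.
rewrite horner_coef mulr_sumr; apply: span_sum => // i _.
rewrite mulrA [_ * _ ^+ _]mulrC; apply: spanM => //.
rewrite /u (bigD1 i) //= mulrAC mulrC; apply: spanM => //.
have [_ [b _ ->]] := tP i; apply: span_sum => // j _; apply: spanM => //.
by rewrite -GF//; apply: span_gen => //; rewrite ltnS ltnW.
Qed.

End Derivations.

Lemma eliminate_variables p T ys h : prime_ideal p -> p 0 ->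
  (forall y, y \in ys -> exists q, relation p (gen T) (X y) q) ->
  gen (T :|: [set y in ys])%SET h -> ~ p h ->
  exists c u, [/\ gen T c, ~ p c & p (c - u * h)].
Proof.
move=> pp p0; elim/last_ind: ys h => [|ys y IH] h algT Th ph.
  exists h, 1; rewrite mul1r subrr; split=> //.
  apply: gen_mono Th; apply/fintype.subsetP => i.
  by rewrite finset.in_setU finset.in_set => /orP[].
set S := (T :|: [set y in ys])%SET in IH.
have TS : T \subset S by exact: finset.subsetUl.
have SE : (T :|: [set x in rcons ys y])%SET = y |: S.
  apply/finset.setP => x; rewrite finset.in_setU1 !finset.in_setU !finset.in_set.
  by rewrite mem_rcons in_cons orbCA.
have yy : y \in rcons ys y by rewrite mem_rcons mem_head.
have [q [Tq pq lq]] := algT y yy.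
have [f mf] : exists f, minimal_relation p (gen S) (X y) f.
  by apply: (minimal_relation_exists (q := q)); split=> // i; apply: gen_mono (Tq i).
rewrite SE in Th; have hq := (genU1P S y h).1 Th.
have [c [u [Sc pc pcu]]] := eliminate_variable pp (subring_gen S) mf hq ph.
have [|c' [u' [Tc' pc' pcu']]] := IH c _ Sc pc.
  by move=> x xys; apply: algT; rewrite mem_rcons in_cons xys orbT.
exists c', (u' * u); split=> //.
rewrite (_ : _ - _ = (c' - u' * c) + u' * (c - u * h)); last by ring.
by apply: prime_idealD => //; apply: prime_idealMl.
Qed.

Definition independent p T := forall h, gen T h -> p h -> h = 0.

(** Maximality is with respect to inclusion: it makes every other variable algebraic over T, as
    elimination requires. *)
Definition max_independent p T := independent p T /\
  forall T', T \subset T' -> independent p T' -> T' = T.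

Lemma max_independent_exists p T0 : independent p T0 ->
  exists2 T : {set 'I_N}, T0 \subset T & max_independent p T.
Proof.
move=> indT0; pose Q (T : {set 'I_N}) := `[< T0 \subset T /\ independent p T >].
have QT0 : Q T0 by apply/asboolP.
case: (@arg_maxnP _ T0 Q (fun T : {set 'I_N} => #|T|) QT0) => T /asboolP[T0T indT] Tmax.
exists T => //; split=> // T' TT' indT'; apply/esym/eqP.
rewrite eqEcard TT'; apply: Tmax; apply/asboolP; split=> //.
exact: fintype.subset_trans TT'.
Qed.

Lemma max_independent_relation p T y : p 0 -> max_independent p T -> y \notin T ->
  exists q, relation p (gen T) (X y) q.
Proof.
move=> p0 [indT Tmax] yT.
have /existsNP[h /not_implyP[Th /not_implyP[ph h0]]] : ~ independent p (y |: T).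
  move=> indyT; have := Tmax _ (finset.subsetU1 _ _) indyT.
  by move=> E; move: yT; rewrite -E finset.setU11.
have [q Tq hq] := (genU1P T y h).1 Th; exists q; split; rewrite -?hq//.
move=> pl; apply: h0; rewrite hq; suff -> : q = 0 by rewrite horner0.
apply/eqP; rewrite -lead_coef_eq0; apply/eqP; apply: indT => //.
by rewrite lead_coefE.
Qed.

Lemma max_independent_eliminate p T h : prime_ideal p -> p 0 -> max_independent p T ->
  gen finset.setT h -> ~ p h -> exists c u, [/\ gen T c, c != 0 & p (c - u * h)].
Proof.
move=> pp p0 mT Th ph.
have [||c [u [Tc pc pcu]]] := @eliminate_variables p T (enum (~: T)%SET) h pp p0 _ _ ph.
- by move=> y; rewrite mem_enum finset.in_setC; exact: max_independent_relation.
- apply: gen_mono Th; apply/fintype.subsetP => y _.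
  by rewrite finset.in_setU finset.in_set mem_enum finset.in_setC orbN.
by exists c, u; split=> //; apply/eqP => c0; apply: pc; rewrite c0.
Qed.

End GeneratedSubalgebras.

(** * Zero sets and their dimension *)

Section Decompositions.
Context {T : Type}.
Variable closed : set (set T).
Hypothesis closedI : forall V W, closed V -> closed W -> closed (V `&` W).
Hypothesis closedU : forall V W, closed V -> closed W -> closed (V `|` W).
Hypothesis closed0 : closed set0.
Implicit Types (V W Z : set T) (C : set (set T)).

Lemma irreducible_sub_setU V W1 W2 : irreducible closed V -> closed W1 -> closed W2 ->
  V `<=` W1 `|` W2 -> V `<=` W1 \/ V `<=` W2.
Proof.
move=> [cV V0 irrV] cW1 cW2 VW.
have [|E|E] := irrV (V `&` W1) (V `&` W2) (closedI cV cW1) (closedI cV cW2).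
- by rewrite -setIUr; apply/esym/setIidl.
- by left; apply/setIidPl.
- by right; apply/setIidPl.
Qed.

Lemma irreducible_sub_bigcup V C : irreducible closed V -> finite_set C ->
  (forall Z, C Z -> closed Z) -> V `<=` \bigcup_(Z in C) Z ->
  exists2 Z, C Z & V `<=` Z.
Proof.
move=> irrV /finite_seqP[s ->{C}] cs Vs.
suff : exists2 Z, Z \in s & V `<=` Z by [].
have {}cs Z : Z \in s -> closed Z by exact: cs.
have {}Vs : V `<=` [set x | exists2 Z, Z \in s & Z x] by move=> x /Vs[Z sZ Zx]; exists Z.
elim: s cs Vs => [|Z s IH] cs Vs.
  by have [_ [x Vx] _] := irrV; have [] := Vs x Vx.
have cS : closed [set x | exists2 Z, Z \in s & Z x].
  elim: s cs {IH Vs} => [|Y s IH] cs.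
    rewrite (_ : [set _ | _] = set0) //; apply/seteqP; split=> // x [Y].
    by rewrite in_nil.
  rewrite (_ : [set _ | _] = Y `|` [set x | exists2 Z, Z \in s & Z x]).
    apply: closedU; first by apply: cs; rewrite in_cons mem_head orbT.
    apply: IH => W; rewrite in_cons => /orP[/eqP ->|Ws]; apply: cs.
      exact: mem_head.
    by rewrite !in_cons Ws !orbT.
  apply/seteqP; split=> x.
    move=> [W]; rewrite in_cons => /orP[/eqP ->|Ws]; first by left.
    by right; exists W.
  move=> [Yx|[W Ws Wx]]; first by exists Y => //; exact: mem_head.
  by exists W => //; rewrite in_cons Ws orbT.
have [||VZ|VS] := @irreducible_sub_setU V Z _ irrV _ cS.
- by apply: cs; exact: mem_head.
- move=> x /Vs[W]; rewrite in_cons => /orP[/eqP ->|Ws]; first by left.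
  by right; exists W.
- by exists Z => //; exact: mem_head.
have [|W Ws VW] := IH _ VS.
  by move=> W Ws; apply: cs; rewrite in_cons Ws orbT.
by exists W => //; rewrite in_cons Ws orbT.
Qed.

Lemma irr_decomposition_sub V C C' : irr_decomposition closed V C ->
  irr_decomposition closed V C' -> C `<=` C'.
Proof.
move=> [fC iC aC VC] [fC' iC' aC' VC'] Z CZ.
have sub (D D' : set (set T)) : finite_set D' -> (forall Y, D Y -> irreducible closed Y) ->
    (forall Y, D' Y -> irreducible closed Y) ->
    \bigcup_(Y in D) Y = \bigcup_(Y in D') Y -> forall Y, D Y -> exists2 Y', D' Y' & Y `<=` Y'.
  move=> fD' iD iD' DD' Y DY; apply: irreducible_sub_bigcup => //; first exact: iD.
    by move=> Y' /iD'[].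
  by rewrite -DD' => x Yx; exists Y.
have [Y C'Y ZY] := sub C C' fC' iC iC' (etrans (esym VC) VC') Z CZ.
have [Z' CZ' YZ'] := sub C' C fC iC' iC (etrans (esym VC') VC) Y C'Y.
have ZZ' : Z = Z' by apply: aC => //; exact: subset_trans YZ'.
by rewrite (_ : Z = Y)//; apply/seteqP; split=> //; rewrite ZZ'.
Qed.

Lemma irr_decomposition_unique V C C' : irr_decomposition closed V C ->
  irr_decomposition closed V C' -> C = C'.
Proof. by move=> d d'; apply/seteqP; split; [exact: irr_decomposition_sub d d'|exact: irr_decomposition_sub d' d]. Qed.

Lemma irr_decomposition1 V : irreducible closed V -> irr_decomposition closed V [set V].
Proof.
move=> irrV; split.
- exact: finite_set1.
- by move=> Z ->.
- by move=> Z Z' -> ->.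
- by rewrite bigcup_set1.
Qed.

Lemma irr_decomposition_antichain V (s : seq (set T)) :
  (forall Z, Z \in s -> irreducible closed Z) -> V = \bigcup_(Z in [set` s]) Z ->
  exists C, irr_decomposition closed V C.
Proof.
have [n] := ubnP (size s); elim: n s => // n IH s sn irrs Vs.
have [[Z [Z' [sZ sZ' ZZ' neq]]]|anti] :=
    pselect (exists Z Z', [/\ Z \in s, Z' \in s, Z `<=` Z' & Z <> Z']); last first.
  exists [set` s]; split=> //.
  move=> Z Z' sZ sZ' ZZ'; apply: contrapT => neq; apply: anti.
  by exists Z, Z'.
apply: (IH [seq Y <- s | Y != Z]).
- rewrite -ltnS; apply: leq_trans sn; rewrite ltnS size_filter -(count_predC (pred1 Z) s).
  rewrite -[X in (X < _)%N]add0n ltn_add2r -has_count.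
  by apply/hasP; exists Z => /=.
- by move=> Y; rewrite mem_filter => /andP[_]; exact: irrs.
rewrite Vs; apply/seteqP; split=> x [Y /= sY Yx]; last first.
  by exists Y => //=; move: sY; rewrite mem_filter => /andP[].
have [YZ|YZ] := eqVneq Y Z.
  exists Z'; last by apply: ZZ'; rewrite -YZ.
  by rewrite /= mem_filter sZ' andbT; apply/eqP => E; apply: neq.
by exists Y => //=; rewrite mem_filter YZ.
Qed.

(** Noetherian induction: a closed set without decomposition properly contains another one, and
    choice iterates this into a forbidden descending chain. *)
Lemma irr_decomposition_exists :
  (forall V : nat -> set T, (forall n, closed (V n)) -> ~ forall n, V n.+1 `<` V n) ->
  forall V, closed V -> exists C, irr_decomposition closed V C.
Proof.
move=> dcc V cV; pose dec V := exists2 s : seq (set T),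
  forall Z, Z \in s -> irreducible closed Z & V = \bigcup_(Z in [set` s]) Z.
suff [s irrs Vs] : dec V by exact: irr_decomposition_antichain Vs.
apply: contrapT => ndec.
have /choice[f fP] : forall W, exists W', closed W -> ~ dec W -> [/\ closed W', ~ dec W' & W' `<` W].
  move=> W; have [[cW nW]|nW] := pselect (closed W /\ ~ dec W); last first.
    by exists set0 => cW ndW; exfalso; apply: nW.
  apply: contrapT => /forallNP nex; apply: nW.
  have decW' W' : closed W' -> W' `<` W -> dec W'.
    by move=> cW' W'W; apply: contrapT => ndW'; apply: (nex W') => _ _.
  have [W0|/set0P W0] := eqVneq W set0.
    exists [::] => //; rewrite W0; apply/seteqP; split=> // x [Z /=].
    by rewrite in_nil.
  have [irrW|] := pselect (irreducible closed W).
    exists [:: W]; first by move=> Z; rewrite mem_seq1 => /eqP ->.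
    apply/seteqP; split=> x; first by exists W => //=; rewrite mem_seq1.
    by move=> [Z /=]; rewrite mem_seq1 => /eqP ->.
  move=> nirr; have /existsNP[W1 /existsNP[W2]] : ~ forall V1 V2, closed V1 -> closed V2 ->
      W = V1 `|` V2 -> V1 = W \/ V2 = W by move=> H; apply: nirr.
  move=> /not_implyP[c1 /not_implyP[c2 /not_implyP[W12 /not_orP[n1 n2]]]].
  have [s1 irr1 E1] : dec W1.
    by apply: decW' => //; rewrite properEneq; split; [exact/eqP|rewrite W12; exact: subsetUl].
  have [s2 irr2 E2] : dec W2.
    by apply: decW' => //; rewrite properEneq; split; [exact/eqP|rewrite W12; exact: subsetUr].
  exists (s1 ++ s2); first by move=> Z; rewrite mem_cat => /orP[/irr1|/irr2].
  rewrite W12 E1 E2; apply/seteqP; split=> x.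
    by move=> [[Z sZ Zx]|[Z sZ Zx]]; exists Z => //=; rewrite mem_cat sZ ?orbT.
  by move=> [Z /=]; rewrite mem_cat => /orP[sZ|sZ] Zx; [left|right]; exists Z.
have itP n : closed (iter n f V) /\ ~ dec (iter n f V).
  by elim: n => // n [cn nn]; have [] := fP _ cn nn.
apply: (dcc (fun n => iter n f V)) => [n|n]; first by have [] := itP n.
by have [cn nn] := itP n; have [] := fP _ cn nn.
Qed.

End Decompositions.

Section ZerosOfEvaluations.
Context {R : realType} {T : Type} {M : comNzRingType}.
Variable ev : M -> T -> R.
Hypothesis ev1 : forall x, ev 1 x = 1.
Hypothesis evD : forall p q x, ev (p + q) x = ev p x + ev q x.
Hypothesis evM : forall p q x, ev (p * q) x = ev p x * ev q x.
Implicit Types (V W Z : set T) (qs : seq M).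

Definition zeros qs : set T := [set x | forall q, q \in qs -> ev q x = 0].

(** An ideal of formal polynomials and not of functions. For the exponential evaluation it is the
    ideal, in n + 2 variables, of the lift of V to the graph of exp, and can be compared with the
    ideals of algebraic sets there. *)
Definition vanishing V : M -> Prop := fun q => forall x, V x -> ev q x = 0.

Local Notation closed := (zero_set (range ev)).

Lemma ev0 x : ev 0 x = 0.
Proof. by apply: (@addrI _ (ev 0 x)); rewrite -evD !addr0. Qed.

Lemma zero_set_zeros V : closed V <-> exists qs, V = zeros qs.
Proof.
split=> [[fs fsP ->]|[qs ->]].
  have /choice[Q QP] : forall i, exists q, (i < size fs)%N -> ev q = fs`_i.
    move=> i; have [/fsP[q _ <-]|_] := boolP (i < size fs)%N; first by exists q.
    by exists 0.
  exists (mkseq Q (size fs)); apply/seteqP; split=> x Zx.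
    by move=> q /mapP[i]; rewrite mem_iota => /= ilt ->; rewrite QP//; apply: Zx.
  move=> i ilt; rewrite -QP//; apply: Zx; apply/mapP; exists i => //.
  by rewrite mem_iota.
exists (map ev qs) => [i|].
  by rewrite size_map => ilt; exists qs`_i => //; rewrite (nth_map 0).
apply/seteqP; split=> x Zx.
  by move=> i; rewrite size_map => ilt; rewrite (nth_map 0)//; apply: Zx; exact: mem_nth.
move=> q qqs; have ilt : (index q qs < size qs)%N by rewrite index_mem.
have := Zx (index q qs); rewrite size_map => /(_ ilt).
by rewrite (nth_map 0)// nth_index.
Qed.

Lemma closed_zeros qs : closed (zeros qs).
Proof. by apply/zero_set_zeros; exists qs. Qed.

Lemma closed_zero q : closed [set x | ev q x = 0].
Proof.
rewrite (_ : [set _ | _] = zeros [:: q]); first exact: closed_zeros.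
apply/seteqP; split=> x; last by apply; exact: mem_head.
by move=> qx r; rewrite mem_seq1 => /eqP ->.
Qed.

Lemma zero_setI V W : closed V -> closed W -> closed (V `&` W).
Proof.
move=> /zero_set_zeros[vs ->] /zero_set_zeros[ws ->]; apply/zero_set_zeros.
exists (vs ++ ws); apply/seteqP; split=> x.
  by move=> [Vx Wx] q; rewrite mem_cat => /orP[/Vx|/Wx].
by move=> VWx; split=> q qs; apply: VWx; rewrite mem_cat qs ?orbT.
Qed.

Lemma zero_setU V W : closed V -> closed W -> closed (V `|` W).
Proof.
move=> /zero_set_zeros[vs ->] /zero_set_zeros[ws ->]; apply/zero_set_zeros.
exists [seq v * w | v <- vs, w <- ws]; apply/seteqP; split=> x.
  move=> VWx q /allpairsP[[v w] [/= vvs wws ->]]; rewrite evM.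
  by case: VWx => [/(_ _ vvs)->|/(_ _ wws)->]; rewrite ?mul0r ?mulr0.
move=> VWx; have [Vx|/existsNP[v /not_implyP[vvs vx]]] := pselect (zeros vs x).
  by left.
right=> w wws; have := VWx (v * w); rewrite evM => /(_ (allpairs_f _ vvs wws)).
by move=> /eqP; rewrite mulf_eq0 => /orP[/eqP|/eqP//].
Qed.

Lemma zero_set0 : closed set0.
Proof.
rewrite (_ : set0 = [set x | ev 1 x = 0]); first exact: closed_zero.
by apply/seteqP; split=> // x /=; rewrite ev1 => /eqP; rewrite oner_eq0.
Qed.

Lemma zero_set_separate V x : closed V -> ~ V x -> exists2 q, vanishing V q & ev q x != 0.
Proof.
move=> /zero_set_zeros[qs ->] /existsNP[q /not_implyP[qqs /eqP qx]].
by exists q => // y Vy; apply: Vy.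
Qed.

Lemma vanishing0 V : vanishing V 0.
Proof. by move=> x _; rewrite ev0. Qed.

Lemma vanishing_prime V : irreducible closed V -> prime_ideal (vanishing V).
Proof.
move=> irrV; have [cV [x Vx] _] := irrV; split.
- by move=> /(_ x Vx); rewrite ev1 => /eqP; rewrite oner_eq0.
- by move=> p q Vp Vq y Vy; rewrite evD Vp// Vq// addr0.
- by move=> p q Vq y Vy; rewrite evM Vq// mulr0.
move=> p q Vpq.
have [|H|H] := irreducible_sub_setU zero_setI irrV (closed_zero p) (closed_zero q).
- by move=> y Vy; have /eqP := Vpq y Vy; rewrite evM mulf_eq0 => /orP[]/eqP; [left|right].
- by left=> y /H.
- by right=> y /H.
Qed.

Lemma vanishing_witness V q : ~ vanishing V q -> exists2 x, V x & ev q x != 0.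
Proof. by move=> /existsNP[x /not_implyP[Vx /eqP qx]]; exists x. Qed.

(** A polynomial that vanishes on V (n+1) but not on V n is no combination of the earlier ones,
    since all of those vanish on V n. *)
Lemma zero_set_dcc : noetherian (fun _ : M => True) -> forall V : nat -> set T,
  (forall n, closed (V n)) -> ~ forall n, V n.+1 `<` V n.
Proof.
move=> nM V cV dV.
have /choice[q qP] : forall n, exists q, vanishing (V n.+1) q /\ ~ vanishing (V n) q.
  move=> n; have [_ /existsNP[x /not_implyP[Vx nVx]]] := dV n.
  have [q Vq qx] := zero_set_separate (cV n.+1) nVx.
  by exists q; split=> // /(_ x Vx)/eqP; exact/negP.
have Vmono m n : (m <= n)%N -> V n `<=` V m.
  move=> /subnKC <-; elim: (n - m)%N => [|k IH]; first by rewrite addn0.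
  by rewrite addnS; apply: subset_trans IH; have [] := dV (m + k)%N.
have sM : subring (fun _ : M => True) by [].
have [n [a _ E]] := noetherian_stationary sM nM (fun n => I : (fun _ => True) (q n)).
have [_] := qP n; apply=> x Vx; rewrite E.
apply: (big_ind (fun q => ev q x = 0)) => [|p r px rx|i _]; first exact: ev0.
  by rewrite evD px rx addr0.
rewrite evM; have [Vi _] := qP i; rewrite Vi ?mulr0//.
exact: Vmono (ltn_ord i) _ Vx.
Qed.

End ZerosOfEvaluations.

Section PolynomialFunctions.
Context {R : realType} {K : fieldType}.
Variable iota : {rmorphism K -> R}.

Definition mpoly_const {N} : {rmorphism K -> {mpoly K[N]}} := @mpoly.mpolyC N K.
Definition mpoly_var {N} (i : 'I_N) : {mpoly K[N]} := mpoly.mpolyX K (mpoly.mnm1 i).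

Local Notation gen := (gen (@mpoly_const _) (@mpoly_var _)).

(** Serves as an induction principle on polynomials, over constants, variables, sums and
    products. *)
Lemma gen_mpoly N (Q : {mpoly K[N]}) : gen finset.setT Q.
Proof.
elim/mpoly.mpolyind: Q => [|c m q _ _ IH].
  rewrite -(rmorph0 mpoly_const); exact: gen_const.
apply: gen_add => //; rewrite -mpoly.mul_mpolyC; apply: gen_mul; first exact: gen_const.
rewrite mpoly.mpolyXE_id; apply: (big_ind (gen finset.setT)).
- rewrite -(rmorph1 mpoly_const); exact: gen_const.
- by move=> *; exact: gen_mul.
- move=> i _; apply: subringX; first exact: subring_gen.
  by apply: gen_var; rewrite finset.in_setT.
Qed.

Lemma mpoly_noetherian N : noetherian (fun _ : {mpoly K[N]} => True).
Proof.
have -> : (fun _ : {mpoly K[N]} => True) = gen finset.setT.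
  by apply/funext => Q; apply/propext; split=> // _; exact: gen_mpoly.
exact: noetherian_gen.
Qed.

Lemma mderiv_var N (j i : 'I_N) : mpoly.mderiv j (mpoly_var i) = (j == i)%:R :> {mpoly K[N]}.
Proof.
rewrite /mpoly_var mpoly.mderivX mpoly.mnm1E eq_sym.
case: eqP => [->|_]; last by rewrite scale0r.
rewrite scale1r -mpoly.mpolyX0; congr mpoly.mpolyX.
by apply/mpoly.mnmP => l; rewrite mpoly.mnmBE subnn mpoly.mnm0E.
Qed.

Context {N : nat}.
Implicit Types (Q : {mpoly K[N]}) (x : 'rV[R]_N).

Lemma pevalD p q x : peval iota (p + q) x = peval iota p x + peval iota q x.
Proof. exact: raddfD. Qed.

Lemma pevalM p q x : peval iota (p * q) x = peval iota p x * peval iota q x.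
Proof. exact: rmorphM. Qed.

Lemma peval1 x : peval iota 1 x = 1.
Proof. exact: rmorph1. Qed.

Lemma peval0 x : peval iota 0 x = 0.
Proof. exact: rmorph0. Qed.

Lemma peval_sum (I : Type) (s : seq I) (P : pred I) (F : I -> {mpoly K[N]}) x :
  peval iota (\sum_(i <- s | P i) F i) x = \sum_(i <- s | P i) peval iota (F i) x.
Proof. exact: rmorph_sum. Qed.

Lemma peval_prod (I : Type) (s : seq I) (P : pred I) (F : I -> {mpoly K[N]}) x :
  peval iota (\prod_(i <- s | P i) F i) x = \prod_(i <- s | P i) peval iota (F i) x.
Proof. exact: rmorph_prod. Qed.

Lemma pevalC a x : peval iota (mpoly_const a) x = iota a.
Proof. exact: mpoly.mmapC. Qed.

Lemma peval_var i x : peval iota (mpoly_var i) x = x 0 i.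
Proof. by rewrite /peval mpoly.mmapX mpoly.mmap1U. Qed.

Lemma poly_ringE : poly_ring iota = range (@peval R K iota N).
Proof. by apply/seteqP; split=> f [Q]; [move=> ->; exists Q|move=> _ <-; exists Q]. Qed.

End PolynomialFunctions.

Section Calculus.
Context {R : realType}.

Lemma cvg_mx_entries (T : topologicalType) m n (f : T -> 'M[R]_(m, n)) (x : T) :
  (forall i j, {for x, continuous (fun y => f y i j)}) -> {for x, continuous f}.
Proof.
move=> fij; apply/cvgrPdist_lt => e e0.
have : \forall y \near x, forall ij : 'I_m * 'I_n, `|f x ij.1 ij.2 - f y ij.1 ij.2| < e.
  by apply: filter_forall => -[i j]; have /cvgrPdist_lt/(_ e e0) := fij i j.
apply: filterS => y xy; rewrite [ltLHS]/Num.Def.normr/= mx_normrE.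
by apply/bigmax_ltP; split=> // ij _; rewrite !mxE.
Qed.

Lemma derive_coord n (x v : 'rV[R]_n) i : 'D_v (fun y : 'rV[R]_n => y 0 i) x = v 0 i.
Proof.
have /matrixP/(_ 0 i) := derive_mx (@derivable_id R 'rV[R]_n x v).
by rewrite derive_id mxE => ->.
Qed.

Lemma jacobian_entry n m (f : 'rV[R]_n -> 'rV[R]_m) x j i : differentiable f x ->
  'J f x j i = 'D_(delta_mx 0 j) (fun y => f y 0 i) x.
Proof.
move=> df; have /matrixP/(_ 0 i) := derive_mx (diff_derivable (v := delta_mx 0 j) df).
by rewrite deriveEjacobian// -rowE !mxE.
Qed.

Lemma differentiable_row n m (f : 'I_m -> 'rV[R]_n -> R) x :
  (forall i, differentiable (f i) x) -> differentiable (fun y => \row_i f i y) x.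
Proof.
move=> df.
rewrite (_ : (fun _ => _) = \sum_(i < m) (fun y => f i y *: delta_mx 0 i)); last first.
  by apply/funext => y; rewrite fct_sumE [LHS]row_sum_delta; apply: eq_bigr => i _; rewrite mxE.
by apply: differentiable_sum => i; apply: differentiableZl.
Qed.

Context {K : fieldType}.
Variable iota : {rmorphism K -> R}.
Context {N : nat}.
Implicit Types (Q : {mpoly K[N]}) (x : 'rV[R]_N).

Lemma differentiable_peval Q x : differentiable (peval iota Q) x.
Proof.
elim: (gen_mpoly Q) => [a|i _|p q _ dp _ dq|p q _ dp _ dq].
- rewrite (_ : peval iota _ = cst (iota a)); first exact: differentiable_cst.
  by apply/funext => y; rewrite pevalC.
- rewrite (_ : peval iota _ = (fun y : 'rV[R]_N => y 0 i)); first exact: differentiable_coord.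
  by apply/funext => y; rewrite peval_var.
- rewrite (_ : peval iota _ = peval iota p + peval iota q); first exact: differentiableD.
  by apply/funext => y; rewrite pevalD.
- rewrite (_ : peval iota _ = peval iota p * peval iota q); first exact: differentiableM.
  by apply/funext => y; rewrite pevalM.
Qed.

Lemma continuous_peval Q : continuous (peval iota Q).
Proof. by move=> x; apply: differentiable_continuous; exact: differentiable_peval. Qed.

Lemma derive_peval j Q x :
  'D_(delta_mx 0 j) (peval iota Q) x = peval iota (mpoly.mderiv j Q) x.
Proof.
elim: (gen_mpoly Q) => [a|i _|p q _ dp _ dq|p q _ dp _ dq].
- rewrite (_ : peval iota _ = cst (iota a)); last by apply/funext => y; rewrite pevalC.
  by rewrite derive_cst mpoly.mderivC /peval rmorph0.
- rewrite (_ : peval iota _ = (fun y : 'rV[R]_N => y 0 i)); last first.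
    by apply/funext => y; rewrite peval_var.
  rewrite derive_coord mxE /= mderiv_var eq_sym.
  by case: eqP => _; rewrite /peval ?rmorph1 ?rmorph0.
- rewrite (_ : peval iota _ = peval iota p + peval iota q); last first.
    by apply/funext => y; rewrite pevalD.
  rewrite deriveD ?dp ?dq; try by apply: diff_derivable; exact: differentiable_peval.
  by rewrite mpoly.mderivD pevalD.
- rewrite (_ : peval iota _ = peval iota p * peval iota q); last first.
    by apply/funext => y; rewrite pevalM.
  rewrite deriveM ?dp ?dq; try by apply: diff_derivable; exact: differentiable_peval.
  by rewrite mpoly.mderivM pevalD !pevalM /GRing.scale/= addrC [X in X + _]mulrC.
Qed.

Lemma jacobian_peval c (F : 'I_c -> {mpoly K[N]}) x :
  'J (fun y => \row_i peval iota (F i) y) x =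
  \matrix_(j, i) peval iota (mpoly.mderiv j (F i)) x.
Proof.
apply/matrixP => j i; rewrite jacobian_entry; last first.
  by apply: differentiable_row => k; exact: differentiable_peval.
rewrite [RHS]mxE -[RHS]derive_peval.
rewrite (_ : (fun y : 'rV[R]_N => _) = peval iota (F i))//.
by apply/funext => y; rewrite mxE.
Qed.

End Calculus.

Section Minors.
Context {F : fieldType}.

Lemma unit_submatrix_exists m n (A : 'M[F]_(m, n)) :
  exists (f : 'I_(\rank A) -> 'I_m) (g : 'I_(\rank A) -> 'I_n), mxsub f g A \in unitmx.
Proof.
have ffree := maxrowsub_free A.
have full : row_full (rowsub (maxrankfun A) A)^T.
  by rewrite /row_full mxrank_tr.
exists (maxrankfun A), (fullrankfun full).
rewrite -unitmx_tr (_ : _^T = rowsub (fullrankfun full) (rowsub (maxrankfun A) A)^T).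
  exact: fullrowsub_unit.
by apply/matrixP => i j; rewrite !mxE.
Qed.

Lemma unit_submatrix_rank m n k (A : 'M[F]_(m, n)) (f : 'I_k -> 'I_m) (g : 'I_k -> 'I_n) :
  mxsub f g A \in unitmx -> (k <= \rank A)%N.
Proof.
move=> /mxrank_unit <-; rewrite (_ : mxsub f g A = rowsub f (rowsub g A^T)^T).
  rewrite (leq_trans (mxrankS (rowsub_sub _ _)))// mxrank_tr.
  by rewrite (leq_trans (mxrankS (rowsub_sub _ _)))// mxrank_tr.
by apply/matrixP => i j; rewrite !mxE.
Qed.

End Minors.

Section Strata.
Context {R : realType} {N : nat}.
Variable A : set ('rV[R]_N.+1 -> R).
Implicit Types V : set 'rV[R]_N.+1.

Lemma Reg_sub V : Reg A V `<=` V.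
Proof.
move=> x [[_ []]//|[_ [Z [[C [_ _ _ ->] CZ] [Zx _] _]]]].
by exists Z.
Qed.

Lemma stratum_sub V k : stratum A V k `<=` V.
Proof.
apply: subset_trans (@Reg_sub _) _; elim: k => //= k IH.
by apply: subset_trans IH => x [].
Qed.

Lemma dim_ge V d k x : (d < N.+2)%N -> stratum A V k x ->
  submanifold_at d (stratum A V k) x -> (d <= Defs.dim A V)%N.
Proof.
move=> dN Vx mx; have Pd : `[< exists k x, stratum A V k x /\
    submanifold_at (Ordinal dN) (stratum A V k) x >] by apply/asboolP; exists k, x.
exact: (@leq_bigmax_cond _ (fun e : 'I_N.+2 => `[< exists k x, stratum A V k x /\
  submanifold_at e (stratum A V k) x >]) (fun e : 'I_N.+2 => e : nat) (Ordinal dN) Pd).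
Qed.

(** The value 0 may come from an empty maximum, hence the positivity assumption. *)
Lemma dim_witness V : (0 < Defs.dim A V)%N ->
  exists k x, stratum A V k x /\ submanifold_at (Defs.dim A V) (stratum A V k) x.
Proof.
rewrite /Defs.dim => d0.
have [i Pi E] : exists2 i : 'I_N.+2, `[< exists k x, stratum A V k x /\ submanifold_at i (stratum A V k) x >]
   & \max_(d < N.+2 | `[< exists k x, stratum A V k x /\ submanifold_at d (stratum A V k) x >]) d = i.
  elim/big_ind: _ d0 => [//|a b IHa IHb|i Pi _]; last by exists i.
  by case: (leqP a b) => _ ab0; [exact: IHb|exact: IHa].
by rewrite E; apply/asboolP.
Qed.

End Strata.

Section VanishingIdealGenerators.
Context {R : realType} {K : fieldType}.
Variable iota : {rmorphism K -> R}.
Context {N : nat}.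
Implicit Types (V W Z : set 'rV[R]_N.+1) (Q : {mpoly K[N.+1]}).
Local Notation ev := (@peval R K iota N.+1).
Local Notation van := (vanishing ev).
Local Notation gen := (gen (@mpoly_const K N.+1) (@mpoly_var K N.+1)).

(** By the basis theorem a generating sequence exists, so [xget] returns one and not merely its
    default. *)
Lemma ideal_gensP V : generates (poly_ring iota) (ideal_gens (poly_ring iota) V)
  (vanishing_ideal (poly_ring iota) V).
Proof.
rewrite /ideal_gens; apply: (@xgetPex _ [::]
  [set fs | generates (poly_ring iota) fs (vanishing_ideal (poly_ring iota) V)]).
have [||||n [u [uV Vu]]] := @mpoly_noetherian K N.+1 (van V) => //.
- exact: vanishing0 (@pevalD _ _ iota _) _.
- by move=> f g Vf Vg x Vx; rewrite pevalD Vf// Vg// addr0.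
- by move=> b f _ Vf x Vx; rewrite pevalM Vf// mulr0.
have pr (i : nat) : poly_ring iota (ev (u i)) by exists (u i).
exists (mkseq (fun i => ev (u i)) n); split.
  by move=> i; rewrite size_mkseq => lin; rewrite nth_mkseq//; split=> //; exact: uV.
move=> f [[Q ->] VQ]; have [a _ QE] := Vu Q VQ.
exists (fun i => ev (a i)); first by move=> i; exists (a i).
apply/funext => x; rewrite QE peval_sum.
rewrite size_mkseq; apply: eq_bigr => i _.
by rewrite nth_mkseq// pevalM.
Qed.

Lemma ideal_gens_poly V : exists G : 'I_(size (ideal_gens (poly_ring iota) V)) -> {mpoly K[N.+1]},
  [/\ forall i, ev (G i) = (ideal_gens (poly_ring iota) V)`_i,
      forall i, van V (G i) &
      forall Q, van V Q -> exists b : 'I_(size (ideal_gens (poly_ring iota) V)) -> {mpoly K[N.+1]},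
        forall x, ev Q x = ev (\sum_i b i * G i) x].
Proof.
have [gV Vg] := ideal_gensP V; set fs := ideal_gens _ V in gV Vg *.
have /choice[G GP] : forall i : 'I_(size fs), exists q, ev q = fs`_i.
  by move=> i; have [[q ->] _] := gV i (ltn_ord i); exists q.
exists G; split=> // [i x Vx|Q VQ].
  by rewrite GP; have [_] := gV i (ltn_ord i); apply.
have [|a Aa E] := Vg (ev Q); first by split=> //; exists Q.
have /choice[b bP] : forall i : 'I_(size fs), exists q, a i = ev q.
  by move=> i; have [q ->] := Aa i; exists q.
exists b => x; rewrite E peval_sum; apply: eq_bigr => i _.
by rewrite bP -GP pevalM.
Qed.

End VanishingIdealGenerators.

Section LocalEquations.
Context {R : realType} {K : fieldType}.
Variable iota : {rmorphism K -> R}.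
Context {N : nat}.
Implicit Types (V W Z : set 'rV[R]_N.+1) (Q : {mpoly K[N.+1]}).
Local Notation ev := (@peval R K iota N.+1).
Local Notation van := (vanishing ev).
Local Notation gen := (gen (@mpoly_const K N.+1) (@mpoly_var K N.+1)).
Local Notation pr := (poly_ring iota).

Definition jacobian_mpoly c (F : 'I_c -> {mpoly K[N.+1]}) x : 'M[R]_(N.+1, c) :=
  \matrix_(j, i) ev (mpoly.mderiv j (F i)) x.

Lemma rank_atE V (G : 'I_(size (ideal_gens pr V)) -> {mpoly K[N.+1]}) x :
  (forall i, ev (G i) = (ideal_gens pr V)`_i) ->
  rank_at pr V x = \rank (jacobian_mpoly G x).
Proof.
move=> GP; rewrite /rank_at /jacobian_mpoly -jacobian_peval; congr (\rank ('J _ _)).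
by apply/funext => y; apply/rowP => i; rewrite !mxE GP.
Qed.

Lemma mderiv_combination V c (G : 'I_c -> {mpoly K[N.+1]}) Q b x j :
  (forall y, ev Q y = ev (\sum_i b i * G i) y) -> (forall i, van V (G i)) -> V x ->
  ev (mpoly.mderiv j Q) x = \sum_i ev (b i) x * ev (mpoly.mderiv j (G i)) x.
Proof.
move=> QE GV Vx; rewrite -derive_peval (_ : ev Q = ev (\sum_i b i * G i)); last exact/funext.
rewrite derive_peval raddf_sum peval_sum; apply: eq_bigr => i _ /=.
rewrite mpoly.mderivM pevalD !pevalM.
by rewrite (GV i x Vx) mulr0 add0r.
Qed.

Lemma peval_det n (M : 'M[{mpoly K[N.+1]}]_n) x :
  ev (\det M) x = \det (map_mx (fun Q => ev Q x) M).
Proof. by rewrite /peval -det_map_mx. Qed.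

Lemma vanishing_natM W n (a : {mpoly K[N.+1]}) : van W (n.+1%:R * a) -> van W a.
Proof.
move=> Wa x Wx; have /eqP := Wa x Wx; rewrite pevalM mulf_eq0 => /orP[|/eqP//].
by rewrite /peval rmorph_nat pnatr_eq0.
Qed.

Lemma span_vanish c (F : nat -> {mpoly K[N.+1]}) h x : span (fun=> True) F c h ->
  (forall i, (i < c)%N -> ev (F i) x = 0) -> ev h x = 0.
Proof.
move=> [a _ ->] F0; rewrite peval_sum big1 //= => i _.
by rewrite pevalM F0 ?mulr0.
Qed.

(** The Jacobian criterion. The polynomial s collects the denominators t i, by which the F i
    generate the ideal of W, and the diagonal delta of the triangular Jacobian. Off the zeros of s
    the F i cut out W with independent differentials, and on W the generators G have the same rank c
    as the F i, since each family is a combination of the other. *)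
Lemma irreducible_local_equations W T : irreducible (zero_set pr) W ->
  max_independent (@mpoly_const K N.+1) (@mpoly_var K N.+1) (van W) T ->
  exists (c : nat) (F : nat -> {mpoly K[N.+1]}) (s : {mpoly K[N.+1]}),
    [/\ (c + #|T|)%N = N.+1, ~ van W s,
        forall x, ev s x != 0 -> (W x <-> forall i, (i < c)%N -> ev (F i) x = 0),
        forall x, ev s x != 0 -> \rank (jacobian_mpoly (fun i : 'I_c => F i) x) = c &
        forall x, W x -> ev s x != 0 -> reg_irr pr W x].
Proof.
move=> irrW; rewrite poly_ringE in irrW.
move=> maxT; have [indT Tmax] := maxT.
have ev1 := @peval1 _ _ iota N.+1; have evD := @pevalD _ _ iota N.+1.
have evM := @pevalM _ _ iota N.+1.
have pp := vanishing_prime ev1 evD evM irrW.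
have p0 : van W 0 by exact: vanishing0.
have [cW W0 _] := irrW.
have [G [GE GW Wspan]] := ideal_gens_poly iota W.
set k := size _ in G GE GW Wspan.
pose ys := enum (~: T)%SET.
have [||||||||F [FP Fspan]] := @triangular_system _ _ _ _ _ (@mpoly.mderiv N.+1 K) _ _ _ _ (van W) T ys pp _ indT.
- by move=> i a; exact: mpoly.mderivC.
- by move=> i j; exact: mderiv_var.
- by move=> i f g; exact: mpoly.mderivD.
- by move=> i f g; exact: mpoly.mderivM.
- by move=> n a; exact: vanishing_natM.
- by move=> y; rewrite mem_enum finset.in_setC; exact: max_independent_relation.
- exact: enum_uniq.
- by move=> y; rewrite mem_enum finset.in_setC.
set c := size ys in FP Fspan.
have cT : (c + #|T|)%N = N.+1 by rewrite /c -cardE addnC cardsC card_ord.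
have FW i : (i < c)%N -> van W (F i) by move=> ic; have [] := FP ord0 i ic.
have /choice[t tP] : forall i : 'I_k, exists t, ~ van W t /\ span (fun=> True) F c (t * G i).
  move=> i; have [|t Wt St] := Fspan (G i) _ (GW i); last by exists t.
  apply: gen_mono (gen_mpoly _); apply/fintype.subsetP => y _.
  by rewrite finset.in_setU finset.in_set mem_enum finset.in_setC orbN.
pose delta := \prod_(i < c) mpoly.mderiv (nth ord0 ys i) (F i).
pose s := (\prod_(i < k) t i) * delta.
have Ws : ~ van W s.
  apply: prime_idealNM => //; apply: prime_idealN_prod => // i _.
    by have [] := tP i.
  by have [] := FP ord0 i (ltn_ord i).
have st x i : ev s x != 0 -> ev (t i) x != 0.
  rewrite /s pevalM mulf_eq0 negb_or => /andP[+ _]; rewrite peval_prod => /prodf_neq0.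
  exact.
have sdelta x : ev s x != 0 -> ev delta x != 0.
  by rewrite /s pevalM mulf_eq0 negb_or => /andP[].
have rankF x : ev s x != 0 -> \rank (jacobian_mpoly (fun i : 'I_c => F i) x) = c.
  move=> /sdelta dx; apply/eqP; rewrite eqn_leq rank_leq_col /=.
  apply: (@unit_submatrix_rank _ _ _ _ _ (fun i : 'I_c => nth ord0 ys i) id).
  rewrite -unitmx_tr unitmxE unitfE det_trig.
    move: dx; rewrite /delta peval_prod; congr (is_true (_ != 0)).
    by apply: eq_bigr => i _; rewrite !mxE.
  apply/is_trig_mxP => i j ij; rewrite !mxE.
  have [_ _ _ D0] := FP ord0 i (ltn_ord i).
  by rewrite D0 ?peval0// ij ltn_ord.
have rankG y : W y -> ev s y != 0 -> \rank (jacobian_mpoly G y) = c.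
  move=> Wy sy; apply/eqP; rewrite eqn_leq -{2}(rankF y sy); apply/andP; split.
    have /choice[a aP] : forall i : 'I_k, exists a : nat -> {mpoly K[N.+1]},
        t i * G i = \sum_(l < c) a l * F l.
      by move=> i; have [_ [a _ ->]] := tP i; exists a.
    have -> : jacobian_mpoly G y = jacobian_mpoly (fun i : 'I_c => F i) y *m
        \matrix_(l, i) (ev (a i l) y / ev (t i) y).
      apply/matrixP => j i; rewrite !mxE; apply: (mulfI (st y i sy)).
      have := @mderiv_combination W c (fun i : 'I_c => F i) (t i * G i) (fun l : 'I_c => a i l) y j.
      rewrite mpoly.mderivM pevalD !pevalM (GW i y Wy) mulr0 add0r => ->//.
      - rewrite mulr_sumr; apply: eq_bigr => l _; rewrite !mxE mulrCA.
        by rewrite [ev (t i) y * _]mulrC divfK ?st// mulrC.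
      - by move=> z; rewrite aP.
      - by move=> l; exact: FW.
    by rewrite (leq_trans (mxrankM_maxl _ _))// rank_leq_col.
  have /choice[b bP] : forall l : 'I_c, exists b : 'I_k -> {mpoly K[N.+1]},
      forall x, ev (F l) x = ev (\sum_i b i * G i) x.
    by move=> l; apply: Wspan; apply: FW.
  have -> : jacobian_mpoly (fun i : 'I_c => F i) y = jacobian_mpoly G y *m
      \matrix_(i, l) ev (b l i) y.
    apply/matrixP => j l; rewrite !mxE (mderiv_combination _ (bP l) GW Wy).
    by apply: eq_bigr => i _; rewrite !mxE mulrC.
  exact: mxrankM_maxl.
(* A minor of G that is nonzero at z lies outside the prime ideal of W, and so does s; both are
   nonzero at a common point y of W, where the rank is c. Hence c is the maximal rank on W and
   points with s nonzero are regular. *)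
have rank_le z : W z -> (\rank (jacobian_mpoly G z) <= c)%N.
  move=> Wz; have [f [g fgz]] := unit_submatrix_exists (jacobian_mpoly G z).
  pose mu := \det (\matrix_(a, b) mpoly.mderiv (f a) (G (g b))).
  have muE x : ev mu x = \det (mxsub f g (jacobian_mpoly G x)).
    by rewrite peval_det; congr (\det _); apply/matrixP => a b; rewrite !mxE.
  have Wmu : ~ van W mu.
    by move=> /(_ z Wz) /eqP; apply/negP; rewrite muE -unitfE -unitmxE.
  have [y Wy] := vanishing_witness (prime_idealNM pp Wmu Ws).
  rewrite pevalM mulf_eq0 negb_or => /andP[muy sy].
  rewrite -(rankG y Wy sy); apply: (@unit_submatrix_rank _ _ _ _ _ f g).
  by rewrite unitmxE unitfE -muE.
have rank_idealE x : W x -> ev s x != 0 -> rank_ideal pr W = c.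
  move=> Wx sx; rewrite /rank_ideal; apply/eqP; rewrite eqn_leq; apply/andP; split.
    by apply/bigmax_leqP => r /asboolP[z Wz <-]; rewrite (rank_atE z GE) rank_le.
  have cN : (c < N.+2)%N by rewrite -cT ltnS leq_addr.
  have Pc : `[< exists2 z, W z & rank_at pr W z = Ordinal cN >].
    by apply/asboolP; exists x => //; rewrite (rank_atE x GE) rankG.
  exact: (@leq_bigmax_cond _ (fun r : 'I_N.+2 => `[< exists2 z, W z & rank_at pr W z = r >])
    (fun r : 'I_N.+2 => r : nat) (Ordinal cN) Pc).
exists c, F, s; split=> //.
  move=> x sx; split; first by move=> Wx i ic; exact: FW.
  move=> F0; apply: contrapT => nWx.
  have [Q WQ] := zero_set_separate cW nWx; have [b ->] := Wspan Q WQ.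
  rewrite peval_sum big1 ?eqxx// => i _; rewrite pevalM.
  have := span_vanish (tP i).2 F0; rewrite pevalM => /eqP.
  by rewrite mulf_eq0 (negbTE (st x i sx)) /= => /eqP ->; rewrite mulr0.
by move=> x Wx sx; split=> //; rewrite (rank_atE x GE) (rank_idealE x)// rankG.
Qed.

End LocalEquations.

Section AlgebraicDimension.
Context {R : realType} {K : fieldType}.
Variable iota : {rmorphism K -> R}.
Context {N : nat}.
Implicit Types (V W Z : set 'rV[R]_N.+1) (Q : {mpoly K[N.+1]}).
Local Notation ev := (@peval R K iota N.+1).
Local Notation van := (vanishing ev).
Local Notation pr := (poly_ring iota).

(** e is a product of polynomials, each vanishing on one other component but not on Wi; primality
    keeps the product from vanishing on Wi. *)
Lemma avoid_other_components (C : set (set 'rV[R]_N.+1)) W Wi :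
  irr_decomposition (zero_set pr) W C -> C Wi ->
  exists2 e, ~ van Wi e & forall x, ev e x != 0 -> forall Z, C Z -> Z x -> Z = Wi.
Proof.
rewrite poly_ringE => -[/finite_seqP[s ->{C}] irrC anti _] sWi.
have ev1 := @peval1 _ _ iota N.+1; have evD := @pevalD _ _ iota N.+1.
have evM := @pevalM _ _ iota N.+1.
have pp := vanishing_prime ev1 evD evM (irrC Wi sWi).
have /choice[e eP] : forall Z, exists e, Z \in s -> Z <> Wi -> van Z e /\ ~ van Wi e.
  move=> Z; have [[sZ neq]|nZ] := pselect (Z \in s /\ Z <> Wi); last first.
    by exists 0 => sZ neq; exfalso; apply: nZ.
  have [x Wx nZx] : exists2 x, Wi x & ~ Z x.
    apply: contrapT => nex; apply: neq; apply/esym/anti => // x Wx.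
    by apply: contrapT => nZx; apply: nex; exists x.
  have [cZ _ _] := irrC Z sZ.
  have [q Zq qx] := zero_set_separate cZ nZx.
  by exists q => _ _; split=> // /(_ x Wx) /eqP; exact/negP.
exists (\prod_(Z <- s | (Z \in s) && (Z != Wi)) e Z).
  by apply: prime_idealN_prod => // Z /andP[sZ /eqP neq]; have [] := eP Z sZ neq.
move=> x ex Z /= sZ Zx; apply/eqP; apply: contraNT ex => neq.
rewrite (big_rem Z) //= sZ neq pevalM.
by have [/(_ x Zx) -> _] := eP Z sZ (elimN eqP neq); rewrite mul0r.
Qed.

Lemma continuous_jacobian_mpoly c (F : 'I_c -> {mpoly K[N.+1]}) x :
  {for x, continuous (fun z => 'J (fun y => \row_i ev (F i) y) z)}.
Proof.
apply: cvg_mx_entries => j i.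
rewrite (_ : (fun _ => _) = ev (mpoly.mderiv j (F i))); first exact: continuous_peval.
by apply/funext => y; rewrite jacobian_peval mxE.
Qed.

(** On the open set U where s and e are nonzero, the first stratum [Reg W] coincides with Wi and is
    cut out by c = N + 1 - |T| independent equations. Primality of the ideal of Wi gives a point of
    Wi in U. *)
Theorem alg_dim_ge W Wi T : irr_component (algebraic_set iota) W Wi ->
  max_independent (@mpoly_const K N.+1) (@mpoly_var K N.+1) (van Wi) T ->
  (#|T| <= alg_dim iota W)%N.
Proof.
move=> [C dC CWi] maxT; have [fC irrC anti WC] := dC.
have [c [F [s [cT Ws sF sJ sreg]]]] := irreducible_local_equations (irrC Wi CWi) maxT.
have [e We eC] := avoid_other_components dC CWi.
have ev1 := @peval1 _ _ iota N.+1; have evD := @pevalD _ _ iota N.+1.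
have evM := @pevalM _ _ iota N.+1.
have cI := @zero_setI _ _ _ ev.
have cU := zero_setU evM.
have c0 := zero_set0 ev1.
rewrite -poly_ringE in cI cU c0.
have irrWi : irreducible (zero_set pr) Wi := irrC Wi CWi; rewrite poly_ringE in irrWi.
have pp := vanishing_prime ev1 evD evM irrWi.
have [x Wx] := vanishing_witness (prime_idealNM pp Ws We).
rewrite evM mulf_eq0 negb_or => /andP[sx ex].
pose U := [set y | ev s y != 0] `&` [set y | ev e y != 0].
have openn (Q : {mpoly K[N.+1]}) : open [set y | ev Q y != 0].
  rewrite (_ : [set y | _] = ev Q @^-1` [set z | z != 0]) //.
  by apply: open_comp; [move=> y _; exact: continuous_peval|exact: open_neq].
have regU y : U y -> (Reg pr W y <-> Wi y).
  move=> [/= sy ey]; split.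
    move=> /Reg_sub; rewrite WC => -[Z CZ Zy].
    by rewrite -(eC y ey Z CZ Zy).
  move=> Wiy; have ry := sreg y Wiy sy.
  (* [Reg] treats irreducible sets apart; in that case Wi = W because the decomposition is
     unique. *)
  have [irrW|nirrW] := pselect (irreducible (zero_set pr) W).
    left; split=> //; suff <- : Wi = W by [].
    have := irr_decomposition_unique cI cU c0 (irr_decomposition1 irrW) dC.
    by move=> E; move: CWi; rewrite -E.
  right; split=> //; exists Wi; split=> //; first by exists C.
  move=> Z [C' dC' C'Z] Zy; apply: eC ey _ _ Zy.
  by rewrite (irr_decomposition_unique cI cU c0 dC dC').
have Ux : U x by [].
apply: (@dim_ge _ _ _ W _ 0 x) => /=.
- by rewrite ltnS (leq_trans (max_card _))// card_ord.
- by apply/(regU x Ux).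
exists c, U, (fun y => \row_(i < c) ev (F i) y); split; split=> //.
- by apply: openI; exact: openn.
- by apply/(regU x Ux).
- by move=> y _; apply: differentiable_row => i; exact: differentiable_peval.
- by move=> y _; exact: continuous_jacobian_mpoly.
- by rewrite jacobian_peval; exact: sJ.
move=> y Uy; rewrite /stratum /=; split.
  move=> /(regU y Uy) Wy; apply/rowP => i; rewrite !mxE.
  by apply: (sF y Uy.1).1 Wy _ (ltn_ord i).
move=> g0; apply/(regU y Uy)/(sF y Uy.1) => i ic.
by have /rowP/(_ (Ordinal ic)) := g0; rewrite !mxE.
Qed.

End AlgebraicDimension.

(** * Generic points *)

Section ReductionByDerivation.
Context {R : realType} {K : fieldType}.
Variable iota : {rmorphism K -> R}.
Context {N : nat}.
Implicit Types (Q : {mpoly K[N]}) (S : {set 'I_N}).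
Local Notation gen := (gen (@mpoly_const K N) (@mpoly_var K N)).

Lemma field_natr_neq0 n : n.+1%:R != 0 :> K.
Proof. by rewrite -(fmorph_eq0 iota) rmorph_nat pnatr_eq0. Qed.

Lemma msupp_mderiv j Q (m : mpoly.multinom N) : m \in mpoly.msupp Q -> m j != 0%N ->
  mpoly.mnm_sub m (mpoly.mnm1 j) \in mpoly.msupp (mpoly.mderiv j Q).
Proof.
move=> mQ mj; rewrite mpoly.mcoeff_msupp mpoly.mcoeff_deriv.
rewrite mpoly.submK; last by apply/mpoly.mnm_lepP => i; rewrite mpoly.mnm1E; case: eqP => [<-|//]; rewrite lt0n.
rewrite -mulr_natr mulf_neq0 ?field_natr_neq0//.
by rewrite -mpoly.mcoeff_msupp.
Qed.

Lemma gen_mderiv0 S Q : (forall j, j \notin S -> mpoly.mderiv j Q = 0) -> gen S Q.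
Proof.
move=> dQ; rewrite (mpoly.mpolyE Q) big_seq.
have sg := subring_gen (@mpoly_const K N) (@mpoly_var K N) S.
apply: (subring_sum sg) => m mQ.
rewrite -mpoly.mul_mpolyC; apply: gen_mul; first exact: gen_const.
rewrite mpoly.mpolyXE_id; apply: (big_ind (gen S)); first by have [] := sg.
  by move=> *; exact: gen_mul.
move=> i _; have [iS|iS] := boolP (i \in S).
  by apply: (subringX sg); exact: gen_var.
have [->|mi] := eqVneq (m i) 0%N; first by rewrite expr0; have [] := sg.
by have := msupp_mderiv mQ mi; rewrite dQ// mpoly.msupp0.
Qed.

(** Differentiation lowers the degree, and in characteristic 0 a polynomial killed by all
    derivatives outside S involves only the variables of S. P will be vanishing along a parametrized
    family. *)
Lemma reduce_by_derivation (P : {mpoly K[N]} -> Prop) S Q :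
  (forall j q, j \notin S -> P q -> P (mpoly.mderiv j q)) -> P Q -> Q != 0 ->
  exists q, [/\ P q, q != 0 & gen S q].
Proof.
move=> PD PQ Q0.
have [k] := ubnP (mpoly.msize Q); elim: k Q PQ Q0 => // k IH Q PQ Q0 Qk.
have [[j jS dj]|nd] := pselect (exists2 j, j \notin S & mpoly.mderiv j Q != 0); last first.
  exists Q; split=> //; apply: gen_mderiv0 => j jS; apply/eqP/negPn/negP => dj.
  by apply: nd; exists j.
apply: (IH (mpoly.mderiv j Q)) => //; first exact: PD.
have Q1 : (0 < mpoly.msize Q)%N by rewrite lt0n mpoly.msize_poly_eq0.
suff : (mpoly.msize (mpoly.mderiv j Q) <= (mpoly.msize Q).-1)%N by move: Q1 Qk; lia.
rewrite mpoly.msizeE; apply/bigmax_leqP_seq => m md _.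
have : mpoly.mnm_add m (mpoly.mnm1 j) \in mpoly.msupp Q.
  rewrite mpoly.mcoeff_msupp; apply/eqP => Qm; move: md.
  by rewrite mpoly.mcoeff_msupp mpoly.mcoeff_deriv Qm mul0rn eqxx.
by move=> /mpoly.msize_mdeg_lt; rewrite mpoly.mdegD mpoly.mdeg1; lia.
Qed.

End ReductionByDerivation.

Section ExponentialPolynomials.
Context {R : realType}.
Implicit Types (p : {poly R}) (a b : R).

Lemma poly_eq0_interval p a b : a < b -> (forall x, a < x < b -> p.[x] = 0) -> p = 0.
Proof.
move=> ab p0; apply: contrapT => /eqP pn0.
pose rs := mkseq (fun k => a + (b - a) / k.+2%:R) (size p).
have urs : uniq rs.
  rewrite map_inj_uniq ?iota_uniq// => i j /addrI /(mulfI (lt0r_neq0 _)).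
  by rewrite subr_gt0 => /(_ ab) /invr_inj /eqP; rewrite eqr_nat => /eqP[].
have rrs : all (root p) rs.
  apply/allP => x /mapP[k _ ->]; apply/rootP/p0.
  have k2 : 1 < k.+2%:R :> R by rewrite ltr1n.
  have k0 : 0 < k.+2%:R :> R by rewrite ltr0n.
  have ba : 0 < b - a by rewrite subr_gt0.
  rewrite ltrDl divr_gt0//= -ltrBrDl ltr_pdivrMr// ltr_pMr//.
have := max_poly_roots pn0 rrs urs.
by rewrite size_mkseq ltnn.
Qed.

Lemma shifted_deriv_eq0 p d : d != 0 -> p^`() + d *: p = 0 -> p = 0.
Proof.
move=> d0 /eqP; rewrite addrC addr_eq0 => /eqP E; apply: contrapT => /eqP p0.
have := lt_size_deriv p0; rewrite -(size_polyN p^`()) -E.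
by rewrite size_scale// ltnn.
Qed.

Lemma derive_eq0_interval (f df : R -> R) a b : (forall x : R, is_derive x 1 f (df x)) ->
  (forall x, a < x < b -> f x = 0) -> forall x, a < x < b -> df x = 0.
Proof.
move=> fdf f0 x xab; have := @derive_val _ _ _ _ _ _ _ (fdf x) => <-.
rewrite (@near_eq_derive _ _ _ f (cst 0)); first by rewrite derive_cst.
near=> y; apply: f0; near: y; apply: near_in_itvoo.
by rewrite in_itv.
Unshelve. all: by end_near. Qed.

(** Exponentials are linearly independent over polynomials, even on an interval. Replacing a
    function g by g' - l g shortens A l and turns A j into A j' + (j - l) A j, which vanishes for j
    < l only if A j does. *)
Lemma exp_poly_eq0 l (A : nat -> {poly R}) a b : a < b ->
  (forall x, a < x < b -> exp_poly l A x = 0) -> forall j, (j < l)%N -> A j = 0.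
Proof.
move=> ab; elim: l A => [//|l IHl] A.
have [n] := ubnP (size (A l)); elim: n A => // n IHn A sA fA.
have fE (x : R) : exp_poly l.+1 A x = exp_poly l A x + (A l).[x] * expR (l%:R * x).
  by rewrite /exp_poly big_ord_recr.
have [Al0|Aln0] := eqVneq (A l) 0.
  move=> j; rewrite ltnS leq_eqVlt => /orP[/eqP ->//|]; apply: IHl => x xab.
  by have := fA x xab; rewrite fE Al0 horner0 mul0r addr0.
pose A1 j := (A j)^`() + j%:R *: A j - l%:R *: A j.
have A1l : A1 l = (A l)^`() by rewrite /A1 addrK.
have dA (x : R) : a < x < b -> exp_poly l.+1 A1 x = 0.
  move=> xab; have := derive_eq0_interval (is_derive_exp_poly l.+1 A) fA xab.
  have := fA x xab; rewrite /exp_poly => E E'.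
  transitivity (\sum_(j < l.+1) ((A j)^`() + j%:R *: A j).[x] * expR (j%:R * x)
    - l%:R * \sum_(j < l.+1) (A j).[x] * expR (j%:R * x)).
    rewrite mulr_sumr -sumrB; apply: eq_bigr => j _.
    by rewrite /A1 hornerD hornerN [(l%:R *: _).[x]]hornerZ mulrBl mulrA.
  by rewrite E E' mulr0 subr0.
have A1_0 j : (j < l.+1)%N -> A1 j = 0.
  apply: IHn => //; rewrite A1l.
  by rewrite -ltnS; apply: leq_trans sA; rewrite ltnS lt_size_deriv.
have A0 j : (j < l)%N -> A j = 0.
  move=> jl; apply: (@shifted_deriv_eq0 _ (j%:R - l%:R)).
    by rewrite subr_eq0 eqr_nat ltn_eqF.
  by rewrite scalerBl addrA; apply: A1_0; rewrite ltnS ltnW.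
move=> j; rewrite ltnS leq_eqVlt => /orP[/eqP ->|/A0//].
apply: (poly_eq0_interval ab) => x xab.
have := fA x xab; rewrite fE /exp_poly big1 ?add0r => [/eqP|i _].
  by rewrite mulf_eq0 (gt_eqF (expR_gt0 _)) orbF => /eqP.
by rewrite A0// horner0 mul0r.
Qed.

End ExponentialPolynomials.

Section Genericity.
Context {R : realType} {K : fieldType}.
Variable iota : {rmorphism K -> R}.

Lemma gen_set1 N (v : 'I_N) f : gen (@mpoly_const K N) (@mpoly_var K N) [set v]%SET f ->
  exists s : {poly K}, f = (map_poly mpoly_const s).[mpoly_var v].
Proof.
rewrite -[[set v]%SET]finset.setU0 => /genU1P[q q0 ->].
have /choice[a aE] : forall i, exists a, q`_i = mpoly_const a.
  by move=> i; apply: gen_set0 (q0 i).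
exists (\poly_(i < size q) a i); congr (_.[_]); apply/polyP => i.
rewrite coef_map coef_poly; case: ltnP => [_|h]; first by rewrite aE.
by rewrite nth_default// rmorph0.
Qed.

Lemma peval_horner_map N (s : {poly K}) v (w : 'rV[R]_N) :
  peval iota (map_poly mpoly_const s).[mpoly_var v] w = (map_poly iota s).[w 0 v].
Proof.
rewrite -(peval_var iota) /peval -horner_map -map_poly_comp; congr (_.[_]).
by apply: eq_map_poly => a; rewrite /= mpoly.mmapC.
Qed.

Definition transcendental (t : R) := forall s : {poly K}, (map_poly iota s).[t] = 0 -> s = 0.

End Genericity.

Section Countability.
Context {R : realType} {K : fieldType}.
Variable iota : {rmorphism K -> R}.
Hypothesis K_algebraic : forall a : K, algebraicOver (ratr : rat -> R) (iota a).

Lemma finite_roots (p : {poly R}) : p != 0 -> finite_set [set x | root p x].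
Proof.
move=> p0; apply: contrapT => /(infinite_set_fset (size p))[B Broot].
have := @max_poly_roots _ p (finmap.enum_fset B) p0 _ (finmap.fset_uniq B).
rewrite ltnNge => /[swap] -> /implyP; rewrite implybF => /negP; apply.
by apply/allP => x xB; exact: Broot.
Qed.

Lemma algebraic_field_countable : countable [set: K].
Proof.
have -> : [set: K] = \bigcup_(p in [set p : {poly rat} | p != 0])
    [set a | root (map_poly (ratr : rat -> R) p) (iota a)].
  apply/seteqP; split=> // a _; have [p p0 pa] := K_algebraic a.
  by exists p.
apply: bigcup_countable => [|p /= p0]; [exact: countableP|apply: finite_set_countable].
apply: (finite_preimage (f := iota) (B := [set x | root (map_poly ratr p) x])).
  by move=> a b _ _; exact: fmorph_inj.
by apply: finite_roots; rewrite map_poly_eq0.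
Qed.

Lemma field_enumeration : exists e : nat -> K, forall a, exists n, e n = a.
Proof.
have := algebraic_field_countable; rewrite /countable => /pfcard_geP[|[f]].
  by move=> /seteqP[/(_ 0 I)].
exists f => a; have [n _ <-] := @surj _ _ _ _ f a I.
by exists n.
Qed.

Lemma mpoly_enumeration N : exists e : nat -> {mpoly K[N]}, forall Q, exists n, e n = Q.
Proof.
have [e eP] := field_enumeration; have /choice[g gP] := eP.
pose h (s : seq (nat * mpoly.multinom N)) : {mpoly K[N]} :=
  \sum_(im <- s) e im.1 *: mpoly.mpolyX K im.2.
exists (fun n => if unpickle n is Some s then h s else 0) => Q.
exists (pickle [seq (g (mpoly.mcoeff m Q), m) | m <- mpoly.msupp Q]).
rewrite pickleK /h big_map [RHS]mpoly.mpolyE; apply: eq_bigr => m _.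
by rewrite /= gP.
Qed.

(** There are countably many polynomials, and each nonzero one is nonzero on a dense open set of
    parameters. The family F is abstract because parameters enter in two ways, by [exp_lift] and by
    [set_coord]. *)
Lemma baire_generic N (X : completeNormedModType R) (F : {mpoly K[N]} -> X -> R) (O : set X) :
  (forall Q, continuous (F Q)) ->
  (forall Q (O : set X), Q != 0 -> open O -> O !=set0 -> exists2 t, O t & F Q t != 0) ->
  open O -> O !=set0 -> exists2 t, O t & forall Q, Q != 0 -> F Q t != 0.
Proof.
move=> cF dF oO O0; have [e eP] := mpoly_enumeration N.
pose G i := if e i == 0 then setT else [set t | F (e i) t != 0].
have [|t [Ot Gt]] := @Baire R X G _ O O0 oO.
  move=> i; rewrite /G; case: eqVneq => [_|ei0].
    by split; [exact: openT|move=> O1 [x O1x] _; exists x].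
  split; last by move=> O1 O10 oO1; have [x O1x Fx] := dF _ _ ei0 oO1 O10; exists x.
  rewrite (_ : [set t | _] = F (e i) @^-1` [set z | z != 0]) //.
  by apply: open_comp; [move=> y _; exact: cF|exact: open_neq].
exists t => // Q Q0; have [i Ei] := eP Q.
by have := Gt i I; rewrite /G Ei (negbTE Q0).
Qed.

End Countability.

Section GenericPoints.
Context {R : realType} {K : fieldType}.
Variable iota : {rmorphism K -> R}.

Lemma eq_derive (V W : normedModType R) (f : V -> R) (g : W -> R) v w a b :
  (forall h, f (h *: v + a) = g (h *: w + b)) -> 'D_v f a = 'D_w g b.
Proof.
move=> fg; have fg0 : f a = g b by have := fg 0; rewrite !scale0r !add0r.
rewrite /derive; set d := (fun _ : R => _); set d' := (fun _ : R => _).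
by suff -> : d = d' by []; rewrite funeqE => h; rewrite /d /d' /= fg fg0.
Qed.

Lemma gen_agree N (S : {set 'I_N}) Q (w w' : 'rV[R]_N) :
  gen (@mpoly_const K N) (@mpoly_var K N) S Q -> (forall i, i \in S -> w 0 i = w' 0 i) ->
  peval iota Q w = peval iota Q w'.
Proof.
move=> SQ ww'; elim: SQ => [a|i iS|p q _ IHp _ IHq|p q _ IHp _ IHq].
- by rewrite !pevalC.
- by rewrite !peval_var ww'.
- by rewrite !pevalD IHp IHq.
- by rewrite !pevalM IHp IHq.
Qed.

Definition set_coord N (v : 'I_N) (c : R) (w : 'rV[R]_N) : 'rV[R]_N :=
  \row_i (if i == v then c else w 0 i).

Lemma set_coordD N (v : 'I_N) c (w : 'rV[R]_N) h j : j != v ->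
  set_coord v c (h *: delta_mx 0 j + w) = h *: delta_mx 0 j + set_coord v c w.
Proof.
move=> jv; apply/rowP => i; rewrite !mxE /=; case: eqVneq => [->|//].
by rewrite eq_sym (negbTE jv) mulr0 add0r.
Qed.

Lemma continuous_set_coord N (v : 'I_N) c : continuous (set_coord v c).
Proof.
move=> w; apply: cvg_mx_entries => i j.
rewrite (_ : (fun _ => _) = (fun y : 'rV[R]_N => if j == v then c else y 0 j)); last first.
  by apply/funext => y; rewrite mxE.
by case: eqVneq => _; [apply: cst_continuous|apply: coord_continuous].
Qed.

(** Vanishing on an open set is inherited by derivatives in the free variables, so a nonzero
    polynomial in the variable v alone would vanish at the transcendental number c. *)
Lemma nonvanishing_transcendental N (Q : {mpoly K[N]}) v c (O : set 'rV[R]_N) :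
  transcendental iota c -> Q != 0 -> open O -> O !=set0 ->
  exists2 w, O w & peval iota Q (set_coord v c w) != 0.
Proof.
move=> tc Q0 oO [w0 Ow0]; apply: contrapT => nex.
pose P (q : {mpoly K[N]}) := forall w, O w -> peval iota q (set_coord v c w) = 0.
have PQ : P Q.
  by move=> w Ow; apply/eqP/negPn/negP => Qw; apply: nex; exists w.
have [|q [Pq q0 gq]] := reduce_by_derivation iota (S := [set v]%SET) _ PQ Q0.
  move=> j q; rewrite finset.in_set1 => jv Pq w Ow; rewrite -derive_peval.
  transitivity ('D_(delta_mx 0 j) (fun w => peval iota q (set_coord v c w)) w).
    by apply: eq_derive => h; rewrite set_coordD.
  rewrite (@near_eq_derive _ _ _ _ (cst 0)); first by rewrite derive_cst.
  by apply: filterS (open_nbhs_nbhs (conj oO Ow)) => y; exact: Pq.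
have [s qE] := gen_set1 gq.
have := Pq w0 Ow0; rewrite qE peval_horner_map mxE eqxx => /tc s0.
by move/eqP: q0; apply; rewrite qE s0 map_poly0 horner0.
Qed.

Context {n : nat}.
Implicit Types t : 'rV[R]_n.+1.

Lemma exp_lift_lift t j : exp_lift t 0 (lift ord_max j) = t 0 j.
Proof. by rewrite mxE liftK. Qed.

Lemma exp_lift_max t : exp_lift t 0 ord_max = expR (t 0 ord0).
Proof. by rewrite mxE unlift_none. Qed.

Lemma lift_max0 : lift ord_max ord0 = ord0 :> 'I_n.+2.
Proof. by apply/val_inj. Qed.

Lemma exp_lift0 t : exp_lift t 0 ord0 = t 0 ord0.
Proof. by rewrite -lift_max0 exp_lift_lift. Qed.

Lemma continuous_exp_lift : continuous (@exp_lift R n).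
Proof.
move=> t; apply: cvg_mx_entries => i j; rewrite ord1.
case: (unliftP ord_max j) => [k ->|->].
  rewrite (_ : (fun _ => _) = (fun y : 'rV[R]_n.+1 => y 0 k)); first exact: coord_continuous.
  by apply/funext => y; rewrite exp_lift_lift.
rewrite (_ : (fun _ => _) = (fun y : 'rV[R]_n.+1 => expR (y 0 ord0))); last first.
  by apply/funext => y; rewrite exp_lift_max.
apply: (@continuous_comp _ _ _ (fun t : 'rV[R]_n.+1 => t 0 ord0) expR).
  exact: coord_continuous.
exact: continuous_expR.
Qed.

Lemma exp_liftD t h j : j != ord0 ->
  exp_lift (h *: delta_mx 0 j + t) = h *: delta_mx 0 (lift ord_max j) + exp_lift t.
Proof.
move=> j0; apply/rowP => i; rewrite [RHS]mxE.
case: (unliftP ord_max i) => [k ->|->].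
  by rewrite !exp_lift_lift !mxE /= (inj_eq lift_inj).
rewrite !exp_lift_max !mxE /= (negbTE (neq_lift _ _)) eq_sym (negbTE j0).
by rewrite mulr0 !add0r.
Qed.

(** Derivatives in the variables other than X_1 and U_1 reduce the claim to a polynomial in these
    two, that is, to an exponential polynomial in one real variable that vanishes on an interval. *)
Lemma nonvanishing_exp (Q : {mpoly K[n.+2]}) (O : set 'rV[R]_n.+1) :
  Q != 0 -> open O -> O !=set0 -> exists2 t, O t & peval iota Q (exp_lift t) != 0.
Proof.
move=> Q0 oO [t0 Ot0]; apply: contrapT => nex.
pose P (q : {mpoly K[n.+2]}) := forall t, O t -> peval iota q (exp_lift t) = 0.
have PQ : P Q.
  by move=> w Ow; apply/eqP/negPn/negP => Qw; apply: nex; exists w.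
have [|q [Pq q0 gq]] := reduce_by_derivation iota (S := ord_max |: [set ord0]%SET) _ PQ Q0.
  move=> j q; rewrite finset.in_setU1 finset.in_set1 negb_or => /andP[jm j0] Pq t Ot.
  case: (unliftP ord_max j) jm j0 => [k ->|->] => jm j0; last by rewrite eqxx in jm.
  have k0 : k != ord0 by apply: contra j0 => /eqP ->; rewrite lift_max0.
  rewrite -derive_peval.
  transitivity ('D_(delta_mx 0 k) (fun t => peval iota q (exp_lift t)) t).
    by apply: eq_derive => h; rewrite exp_liftD.
  rewrite (@near_eq_derive _ _ _ _ (cst 0)); first by rewrite derive_cst.
  by apply: filterS (open_nbhs_nbhs (conj oO Ot)) => y; exact: Pq.
have /genU1P[r rS qE] := gq.
have /choice[s sE] : forall i, exists s : {poly K}, r`_i = (map_poly mpoly_const s).[mpoly_var ord0].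
  by move=> i; exact: gen_set1.
have evq t : peval iota q (exp_lift t) = exp_poly (size r) (fun i => map_poly iota (s i)) (t 0 ord0).
  rewrite qE horner_coef peval_sum; apply: eq_bigr => i _.
  rewrite pevalM sE peval_horner_map exp_lift0 expRM_natl; congr (_ * _).
  by rewrite -exp_lift_max -(peval_var iota) /peval rmorphXn.
have /nbhs_ballP[e /= e0 eO] : nbhs t0 O by apply: open_nbhs_nbhs; split.
have s0 i : (i < size r)%N -> s i = 0.
  move=> ir; apply/eqP; rewrite -(map_poly_eq0 iota); apply/eqP.
  have tt : t0 0 ord0 - e < t0 0 ord0 + e by lra.
  apply: (exp_poly_eq0 (A := fun i => map_poly iota (s i)) tt _ ir) => x xt.
  pose t : 'rV[R]_n.+1 := (x - t0 0 ord0) *: delta_mx 0 ord0 + t0.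
  have tx : t 0 ord0 = x by rewrite !mxE /= mulr1 subrK.
  rewrite -tx -evq; apply: Pq; apply: eO; split=> // a b; rewrite ord1.
  rewrite !mxE /=; case: eqVneq => [->|_]; rewrite ?mulr0 ?add0r; last exact: ballxx.
  by rewrite /ball /= mulr1 subrK ltr_distlC.
move/eqP: q0; apply; rewrite qE; suff -> : r = 0 by rewrite horner0.
apply/polyP => i; rewrite coef0 sE; have [ir|ir] := ltnP i (size r).
  by rewrite s0// map_poly0 horner0.
by rewrite -sE nth_default.
Qed.

End GenericPoints.

(** * Implicit functions *)

Section StrongDifferentiability.
Context {R : realType}.

Lemma mx_norm_entry m n (M : 'M[R]_(m, n)) i j : `|M i j| <= `|M|.
Proof.
by rewrite [leRHS]/Num.Def.normr/= mx_normrE; exact: (le_bigmax _ (fun ij => `|M ij.1 ij.2|) (i, j)).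
Qed.

Lemma mx_norm_le m n (M : 'M[R]_(m, n)) b : 0 <= b ->
  (forall i j, `|M i j| <= b) -> `|M| <= b.
Proof.
move=> b0 Mb; rewrite [leLHS]/Num.Def.normr/= mx_normrE.
by apply: bigmax_le => // ij _.
Qed.

Lemma mx_norm_mul n p (v : 'rV[R]_n) (A : 'M[R]_(n, p)) :
  `|v *m A| <= n%:R * `|v| * `|A|.
Proof.
apply: mx_norm_le => [|i j]; first by rewrite !mulr_ge0.
rewrite mxE (le_trans (ler_norm_sum _ _ _))//.
apply: (@le_trans _ _ (\sum_(k < n) `|v| * `|A|)).
  by apply: ler_sum => k _; rewrite normrM ler_pM// mx_norm_entry.
by rewrite sumr_const card_ord -[leLHS]mulr_natl mulrA.
Qed.

Lemma is_derive_line (V : normedModType R) (f : V -> R) (z v : V) (s : R) :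
  derivable f (z + s *: v) v ->
  is_derive s 1 (fun s : R => f (z + s *: v)) ('D_v f (z + s *: v)).
Proof.
have E (h : R) : f (z + (h *: 1 + s) *: v) = f (h *: v + (z + s *: v)).
  by congr f; rewrite [h *: 1]mulr1 scalerDl addrCA.
move=> df; apply: DeriveDef; last by apply: eq_derive => h; exact: E.
rewrite /derivable (_ : (fun _ => _) = (fun h => h^-1 *:
  ((f \o shift (z + s *: v)) (h *: v) - f (z + s *: v)))); first exact: df.
by rewrite funeqE => h /=; rewrite E.
Qed.

Context {n c : nat}.
Variables (g : 'rV[R]_n -> 'rV[R]_c) (U : set 'rV[R]_n).
Hypothesis oU : open U.
Hypothesis dg : forall y, U y -> differentiable g y.

Lemma jacobian_mean_value (y z : 'rV[R]_n) k :
  (forall s : R, 0 <= s <= 1 -> U (z + s *: (y - z))) ->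
  exists2 s : R, 0 <= s <= 1 &
    (g y - g z) 0 k = ((y - z) *m 'J g (z + s *: (y - z))) 0 k.
Proof.
move=> segU; set v := y - z.
pose phi (s : R) := g (z + s *: v) 0 k.
have der (s : R) : 0 <= s <= 1 -> is_derive s 1 phi ((v *m 'J g (z + s *: v)) 0 k).
  move=> s01; have dgs := dg (segU s s01).
  have dgv := diff_derivable (v := v) dgs.
  rewrite -deriveEjacobian// (derive_mx dgv) mxE.
  by apply: is_derive_line; apply: (derivable_mxP _ _ _).1.
have phic : {within `[0, 1], continuous phi}.
  apply: derivable_within_continuous => s; rewrite in_itv /= => s01.
  by have [] := der s s01.
have [|s s01 E] := @MVT R phi (fun s => (v *m 'J g (z + s *: v)) 0 k) 0 1 ltr01 _ phic.
  move=> s; rewrite in_itv /= => /andP[s0 s1].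
  by apply: der; rewrite !ltW.
exists s; first by move: s01; rewrite in_itv /= => /andP[s0 s1]; rewrite !ltW.
rewrite mxE [(- g z) _ _]mxE; move: E; rewrite subr0 mulr1 => <-.
by rewrite /phi scale1r scale0r addr0 /v addrCA subrr addr0.
Qed.

Hypothesis cJ : forall y, U y -> {for y, continuous (fun z => 'J g z)}.

(** The mean value theorem is applied on the segment from z to y to each coordinate of g separately,
    with its own intermediate point; the maximum norm puts the estimates together. *)
Lemma strong_differentiability x e : U x -> 0 < e ->
  exists2 d, 0 < d & (forall y, `|y - x| < d -> U y) /\
    forall y z, `|y - x| < d -> `|z - x| < d ->
      `|g y - g z - (y - z) *m 'J g x| <= e * `|y - z|.
Proof.
(* [mx_norm_mul] costs a factor n, and n + 1 also covers n = 0. *)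
move=> Ux e0; pose e' := e / n.+1%:R.
have e'0 : 0 < e' by rewrite divr_gt0.
have Ux' : \forall y \near x, U y by apply: open_nbhs_nbhs.
have /nbhs_normP[d /= d0 Hd] : \forall y \near x, U y /\ `|'J g x - 'J g y| < e'.
  by apply: filterI => //; have /cvgrPdist_lt/(_ e' e'0) := cJ Ux.
have Hd' y : `|y - x| < d -> U y /\ `|'J g x - 'J g y| < e'.
  by rewrite distrC; exact: Hd.
exists d => //; split=> [y /Hd'[]//|y z yx zx].
have seg (s : R) : 0 <= s <= 1 -> `|z + s *: (y - z) - x| < d.
  move=> /andP[s0 s1].
  rewrite (_ : _ - x = s *: (y - x) + (1 - s) *: (z - x)); last first.
    rewrite scalerBl scale1r !scalerBr; apply/rowP => i; rewrite !mxE; ring.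
  rewrite (le_lt_trans (ler_normD _ _))// !normrZ (ger0_norm s0) ger0_norm ?subr_ge0//.
  have [s0'|] := ltrP 0 s; last first.
    by move=> s0'; rewrite (le_anti (introT andP (conj s0' s0))) mul0r add0r subr0 mul1r.
  apply: (@lt_le_trans _ _ (s * d + (1 - s) * d)).
    by rewrite ltr_leD ?ltr_pM2l// ler_wpM2l ?subr_ge0// ltW.
  by rewrite -mulrDl addrC subrK mul1r.
apply: mx_norm_le => [|i k]; first by rewrite mulr_ge0// ltW.
rewrite ord1 mxE.
have [|s s01 ->] := @jacobian_mean_value y z k; first by move=> s /seg /Hd'[].
rewrite [(- ((y - z) *m _)) _ _]mxE.
set w := z + _.
have subE (A B : 'rV[R]_c) : A 0 k - B 0 k = (A - B) 0 k by rewrite !mxE.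
rewrite subE -mulmxBr.
apply: le_trans (mx_norm_entry _ _ _) _; apply: le_trans (mx_norm_mul _ _) _.
have [_ Jw] := Hd' w (seg s s01); rewrite distrC in Jw.
apply: (@le_trans _ _ (n%:R * `|y - z| * e')).
  by rewrite ler_wpM2l ?mulr_ge0// ltW.
rewrite mulrAC ler_wpM2r// /e' mulrCA ler_piMr ?(ltW e0)//.
by rewrite ler_pdivrMr// mul1r ler_nat.
Qed.

End StrongDifferentiability.

(** Row vectors as a complete normed space, the setting of the fixed point theorem and of Baire's
    theorem. *)
HB.instance Definition _ (R : realType) m n := Complete.on 'M[R]_(m, n).

Section ImplicitFunction.
Context {R : realType} {n c : nat}.
Variables (g : 'rV[R]_n -> 'rV[R]_c) (U : set 'rV[R]_n).
Hypothesis oU : open U.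
Hypothesis dg : forall y, U y -> differentiable g y.
Hypothesis cJ : forall y, U y -> {for y, continuous (fun z => 'J g z)}.

Lemma banach_closed_ball (phi : 'rV[R]_c -> 'rV[R]_c) (rho : R) : 0 <= rho ->
  (forall e, `|e| <= rho -> `|phi e| <= rho) ->
  (forall e e', `|e| <= rho -> `|e'| <= rho -> `|phi e - phi e'| <= 2^-1 * `|e - e'|) ->
  exists2 e, `|e| <= rho & phi e = e.
Proof.
move=> rho0 phiD phiC; pose D := [set e : 'rV[R]_c | `|e| <= rho].
pose F : {fun D >-> D} := HB.pack phi (isFun.Build _ _ D D phi phiD).
have [|||e De eE] := @banach_fixed_point R 'rV[R]_c D F.
- have h : 0 <= 2^-1 :> R by rewrite invr_ge0.
  exists (NngNum h); split; first by rewrite /= invf_lt1// ltr1n.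
  by move=> [e e'] [/= De De']; apply: phiC.
- rewrite (_ : D = (fun e : 'rV[R]_c => `|e|) @^-1` [set z | z <= rho])//.
  by apply: preimage_closed; [move=> z _; exact: norm_continuous|exact: closed_le].
- by exists 0; rewrite /D /= normr0.
by exists e => //; rewrite -[RHS]/(id e) [in RHS]/= -{2}eE.
Qed.

(** Newton's iteration with the fixed matrix B solves for a correction h in the coordinates f,
    starting from any t near x. Instead of a smooth solution function there is a Lipschitz estimate
    between zeros: their difference in the coordinates f is controlled by the remaining part v. *)
Theorem implicit_function x (f : 'I_c -> 'I_n) : U x -> g x = 0 ->
  rowsub f ('J g x) \in unitmx ->
  let E := rowsub f 1%:M : 'M[R]_(c, n) in
  exists d L r : R, [/\ 0 < d, 0 <= L & 0 < r] /\
   [/\ forall y, `|y - x| < d -> U y,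
       forall y z h v, `|y - x| < d -> `|z - x| < d -> g y = 0 -> g z = 0 ->
         y - z = v + h *m E -> `|h| <= L * `|v| &
       forall t, `|t - x| < r -> exists h, `|t + h *m E - x| < d /\ g (t + h *m E) = 0].
Proof.
move=> Ux gx fx E; set J := 'J g x in fx *; set B := rowsub f J in fx.
have EJ : E *m J = B by rewrite /B rowsubE.
pose beta : R := c%:R * `|invmx B|.
pose kappa : R := c%:R * `|E|.
pose nu : R := n%:R * `|J|.
have beta0 : 0 <= beta by rewrite mulr_ge0.
have kappa0 : 0 <= kappa by rewrite mulr_ge0.
have nu0 : 0 <= nu by rewrite mulr_ge0.
have betaP (v : 'rV_c) : `|v *m invmx B| <= beta * `|v|.
  by rewrite (le_trans (mx_norm_mul _ _))// /beta mulrAC.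
have kappaP (v : 'rV_c) : `|v *m E| <= kappa * `|v|.
  by rewrite (le_trans (mx_norm_mul _ _))// /kappa mulrAC.
have nuP (v : 'rV_n) : `|v *m J| <= nu * `|v|.
  by rewrite (le_trans (mx_norm_mul _ _))// /nu mulrAC.
(* Makes beta * eps * kappa at most 1/2, the contraction factor of phi and the part of |h| absorbed
   in the Lipschitz estimate. *)
pose eps : R := (2 * (beta * kappa + 1))^-1.
have bk0 : 0 <= beta * kappa by rewrite mulr_ge0.
have eps0 : 0 < eps by rewrite invr_gt0 mulr_gt0// ltr_wpDl.
have epsP : beta * eps * kappa <= 2^-1.
  rewrite mulrAC /eps invfM mulrCA ler_piMr ?invr_ge0//.
  by rewrite ler_pdivrMr ?mul1r ?lerDl// ltr_wpDl.
clearbody beta kappa nu.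
have [d d0 [dU dS]] := strong_differentiability oU dg cJ Ux eps0.
pose M := beta * (nu + eps).
have M0 : 0 <= M by rewrite mulr_ge0// addr_ge0// ltW.
pose rho := d / (2 * (kappa + 1)).
have k1 : 0 < kappa + 1 by rewrite ltr_wpDl.
have rho0 : 0 < rho by rewrite divr_gt0// mulr_gt0.
have krho : kappa * rho <= d / 2.
  rewrite (_ : kappa * rho = d / 2 * (kappa / (kappa + 1))); last first.
    by rewrite /rho invfM; ring.
  rewrite ler_piMr ?divr_ge0 ?(ltW d0)//.
  by rewrite ler_pdivrMr// mul1r lerDl.
(* The first bound keeps t + h E within distance d of x; the second gives |phi 0| <= rho / 2, so
   that phi maps the ball of radius rho into itself. *)
pose r := Num.min (d / 2) (rho / (2 * (M + 1))).
have M1 : 0 < M + 1 by rewrite ltr_wpDl.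
have r0 : 0 < r by rewrite lt_min !divr_gt0// mulr_gt0.
exists d, (2 * M), r; split; first by split=> //; rewrite mulr_ge0.
split=> //.
  move=> y z h v yx zx gy gz yz.
  have := dS y z yx zx; rewrite gy gz subrr sub0r normrN yz => Hs.
  have hB : h = ((v + h *m E) *m J - v *m J) *m invmx B.
    rewrite (_ : _ - _ = h *m B) ?mulmxK//.
    by rewrite mulmxDl -mulmxA EJ addrAC subrr add0r.
  have h1 : `|h| <= beta * (eps * (`|v| + kappa * `|h|) + nu * `|v|).
    rewrite {1}hB (le_trans (betaP _))// ler_wpM2l//.
    rewrite (le_trans (ler_normB _ _))// lerD//.
    rewrite (le_trans Hs)// ler_wpM2l ?(ltW eps0)//.
    by rewrite (le_trans (ler_normD _ _))// lerD2l.
  have h2 : beta * eps * kappa * `|h| <= 2^-1 * `|h| by rewrite ler_wpM2r.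
  have h3 : `|h| <= M * `|v| + beta * eps * kappa * `|h|.
    by apply: le_trans h1 _; rewrite le_eqVlt; apply/orP; left; apply/eqP; rewrite /M; ring.
  by have := normr_ge0 h; lra.
move=> t tx.
have txd : `|t - x| < d / 2 by apply: lt_le_trans tx _; rewrite ge_min lexx.
have inball h : `|h| <= rho -> `|t + h *m E - x| < d.
  move=> hr; rewrite addrAC (le_lt_trans (ler_normD _ _))//.
  have : `|h *m E| <= d / 2.
    by rewrite (le_trans (kappaP _))// (le_trans _ krho)// ler_wpM2l.
  by move: txd; lra.
pose phi h := h - g (t + h *m E) *m invmx B.
have phiC e e' : `|e| <= rho -> `|e'| <= rho -> `|phi e - phi e'| <= 2^-1 * `|e - e'|.
  move=> he he'; have := dS _ _ (inball e he) (inball e' he').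
  rewrite opprD addrACA subrr add0r -mulmxBl => gE.
  rewrite (_ : _ - phi e' = - ((g (t + e *m E) - g (t + e' *m E) - (e - e') *m E *m J) *m invmx B)); last first.
    by rewrite -mulmxA EJ !mulmxBl !mulmxK// /phi !opprB addrACA [RHS]addrACA [in RHS](addrC (- e')).
  rewrite normrN (le_trans (betaP _))//.
  apply: (@le_trans _ _ (beta * (eps * (kappa * `|e - e'|)))).
    by rewrite ler_wpM2l// (le_trans gE)// ler_wpM2l ?(ltW eps0).
  by rewrite !mulrA ler_wpM2r.
have phi0 : `|phi 0| <= rho / 2.
  rewrite /phi mul0mx addr0 sub0r normrN (le_trans (betaP _))//.
  have tx' : `|t - x| < d by move: txd; lra.
  have xx : `|x - x| < d by rewrite subrr normr0.
  have := dS t x tx' xx; rewrite gx subr0 => Hs.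
  have gt : `|g t| <= (nu + eps) * `|t - x|.
    rewrite -(subrK ((t - x) *m J) (g t)) (le_trans (ler_normD _ _))//.
    by rewrite addrC mulrDl lerD.
  apply: (@le_trans _ _ (M * `|t - x|)).
    by rewrite /M -mulrA ler_wpM2l.
  have : `|t - x| < rho / (2 * (M + 1)) by apply: lt_le_trans tx _; rewrite ge_min lexx orbT.
  rewrite ltr_pdivlMr ?mulr_gt0// => h1.
  have := normr_ge0 (t - x); nra.
have [|h hr hE] := banach_closed_ball (ltW rho0) _ phiC.
  move=> e he; have := phiC e 0 he; rewrite normr0 subr0 => /(_ (ltW rho0)) h1.
  have := ler_normD (phi e - phi 0) (phi 0); rewrite subrK => h2.
  by move: h1 h2 phi0 he; lra.
exists h; split; first exact: inball.
have : g (t + h *m E) *m invmx B = 0.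
  by move/eqP: hE; rewrite /phi subr_eq addrC -subr_eq subrr eq_sym => /eqP.
by move=> /(congr1 (mulmx^~ B)); rewrite mulmxKV// mul0mx.
Qed.

End ImplicitFunction.

Section ConstantCoordinate.
Context {R : realType}.

Lemma is_derive_flat (phi : R -> R) (s : R) :
  (forall e : R, 0 < e -> exists2 d, 0 < d &
     forall s' : R, `|s' - s| < d -> `|phi s' - phi s| <= e * `|s' - s|) ->
  is_derive s 1 phi 0.
Proof.
move=> H.
have cv : h^-1 *: ((phi \o shift s) (h *: 1) - phi s) @[h --> 0^'] --> (0 : R).
  apply/cvgrPdist_le => e e0; have [d d0 dP] := H e e0.
  apply: filterS (dnbhs0_lt d0) => h hd.
  rewrite sub0r normrN normrZ /= [h *: 1]mulr1 normfV.
  have := dP (h + s); rewrite addrK => /(_ hd) hh.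
  have [->|h0] := eqVneq h 0; first by rewrite normr0 invr0 mul0r ltW.
  by rewrite mulrC ler_pdivrMr ?normr_gt0.
by apply: DeriveDef; [apply/cvg_ex; exists 0|exact: cvg_lim].
Qed.

Lemma flat_constant (phi : R -> R) :
  (forall s e : R, 0 <= s <= 1 -> 0 < e -> exists2 d, 0 < d &
     forall s' : R, `|s' - s| < d -> `|phi s' - phi s| <= e * `|s' - s|) ->
  phi 1 = phi 0.
Proof.
move=> H.
have der (s : R) : 0 <= s <= 1 -> is_derive s 1 phi 0.
  by move=> s01; apply: is_derive_flat => e; exact: H.
have phic : {within `[0, 1], continuous phi}.
  apply: derivable_within_continuous => s; rewrite in_itv /= => s01.
  by have [] := der s s01.
have [|s _ E] := @MVT R phi (fun=> 0) 0 1 ltr01 _ phic.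
  by move=> s; rewrite in_itv /= => /andP[s0 s1]; apply: der; rewrite !ltW.
by apply/eqP; rewrite -subr_eq0 E mul0r.
Qed.

Context {n c : nat}.
Variables (g : 'rV[R]_n -> 'rV[R]_c) (U : set 'rV[R]_n).
Hypothesis oU : open U.
Hypothesis dg : forall y, U y -> differentiable g y.
Hypothesis cJ : forall y, U y -> {for y, continuous (fun z => 'J g z)}.

(* Along a Lipschitz curve y of zeros, (y' - y) *m 'J g y = o(y' - y), so a
   coordinate whose differential is a combination of those of g is constant. *)
Lemma implicit_constant x (f : 'I_c -> 'I_n) i0 : U x -> g x = 0 ->
  rowsub f ('J g x) \in unitmx ->
  (forall z, U z -> g z = 0 -> exists l : 'cV_c, 'J g z *m l = delta_mx i0 0) ->
  exists2 r : R, 0 < r & forall t, `|t - x| < r -> exists h,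
    let y := t + h *m (rowsub f 1%:M : 'M[R]_(c, n)) in
    [/\ U y, g y = 0 & y 0 i0 = x 0 i0].
Proof.
move=> Ux gx fx Jl.
have [d [L [r [[d0 L0 r0] [dU lip solve]]]]] := implicit_function oU dg cJ Ux gx fx.
set E := rowsub f 1%:M : 'M[R]_(c, n) in lip solve *.
exists r => // t tx; pose v := t - x.
have ball_s (s : R) : `|s| * `|v| < r -> `|(x + s *: v) - x| < r.
  by rewrite addrAC subrr add0r normrZ.
have /choice[h hP] (s : R) : exists h, `|s| * `|v| < r ->
    `|x + s *: v + h *m E - x| < d /\ g (x + s *: v + h *m E) = 0.
  have [sr|] := boolP (`|s| * `|v| < r); last by exists 0.
  by have [h hP] := solve _ (ball_s s sr); exists h.
(* A curve of zeros above the segment from x to t. Its points are chosen one by one; [lip] alone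
   makes it Lipschitz. *)
pose y s := x + s *: v + h s *m E.
have yP s : `|s| * `|v| < r -> `|y s - x| < d /\ g (y s) = 0 by exact: hP.
have near_s (s : R) : 0 <= s <= 1 -> `|s| * `|v| < r.
  move=> /andP[s0 s1]; apply: le_lt_trans tx.
  by rewrite ger0_norm// ler_piMl.
have [|h0d gh0] := yP 0; first by rewrite normr0 mul0r.
(* The estimate [lip] with v = 0 is uniqueness of the solution. *)
have y0 : y 0 = x.
  have xx : `|x - x| < d by rewrite subrr normr0.
  have : `|h 0| <= L * `|0 : 'rV[R]_n|.
    apply: (lip (y 0) x) => //; by rewrite /y scale0r addr0 addrAC subrr.
  rewrite normr0 mulr0 normr_le0 => /eqP hh.
  by rewrite /y hh mul0mx scale0r !addr0.
pose C := (1 + c%:R * L * `|E|) * `|v|.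
have C0 : 0 <= C by rewrite mulr_ge0// addr_ge0// !mulr_ge0.
have ylip s s' : `|s| * `|v| < r -> `|s'| * `|v| < r -> `|y s' - y s| <= C * `|s' - s|.
  move=> /yP[sd gs] /yP[sd' gs'].
  have yE : y s' - y s = (s' - s) *: v + (h s' - h s) *m E.
    rewrite /y mulmxBl scalerBl opprD addrACA; congr (_ + _).
    by rewrite opprD addrACA subrr add0r.
  have := lip _ _ _ _ sd' sd gs' gs yE; rewrite yE normrZ => hl.
  rewrite (le_trans (ler_normD _ _))// normrZ.
  have := mx_norm_mul (h s' - h s) E => hE.
  have : `|(h s' - h s) *m E| <= c%:R * (L * (`|s' - s| * `|v|)) * `|E|.
    by apply: le_trans hE _; rewrite ler_wpM2r// ler_wpM2l.
  rewrite /C; set A := `|s' - s|; set B := `|v| => hh.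
  apply: le_trans (lerD (lexx _) hh) _; rewrite le_eqVlt; apply/orP; left; apply/eqP; ring.
clearbody C.
exists (h 1); have [|y1d g1] := yP 1; first by rewrite near_s// ler01 lexx.
have y1E : y 1 = t + h 1 *m E by rewrite /y scale1r /v addrCA subrr addr0.
rewrite -y1E; split=> //; first exact: dU.
rewrite -[in RHS]y0; apply: (flat_constant (phi := fun s => y s 0 i0)) => s e s01 e0.
have [yd gy] := yP s (near_s s s01); have Uy := dU _ yd.
have [l lE] := Jl _ Uy gy.
pose D := c%:R * C * `|l| + 1.
have D0 : 0 < D by rewrite ltr_wpDl// !mulr_ge0.
have eD : 0 < e / D by rewrite divr_gt0.
have [d1 d10 [_ dS]] := strong_differentiability oU dg cJ Uy eD.
pose d2 := Num.min ((r - `|s| * `|v|) / (`|v| + 1)) (d1 / (C + 1)).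
have v1 : 0 < `|v| + 1 by rewrite ltr_wpDl.
have C1 : 0 < C + 1 by rewrite ltr_wpDl.
exists d2; first by rewrite lt_min !divr_gt0// subr_gt0 near_s.
move=> s'; rewrite lt_min !ltr_pdivlMr// => /andP[s'1 s'2].
have s'r : `|s'| * `|v| < r.
  have : `|s'| <= `|s' - s| + `|s| by rewrite -{1}(subrK s s') ler_normD.
  have := normr_ge0 v; have := normr_ge0 (s' - s); move: s'1; nra.
have [yd' gy'] := yP s' s'r.
have lips := ylip s s' (near_s s s01) s'r.
have yy : `|y s' - y s| < d1.
  by apply: le_lt_trans lips _; have := normr_ge0 (s' - s); move: s'2; nra.
have := dS (y s') (y s) yy; rewrite subrr normr0 => /(_ d10).
rewrite gy gy' subrr sub0r normrN => J1.
have yE : y s' 0 i0 - y s 0 i0 = ((y s' - y s) *m 'J g (y s) *m l) 0 0.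
  by rewrite -mulmxA lE -colE !mxE.
rewrite yE (le_trans (mx_norm_entry _ _ _))// (le_trans (mx_norm_mul _ _))//.
have J2 : `|(y s' - y s) *m 'J g (y s)| <= e / D * (C * `|s' - s|).
  by apply: le_trans J1 _; rewrite ler_wpM2l// ltW.
apply: (@le_trans _ _ (c%:R * (e / D * (C * `|s' - s|)) * `|l|)).
  by rewrite ler_wpM2r// ler_wpM2l.
rewrite (_ : _ * `|l| = e * `|s' - s| * ((c%:R * C * `|l|) / D)); last by ring.
by rewrite ler_piMr ?mulr_ge0 ?(ltW e0)// ler_pdivrMr// mul1r lerDl.
Qed.

End ConstantCoordinate.

(** * Exponential sets *)

Section ExponentialRing.
Context {R : realType} {K : fieldType}.
Variable iota : {rmorphism K -> R}.
Hypothesis K_algebraic : forall a : K, algebraicOver (ratr : rat -> R) (iota a).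

(** A number algebraic over K is algebraic over the rationals because K is, so Lindemann's theorem
    applies. *)
Lemma transcendental_or_exp (a : R) : a != 0 ->
  transcendental iota a \/ transcendental iota (expR a).
Proof.
move=> a0; have alg b : ~ transcendental iota b -> algebraicOver (ratr : rat -> R) b.
  move=> /existsNP[s /not_implyP[sb /eqP s0]]; apply/integral_algebraic.
  apply: (@integral_root _ _ _ (map_poly iota s)).
  - by rewrite map_poly_eq0.
  - exact/eqP.
  - by move=> _ /(nthP 0)[i _ <-]; rewrite coef_map; apply/integral_algebraic/K_algebraic.
apply: contrapT => /not_orP[/alg aalg /alg balg].
exact: (exp_transcendental a0 aalg balg).
Qed.

Context {n : nat}.
Notation pt := 'rV[R]_n.+1.
Notation ev := (@exp_eval R K iota n).

Lemma exp_ringE : @exp_ring R K iota n = range ev.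
Proof. by apply/seteqP; split=> [_ [Q ->]|_ [Q _ <-]]; [exists Q|exists Q]. Qed.

Lemma exp_evalD P Q (x : pt) : ev (P + Q) x = ev P x + ev Q x.
Proof. by rewrite /exp_eval pevalD. Qed.

Lemma exp_evalM P Q (x : pt) : ev (P * Q) x = ev P x * ev Q x.
Proof. by rewrite /exp_eval pevalM. Qed.

Lemma exp_eval1 (x : pt) : ev 1 x = 1.
Proof. by rewrite /exp_eval peval1. Qed.

(** Algebraic independence over K of those among the numbers y_1, ..., y_(n+1), e^(y_1) whose index
    lies in T. *)
Definition independent_at (y : pt) :=
  independent (@mpoly_const K n.+2) (@mpoly_var K n.+2) (fun Q => ev Q y = 0).

Lemma independent_sub (A : comNzRingType) (k : {rmorphism K -> A}) N (X : 'I_N -> A)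
    (p q : A -> Prop) T : (forall h, p h -> q h) ->
  independent k X q T -> independent k X p T.
Proof. by move=> pq iq h Th /pq; apply: iq. Qed.

(** Baire's theorem makes [phi t] generic for some t, and independence of S at y depends only on the
    coordinates in S, where y agrees with [phi t]. *)
Lemma independent_near (X : completeNormedModType R) (phi : X -> 'rV[R]_n.+2)
    (O : set X) (Y : set pt) (S : {set 'I_n.+2}) :
  continuous phi ->
  (forall (Q : {mpoly K[n.+2]}) (O : set X), Q != 0 -> open O -> O !=set0 ->
     exists2 t, O t & peval iota Q (phi t) != 0) ->
  open O -> O !=set0 ->
  (forall t, O t -> exists2 y, Y y & forall i, i \in S -> exp_lift y 0 i = phi t 0 i) ->
  exists2 y, Y y & independent_at y S.
Proof.
move=> cphi dphi oO O0 lift_y.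
have [|t Ot tg] := @baire_generic R K iota K_algebraic n.+2 X (fun Q t => peval iota Q (phi t)) O _ dphi oO O0.
  move=> Q t; apply: (@continuous_comp _ _ _ phi (peval iota Q)); first exact: cphi.
  exact: continuous_peval.
have [y Yy yt] := lift_y t Ot; exists y => // Q SQ.
rewrite /exp_eval (gen_agree iota SQ yt) => Qt.
by apply/eqP/negPn/negP => /tg; rewrite Qt eqxx.
Qed.

Lemma independent_near_lift x (r : R) (Y : set pt) (S : {set 'I_n.+2}) : 0 < r ->
  (forall t, `|t - x| < r -> exists2 y, Y y &
     forall i, i \in S -> exp_lift y 0 i = exp_lift t 0 i) ->
  exists2 y, Y y & independent_at y S.
Proof.
move=> r0 H; apply: (@independent_near 'rV[R]_n.+1 (@exp_lift R n) (ball x r)).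
- exact: continuous_exp_lift.
- by move=> Q O Q0 oO O0; apply: nonvanishing_exp.
- exact: ball_open.
- by exists x; apply: ballxx.
- by move=> t; rewrite -ball_normE /= distrC; exact: H.
Qed.

Lemma independent_near_transcendental x (r : R) v c (Y : set pt) (S : {set 'I_n.+2}) : 0 < r ->
  transcendental iota c ->
  (forall w : 'rV[R]_n.+2, `|proj_U1 w - x| < r -> exists2 y, Y y &
     forall i, i \in S -> exp_lift y 0 i = if i == v then c else w 0 i) ->
  exists2 y, Y y & independent_at y S.
Proof.
move=> r0 tc H.
apply: (@independent_near 'rV[R]_n.+2 (@set_coord R n.+2 v c) (ball (exp_lift x) r)).
- exact: continuous_set_coord.
- by move=> Q O Q0 oO O0; apply: nonvanishing_transcendental.
- exact: ball_open.
- by exists (exp_lift x); apply: ballxx.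
- move=> w; rewrite -ball_normE /= distrC => wr.
  have [|y Yy yw] := H w.
    apply: le_lt_trans wr; apply: mx_norm_le => // i j; rewrite ord1.
    rewrite (_ : (proj_U1 w - x) 0 j = (w - exp_lift x) 0 (lift ord_max j)); last first.
      by rewrite mxE [RHS]mxE [in RHS]mxE exp_lift_lift !mxE.
    exact: mx_norm_entry.
  by exists y => // i iS; rewrite yw// mxE.
Qed.

Lemma independent_at_set1 (z : pt) : X1 z != 0 ->
  exists v, independent_at z [set v]%SET.
Proof.
have tr v : transcendental iota (exp_lift z 0 v) -> independent_at z [set v]%SET.
  move=> tv Q /gen_set1[s ->]; rewrite /exp_eval peval_horner_map => /tv ->.
  by rewrite map_poly0 horner0.
by case/transcendental_or_exp => t; [exists ord0|exists ord_max]; apply: tr;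
  rewrite ?exp_lift0 ?exp_lift_max.
Qed.

End ExponentialRing.

Section UnitSubmatrices.
Context {F : fieldType}.

Lemma rowsub_unit_inj m c (A : 'M[F]_(m, c)) (f : 'I_c -> 'I_m) :
  rowsub f A \in unitmx -> injective f.
Proof.
rewrite unitmxE unitfE => + i j fij; apply: contraNeq => ij.
by apply/eqP; apply: (determinant_alternate ij) => k; rewrite !mxE fij.
Qed.

Lemma mul_rowsub1 m c (h : 'rV[F]_c) (f : 'I_c -> 'I_m) j :
  (forall i, f i != j) -> (h *m (rowsub f 1%:M : 'M[F]_(c, m))) 0 j = 0.
Proof. by move=> fj; rewrite mxE big1// => i _; rewrite !mxE (negbTE (fj i)) mulr0. Qed.

(** If no invertible submatrix avoids row i0, deleting this row lowers the rank; a vector killed by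
    the other rows is then not killed by row i0. For a Jacobian this expresses the differential of
    the coordinate i0 by those of the equations. *)
Lemma column_delta m c (A : 'M[F]_(m.+1, c)) (i0 : 'I_m.+1) : \rank A = c ->
  (forall f : 'I_c -> 'I_m.+1, (forall i, f i != i0) -> rowsub f A \notin unitmx) ->
  exists l : 'cV_c, A *m l = delta_mx i0 0.
Proof.
move=> rA nf.
have : ~~ row_full (row' i0 A).
  apply/negP => fA; have := nf (lift i0 \o fullrankfun fA).
  have -> : rowsub (lift i0 \o fullrankfun fA) A = rowsub (fullrankfun fA) (row' i0 A).
    by apply/matrixP => i j; rewrite !mxE.
  rewrite fullrowsub_unit => /(_ _)/negP; apply=> // i.
  by rewrite eq_sym neq_lift.
rewrite -cokermx_eq0; have := mulmx_coker (row' i0 A); set B := cokermx _ => AB B0.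
have [k lk] : exists k, col k B != 0.
  apply/existsP; apply: contraR B0 => /existsPn B0; apply/eqP/matrixP => i k.
  by have /negPn/eqP/matrixP/(_ i 0) := B0 k; rewrite !mxE.
have Al j : j != i0 -> (A *m col k B) j 0 = 0.
  case: (unliftP i0 j) => [j' -> _|->]; last by rewrite eqxx.
  have /matrixP/(_ j' k) := AB; rewrite mxE [RHS]mxE => AB0.
  by rewrite mxE -[RHS]AB0; apply: eq_bigr => i _; rewrite !mxE.
have a0 : (A *m col k B) i0 0 != 0.
  apply: contra lk => /eqP Al0.
  have /row_fullP[C CA] : row_full A by apply/eqP.
  rewrite -(mul1mx (col k B)) -CA -mulmxA (_ : A *m _ = 0) ?mulmx0//.
  by apply/colP => j; rewrite [RHS]mxE; have [->//|/Al] := eqVneq j i0.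
exists (((A *m col k B) i0 0)^-1 *: col k B); rewrite -scalemxAr.
apply/colP => j; rewrite mxE [RHS]mxE eqxx andbT.
by have [->|/Al ->] := eqVneq j i0; rewrite ?mulVf// mulr0.
Qed.

End UnitSubmatrices.

Lemma continuous_det_rowsub {R : realType} m c (f : 'I_c -> 'I_m) :
  continuous (fun A : 'M[R]_(m, c) => \det (rowsub f A)).
Proof.
rewrite /determinant; apply: continuous_big => [|s _]; first exact: add_continuous.
move=> A; apply: (@continuous_comp _ _ _
  (fun A : 'M[R]_(m, c) => \prod_i rowsub f A i (s i)) ( *%R ((-1) ^+ s))); last first.
  exact: mulrl_continuous.
apply: continuous_big => [|i _]; first exact: mul_continuous.
rewrite (_ : (fun _ => _) = (fun B : 'M[R]_(m, c) => B (f i) (s i))).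
  exact: coord_continuous.
by apply/funext => B; rewrite mxE.
Qed.

Section Charts.
Context {R : realType} {K : fieldType}.
Variable iota : {rmorphism K -> R}.
Hypothesis K_algebraic : forall a : K, algebraicOver (ratr : rat -> R) (iota a).
Context {n c : nat}.

(* The coordinates of R^(n+2) that parametrize {g = 0} when the rows f of the
   transposed Jacobian of g form an invertible matrix, together with U_1. *)
Definition params (f : 'I_c -> 'I_n.+1) : {set 'I_n.+2} :=
  (~: [set lift ord_max (f i) | i in 'I_c])%SET.

Lemma card_params f : injective f -> (#|params f| = n.+2 - c)%N.
Proof.
move=> finj; rewrite cardsCs finset.setCK card_ord card_imset ?card_ord//.
by move=> i j /lift_inj/finj.
Qed.

Lemma params_lift f j : lift ord_max j \in params f -> forall i, f i != j.
Proof.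
rewrite finset.in_setC => /negP nj i; apply/eqP => fij; apply: nj.
by apply/imsetP; exists i; rewrite ?fij.
Qed.

Lemma params_max f : ord_max \in params f.
Proof.
by rewrite finset.in_setC; apply/negP => /imsetP[i _ /eqP]; rewrite (negbTE (neq_lift _ _)).
Qed.

Variables (g : 'rV[R]_n.+1 -> 'rV[R]_c) (U : set 'rV[R]_n.+1).
Hypothesis oU : open U.
Hypothesis dg : forall y, U y -> differentiable g y.
Hypothesis cJ : forall y, U y -> {for y, continuous (fun z => 'J g z)}.

(** As f avoids X_1, correcting t in the coordinates f changes neither X_1 nor e^(X_1), so U_1 may
    be counted among the parameters. *)
Lemma independent_chart x f : U x -> g x = 0 -> rowsub f ('J g x) \in unitmx ->
  (forall i, f i != ord0) ->
  exists2 y, U y /\ g y = 0 & independent_at iota y (params f).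
Proof.
move=> Ux gx fx f0.
have [d [L [r [[d0 L0 r0] [dU _ solve]]]]] := implicit_function oU dg cJ Ux gx fx.
apply: (independent_near_lift K_algebraic r0) => t /solve[h [yd gy]].
exists (t + h *m rowsub f 1%:M); first by split; [apply: dU|].
move=> i; case: (unliftP ord_max i) => [j ->|->] iP.
  by rewrite !exp_lift_lift mxE mul_rowsub1 ?addr0//; apply: params_lift.
by rewrite !exp_lift_max mxE mul_rowsub1 ?addr0.
Qed.

(** If X_1 is a parameter in no chart at any point, then dX_1 is everywhere a combination of the
    differentials of g, and X_1 can be kept fixed while the parameters vary. *)
Lemma constant_chart x : U x -> g x = 0 -> \rank ('J g x) = c ->
  (forall y f, U y -> g y = 0 -> (forall i, f i != ord0) ->
     rowsub f ('J g y) \notin unitmx) ->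
  exists (f : 'I_c -> 'I_n.+1) (r : R), [/\ injective f, (exists i, f i = ord0), 0 < r &
    forall t, `|t - x| < r -> exists y, [/\ U y, g y = 0, y 0 ord0 = x 0 ord0 &
      forall j, (forall i, f i != j) -> y 0 j = t 0 j]].
Proof.
move=> Ux gx rx nf.
have fullx : row_full ('J g x) by apply/eqP.
have [f fx] : exists f, rowsub f ('J g x) \in unitmx.
  by exists (fullrankfun fullx); exact: fullrowsub_unit.
(* Where the minor of f stays nonzero the rank stays c, as [column_delta] requires at every zero z
   and not only at x. *)
pose S := [set y | U y /\ rowsub f ('J g y) \in unitmx].
have nS : nbhs x S.
  apply: filterI; first exact: open_nbhs_nbhs.
  have c1 : {for x, continuous (fun y => \det (rowsub f ('J g y)))}.
    apply: (@continuous_comp _ _ _ (fun y => 'J g y) (fun A => \det (rowsub f A))).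
      exact: cJ.
    exact: continuous_det_rowsub.
  have : \forall y \near x, \det (rowsub f ('J g y)) != 0.
    apply: (c1 [set z : R | z != 0]); apply: open_nbhs_nbhs; split; first exact: open_neq.
    by rewrite /= -unitfE -unitmxE.
  by apply: filterS => y; rewrite unitmxE unitfE.
have oS : open S° by exact: open_interior.
have SS y : S° y -> S y by exact: interior_subset.
have [|||r r0 rP] := @implicit_constant R _ _ g S° oS _ _ x f ord0 nS gx fx.
- by move=> y /SS[/dg].
- by move=> y /SS[/cJ].
- move=> z /SS[Uz fz] gz; apply: column_delta; last by move=> f'; apply: nf.
  apply/eqP; rewrite eqn_leq rank_leq_col /=.
  exact: (@unit_submatrix_rank _ _ _ _ _ f id).
exists f, r; split=> //; first exact: rowsub_unit_inj fx.
  apply: contrapT => /forallNP f0; have := nf x f Ux gx.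
  by rewrite fx => /(_ _)/negP; apply=> // i; apply/eqP; exact: f0.
move=> t /rP[h [/SS[Uy _] gy y0]]; exists (t + h *m rowsub f 1%:M); split=> // j fj.
by rewrite mxE mul_rowsub1 ?addr0.
Qed.

End Charts.

Section Independence.
Context {R : realType} {K : fieldType}.
Variable iota : {rmorphism K -> R}.
Hypothesis K_algebraic : forall a : K, algebraicOver (ratr : rat -> R) (iota a).
Context {n : nat}.
Notation pt := 'rV[R]_n.+1.
Notation ev := (@exp_eval R K iota n).
Notation indep := (independent (@mpoly_const K n.+2) (@mpoly_var K n.+2)).

Lemma independent_at_vanishing (Z : set pt) y T : Z y ->
  independent_at iota y T -> indep (vanishing ev Z) T.
Proof. by move=> Zy; apply: independent_sub => h; apply. Qed.

Lemma independent_manifold c (g : pt -> 'rV[R]_c) (U Z : set pt) x : open U ->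
  (forall y, U y -> differentiable g y) ->
  (forall y, U y -> {for y, continuous (fun z => 'J g z)}) ->
  (forall y, U y -> g y = 0 -> Z y) ->
  prime_ideal (vanishing ev Z) -> ~ vanishing ev Z (mpoly_var ord0) ->
  U x -> g x = 0 -> \rank ('J g x) = c ->
  exists2 T : {set 'I_n.+2}, (n.+2 - c <= #|T|)%N & indep (vanishing ev Z) T.
Proof.
move=> oU dg cJ UZ pZ nZ Ux gx rx.
have [[y [f [[Uy gy] [f0 fy]]]]|nf] := pselect (exists y (f : 'I_c -> 'I_n.+1),
    (U y /\ g y = 0) /\ ((forall i, f i != ord0) /\ rowsub f ('J g y) \in unitmx)).
  have [z [Uz gz] zT] := independent_chart K_algebraic oU dg cJ Uy gy fy f0.
  exists (params f); first by rewrite card_params//; exact: rowsub_unit_inj fy.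
  exact: independent_at_vanishing (UZ z Uz gz) zT.
have [|f [r [finj [i0 fi0] r0 rP]]] := constant_chart oU dg cJ Ux gx rx.
  by move=> y f Uy gy f0; apply/negP => fy; apply: nf; exists y, f.
(* Since f takes the value X_1, the set [params f] contains U_1 but not X_1. Without U_1 there
   remain n + 1 - c coordinates, the dimension of the piece, and one more has to be found. *)
pose S := (params f :\ ord_max)%SET.
have cS : #|S|.+1 = (n.+2 - c)%N.
  by rewrite -(card_params finj) [RHS](cardsD1 ord_max) params_max.
have S0 : ord0 \notin S.
  rewrite -lift_max0; apply/negP; rewrite finset.in_setD1 => /andP[_ /params_lift/(_ i0)].
  by rewrite fi0 eqxx.
have SP i : i \in S -> exists2 j, i = lift ord_max j & forall i, f i != j.
  rewrite finset.in_setD1; case: (unliftP ord_max i) => [j ->|->]; last by rewrite eqxx.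
  by move=> /andP[_ /params_lift]; exists j.
have [x0|x0] := eqVneq (x 0 ord0) 0; last first.
  have [v [a [vS ta va]]] : exists v (a : R), [/\ v \notin S, transcendental iota a &
      forall y : pt, y 0 ord0 = x 0 ord0 -> exp_lift y 0 v = a].
    have [t|t] := transcendental_or_exp K_algebraic x0.
      by exists ord0, (x 0 ord0); split=> // y; rewrite exp_lift0.
    exists ord_max, (expR (x 0 ord0)); split=> [||y y0]; rewrite ?exp_lift_max ?y0//.
    by rewrite finset.in_setD1 eqxx.
  have [|y [Uy gy] yT] := @independent_near_transcendental R K iota K_algebraic n x r v a
      (fun y => U y /\ g y = 0) (v |: S)%SET r0 ta.
    move=> w /rP[y [Uy gy y0 yw]]; exists y => // i.
    rewrite finset.in_setU1; case: eqVneq => [-> _|_ /SP[j -> fj]]; first exact: va.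
    by rewrite exp_lift_lift yw// mxE.
  exists (v |: S)%SET; first by rewrite cardsU1 vS -cS.
  exact: independent_at_vanishing (UZ y Uy gy) yT.
have [|y [[Uy gy] y0] yS] := @independent_near_lift R K iota K_algebraic n x r
    (fun y => (U y /\ g y = 0) /\ y 0 ord0 = 0) S r0.
  move=> t /rP[y [Uy gy y0 yt]]; exists y; first by rewrite y0.
  by move=> i /SP[j -> fj]; rewrite !exp_lift_lift yt.
have Zy := UZ y Uy gy.
have iS := independent_at_vanishing Zy yS.
have [T ST maxT] := max_independent_exists iS.
exists T; last exact: maxT.1.
(* S is independent even at the single point y, where X_1 = 0. Were S maximal on Z, elimination
   would yield a nonzero polynomial in S congruent to a multiple of X_1, hence zero at y. *)
rewrite -cS proper_card// finset.properEneq ST andbT; apply/eqP => TS.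
have Z0 : vanishing ev Z 0 by apply: vanishing0 => p q z; apply: exp_evalD.
have [c' [u [Tc c0 cu]]] := max_independent_eliminate pZ Z0 maxT (gen_mpoly _) nZ.
move/eqP: c0; apply; apply: yS; first by rewrite TS.
have := cu y Zy; rewrite -mulN1r mulrA exp_evalD exp_evalM.
by rewrite {3}/exp_eval peval_var exp_lift0 y0 mulr0 addr0.
Qed.

Lemma independent_exp_dim (Z : set pt) : irreducible (exponential_set iota) Z ->
  ~ Z `<=` Zer [:: @X1 R n] ->
  exists2 T : {set 'I_n.+2}, (exp_dim iota Z < #|T|)%N & indep (vanishing ev Z) T.
Proof.
move=> irrZ nZ.
have [z Zz z0] : exists2 z, Z z & X1 z != 0.
  apply: contrapT => nz; apply: nZ => z Zz [|//] _ /=.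
  by apply/eqP/negPn/negP => z0; apply: nz; exists z.
have pZ : prime_ideal (vanishing ev Z).
  apply: vanishing_prime; [exact: exp_eval1|exact: exp_evalD|exact: exp_evalM|].
  by rewrite -exp_ringE.
have nZ' : ~ vanishing ev Z (mpoly_var ord0).
  by move=> /(_ z Zz)/eqP; rewrite /exp_eval peval_var exp_lift0; apply/negP.
have [d0|] := posnP (exp_dim iota Z).
  have [v zv] := independent_at_set1 K_algebraic z0.
  exists [set v]%SET; first by rewrite d0 cards1.
  exact: independent_at_vanishing Zz zv.
move=> /dim_witness[k [x [_ [c [U [g [[cd oU Ux Mx] [dg cJ rx UM]]]]]]]].
have [y Uy gy|T cT iT] := independent_manifold oU dg cJ _ pZ nZ' Ux ((UM x Ux).1 Mx) rx.
  by have /stratum_sub := (UM y Uy).2 gy.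
exists T => //; apply: leq_trans cT.
by rewrite ltn_subRL ltnS (eq_leq cd).
Qed.

End Independence.

Section AdmissibleSets.
Context {R : realType} {K : fieldType}.
Variable iota : {rmorphism K -> R}.
Context {n : nat}.
Notation pt := 'rV[R]_n.+1.
Notation ev := (@exp_eval R K iota n).

Lemma proj_graph (W : set 'rV[R]_n.+2) :
  proj_U1 @` (W `&` exp_graph) = [set x | W (exp_lift x)].
Proof.
have proj_lift (x : pt) : proj_U1 (exp_lift x) = x.
  by apply/rowP => j; rewrite mxE exp_lift_lift.
apply/seteqP; split=> [_ [w [Ww /(_ 0%N isT)/= gw] <-]|x Wx]; last first.
  exists (exp_lift x) => //; split=> // -[|//] _ /=.
  by rewrite /U1 /X1 exp_lift_max exp_lift0 subrr.
rewrite /= (_ : exp_lift _ = w)//; apply/rowP => i.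
case: (unliftP ord_max i) => [j ->|->]; first by rewrite exp_lift_lift mxE.
rewrite exp_lift_max mxE lift_max0; apply/esym/eqP.
by rewrite -subr_eq0; apply/eqP.
Qed.

Lemma exponential_setE : @exponential_set R K iota n = zero_set (range ev).
Proof. by rewrite /exponential_set exp_ringE. Qed.

Lemma algebraic_setE N : @algebraic_set R K iota N = zero_set (range (peval iota)).
Proof. by rewrite /algebraic_set poly_ringE. Qed.

Lemma exponential_set_lift (W : set 'rV[R]_n.+2) : algebraic_set iota W ->
  exponential_set iota [set x | W (exp_lift x)].
Proof.
rewrite algebraic_setE exponential_setE => /zero_set_zeros[qs ->].
by apply/zero_set_zeros; exists qs.
Qed.

Lemma algebraic_at_X1_zero (Z : set pt) : exponential_set iota Z ->
  Z `<=` Zer [:: @X1 R n] -> algebraic_set iota Z.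
Proof.
rewrite exponential_setE algebraic_setE => /zero_set_zeros[qs ->] Z0.
have /choice[s sP] : forall Q : {mpoly K[n.+2]}, exists Q' : {mpoly K[n.+1]},
    forall x : pt, X1 x = 0 -> peval iota Q' x = ev Q x.
  move=> Q; elim: (gen_mpoly Q) => [a|i _|p q _ [p' IHp] _ [q' IHq]|p q _ [p' IHp] _ [q' IHq]].
  - by exists (mpoly_const a) => x _; rewrite /exp_eval !pevalC.
  - case: (unliftP ord_max i) => [j ->|->].
      by exists (mpoly_var j) => x _; rewrite /exp_eval !peval_var exp_lift_lift.
    by exists 1 => x x0; rewrite /exp_eval peval1 peval_var exp_lift_max -/(X1 x) x0 expR0.
  - by exists (p' + q') => x x0; rewrite pevalD exp_evalD IHp// IHq.
  - by exists (p' * q') => x x0; rewrite pevalM exp_evalM IHp// IHq.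
apply/zero_set_zeros; exists (mpoly_var ord0 :: map s qs).
apply/seteqP; split=> [x Zx q|x Zx q qqs].
  have x0 : X1 x = 0 by exact: Z0 Zx 0%N isT.
  rewrite in_cons => /predU1P[->|/mapP[q' q'qs ->]]; first by rewrite peval_var.
  by rewrite sP//; apply: Zx.
have x0 : X1 x = 0 by have := Zx _ (mem_head _ _); rewrite peval_var.
by rewrite -sP//; apply: Zx; rewrite in_cons map_f ?orbT.
Qed.

Lemma exponential_component_sub (V Z : set pt) : irr_component (exponential_set iota) V Z ->
  irreducible (exponential_set iota) Z /\ Z `<=` V.
Proof. by move=> [C [_ irrC _ ->] CZ]; split; [exact: irrC|exact: bigcup_sup]. Qed.

(** The preimage of an algebraic set under [exp_lift] is an exponential set, so irreducibility of Z
    applies to the preimages of the components of W together with the hyperplane X_1 = 0. *)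
Lemma sub_algebraic_component (W : set 'rV[R]_n.+2) (Z : set pt) : algebraic_set iota W ->
  irreducible (exponential_set iota) Z -> ~ Z `<=` Zer [:: @X1 R n] ->
  (forall x, Z x -> W (exp_lift x) \/ X1 x = 0) ->
  exists2 Wi, irr_component (algebraic_set iota) W Wi & forall x, Z x -> Wi (exp_lift x).
Proof.
move=> aW irrZ nZ ZW.
have cI : forall V V' : set pt, exponential_set iota V -> exponential_set iota V' ->
    exponential_set iota (V `&` V').
  move=> V V'; rewrite exponential_setE; exact: zero_setI.
have cU : forall V V' : set pt, exponential_set iota V -> exponential_set iota V' ->
    exponential_set iota (V `|` V').
  move=> V V'; rewrite exponential_setE; apply: zero_setU; exact: exp_evalM.
have c0 : exponential_set iota (@set0 pt).
  by rewrite exponential_setE; apply: zero_set0; exact: exp_eval1.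
have [D dD] : exists D, irr_decomposition (algebraic_set iota) W D.
  apply: irr_decomposition_exists aW; rewrite algebraic_setE.
  apply: zero_set_dcc => [p q x|p q x|]; [exact: pevalD|exact: pevalM|exact: mpoly_noetherian].
have [fD irrD _ WD] := dD.
have cX : exponential_set iota (Zer [:: @X1 R n]).
  exists [:: ev (mpoly_var ord0)] => [[|//] _|]; first by exists (mpoly_var ord0).
  congr Zer; congr (_ :: _); apply/funext => x.
  by rewrite /exp_eval peval_var exp_lift0.
have [ZsW|//] : Z `<=` [set x | W (exp_lift x)] \/ Z `<=` Zer [:: @X1 R n].
  apply: (irreducible_sub_setU cI irrZ) => //; first exact: exponential_set_lift.
  by move=> x /ZW[|x0]; [left|right=> -[|//] _].
have [||_ [Wi DWi <-] ZWi] := irreducible_sub_bigcup (C := (fun Wi => [set x | Wi (exp_lift x)]) @` D)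
    cI cU c0 irrZ (finite_image _ fD).
- by move=> _ [Wi DWi <-]; apply: exponential_set_lift; have [] := irrD _ DWi.
- move=> x /ZsW; rewrite /= WD => -[Wi DWi Wix].
  by exists [set x | Wi (exp_lift x)]; [exists Wi|].
by exists Wi => //; exists D.
Qed.

Lemma admissible_cover (P : {mpoly K[n.+2]}) (W : set 'rV[R]_n.+2) x :
  admissible iota P W -> Zer [:: ev P] x -> W (exp_lift x) \/ X1 x = 0.
Proof.
move=> [_ -> _]; rewrite image_setU => -[|[w /(_ 1%N isT)/= w0 <-]].
  by rewrite proj_graph; left.
by right; rewrite /X1 mxE lift_max0.
Qed.

End AdmissibleSets.

Theorem theorem3p5 (R : realType) (K : fieldType) (iota : {rmorphism K -> R})
    (K_algebraic : forall a : K, algebraicOver (ratr : rat -> R) (iota a))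
    (n : nat) (P : {mpoly K[n.+2]})
    (V : set 'rV[R]_n.+1) (V_def : V = Zer [:: exp_eval iota P])
    (m : nat) (m_def : m = exp_dim iota V)
    (W : set 'rV[R]_n.+2) (W_adm : admissible iota P W)
    (Z : set 'rV[R]_n.+1)
    (Z_comp : irr_component (exponential_set iota) V Z)
    (Z_dim : exp_dim iota Z = m) :
  (exists2 Wi : set 'rV[R]_n.+2,
     irr_component (algebraic_set iota) W Wi & Z = proj_U1 @` (Wi `&` exp_graph))
  \/ (algebraic_set iota Z /\ Z `<=` Zer [:: @X1 R n]).
Proof.
have [irrZ ZV] := exponential_component_sub Z_comp.
have cZ : exponential_set iota Z by have [] := irrZ.
have [Z0|nZ] := pselect (Z `<=` Zer [:: @X1 R n]).
  by right; split=> //; exact: algebraic_at_X1_zero.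
have [aW _ dimW] := W_adm; left.
have [Wi Wi_comp ZWi] : exists2 Wi, irr_component (algebraic_set iota) W Wi &
    forall x, Z x -> Wi (exp_lift x).
  apply: sub_algebraic_component => // x /ZV; rewrite V_def.
  exact: admissible_cover.
exists Wi => //; rewrite proj_graph; apply/seteqP; split=> [x|x Wix]; first exact: ZWi.
apply: contrapT => nZx.
have [q qZ qx] : exists2 q, vanishing (exp_eval iota) Z q & exp_eval iota q x != 0.
  by apply: zero_set_separate nZx; rewrite -exponential_setE.
have qWi : ~ vanishing (peval iota) Wi q.
  by move=> /(_ _ Wix)/eqP; apply/negP.
have [T cT iT] := independent_exp_dim K_algebraic irrZ nZ.
(* This inclusion of ideals carries the independence of T from Z to Wi. *)
have WiZ Q : vanishing (peval iota) Wi Q -> vanishing (exp_eval iota) Z Q.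
  by move=> QWi y /ZWi; exact: QWi.
have [T' TT' maxT'] := max_independent_exists (independent_sub WiZ iT).
have : (#|T| < #|T'|)%N.
  rewrite proper_card// finset.properEneq TT' andbT; apply/eqP => TE.
  have pWi : prime_ideal (vanishing (peval iota) Wi).
    apply: vanishing_prime; [exact: peval1|exact: pevalD|exact: pevalM|].
    by rewrite -algebraic_setE; have [D [_ irrD _ _] /irrD] := Wi_comp.
  have Wi0 : vanishing (peval iota) Wi 0 by move=> y _; rewrite peval0.
  have [c [u [Tc c0 cu]]] := max_independent_eliminate pWi Wi0 maxT' (gen_mpoly q) qWi.
  move/eqP: c0; apply; apply: iT; first by rewrite TE.
  move=> y Zy; rewrite -(subrK (u * q) c) exp_evalD exp_evalM (qZ y Zy) mulr0 addr0.
  exact: WiZ cu y Zy.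
(* The contradiction is m + 1 <= |T| < |T'| <= dim W <= m + 1. *)
have := alg_dim_ge Wi_comp maxT'.
have : (alg_dim iota W <= m.+1)%N by rewrite m_def V_def.
move: cT; rewrite Z_dim; lia.
Qed.
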